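(* Let $(\mathcal{A},{}_{\alpha}\mathcal{A})$ and $(\mathcal{B},{}_{\beta}\mathcal{B})$ be objects such that $\mathcal{A}$ and $\mathcal{B}$ are stable and $\sigma$-unital, where $\alpha$ and $\beta$ are $*$-automorphisms of $\mathcal{A}$ and $\mathcal{B}$ respectively. Suppose $[{}_f\mathcal{B},\Phi_u]:(\mathcal{A},{}_{\alpha}\mathcal{A})\leftarrow(\mathcal{B},{}_{\beta}\mathcal{B})$ is a $1$-arrow between them. If $[{}_f\mathcal{B},\Phi_u]$ is homotopic to an equivalence $1$-arrow via a homotopy $(H,\Phi_H,h_0,h_1)$, then $f_{\rtimes u}:\mathcal{A}\rtimes_{\alpha}\mathbb{Z}\to\mathcal{B}\rtimes_{\beta}\mathbb{Z}$ is equivariantly homotopic to a $*$-isomorphism.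
   Context: Correspondences. For C*-algebras $\mathcal{A},\mathcal{B}$, an $\mathcal{A}-\mathcal{B}$ correspondence is a right Hilbert $\mathcal{B}$-module $X$ with a $*$-homomorphism $\phi_X:\mathcal{A}\to\mathcal{L}(X)$ into the adjointable operators, always assumed non-degenerate ($\phi_X(\mathcal{A})X=X$). It is full if the inner products span a dense subspace of $\mathcal{B}$, proper if $\phi_X(\mathcal{A})\subseteq\mathcal{K}(X)$, regular if proper and $\phi_X$ is injective. A unitary correspondence isomorphism is an inner-product-preserving surjective bimodule map. Tensor products are interior, and associativity isomorphisms are suppressed. Bicategory $\mathfrak{C}^{\mathbb{N}}_{\mathrm{pr}}$. Objects: pairs $(\mathcal{A},X)$ with $X$ a full regular correspondence over $\mathcal{A}$. A 1-arrow $[F,\Phi_F]:(\mathcal{B},Y)\leftarrow(\mathcal{A},X)$ is a full proper $\mathcal{B}-\mathcal{A}$ correspondence $F$ with a unitary correspondence isomorphism $\Phi_F:Y\otimes_{\mathcal{B}}F\to F\otimes_{\mathcal{A}}X$; it is an equivalence 1-arrow if $F$ is an imprimitivity bimodule (i.e. full with left action an isomorphism onto $\mathcal{K}(F)$). A 2-arrow $[F,\Phi_F]\to[G,\Phi_G]$ is a unitary correspondence isomorphism $\Psi:F\to G$ with $(\Psi\otimes1_X)\Phi_F=\Phi_G(1_Y\otimes\Psi)$. Composition of 1-arrows: $[G,\Phi_G]\otimes[F,\Phi_F]=[G\otimes F,\Phi_G\odot\Phi_F]$, $\Phi_G\odot\Phi_F=(1_G\otimes\Phi_F)(\Phi_G\otimes1_F)$.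 Homotopy. Let $I=[0,1]$. $C(I,X)$ is the natural correspondence over $C(I,\mathcal{A})$. For $t\in I$, $\mathcal{A}_t$ is the $C(I,\mathcal{A})-\mathcal{A}$ correspondence $\mathcal{A}$ with left action $f\cdot a=f(t)a$, and $\mathrm{ev}_t=[\mathcal{A}_t,\eta_t]:(C(I,\mathcal{A}),C(I,X))\leftarrow(\mathcal{A},X)$ with $\eta_t$ the canonical unitary isomorphism $C(I,X)\otimes_{C(I,\mathcal{A})}\mathcal{A}_t\to\mathcal{A}_t\otimes_{\mathcal{A}}X$ (both sides identified with $X$, via $f\otimes a\mapsto f(t)a$). For a 1-arrow $[H,\Phi_H]:(\mathcal{B},Y)\leftarrow(C(I,\mathcal{A}),C(I,X))$ put $[H_t,\Phi_{H_t}]=[H,\Phi_H]\otimes\mathrm{ev}_t$. A homotopy $(H,\Phi_H,h_0,h_1)$ from $[F,\Phi_F]$ to $[G,\Phi_G]$ (1-arrows $(\mathcal{B},Y)\leftarrow(\mathcal{A},X)$) consists of such $[H,\Phi_H]$ with 2-arrows $h_0:[H_0,\Phi_{H_0}]\to[F,\Phi_F]$ and $h_1:[H_1,\Phi_{H_1}]\to[G,\Phi_G]$. Homomorphism correspondences. For a non-degenerate $*$-homomorphism $f:\mathcal{A}\to\mathcal{B}$ ($f(\mathcal{A})\mathcal{B}$ dense in $\mathcal{B}$), ${}_f\mathcal{B}$ is $\mathcal{B}$ as a right Hilbert module over itself with left action $a\cdot b=f(a)b$. For $f:\mathcal{A}\to\mathcal{B}$, $g:\mathcal{B}\to\mathcal{C}$,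 $\Psi:{}_f\mathcal{B}\otimes_{\mathcal{B}}{}_g\mathcal{C}\to{}_{g\circ f}\mathcal{C}$ is the unitary correspondence isomorphism $\Psi(b\otimes c)=g(b)c$. For a unitary $u$ in the multiplier algebra $\mathcal{M}(\mathcal{B})$, $M_u(b)=ub$. If $\beta(f(a))=uf(\alpha(a))u^*$ for all $a\in\mathcal{A}$, let $\Phi_u=\Psi^{-1}\circ M_u\circ\Psi:{}_{\alpha}\mathcal{A}\otimes{}_f\mathcal{B}\to{}_f\mathcal{B}\otimes{}_{\beta}\mathcal{B}$ (via ${}_{f\circ\alpha}\mathcal{B}\to{}_{\beta\circ f}\mathcal{B}$), giving the 1-arrow $[{}_f\mathcal{B},\Phi_u]$; every 1-arrow $({}_f\mathcal{B},\Phi)$ between such objects is of this form. Crossed products. $S_{\alpha}$ denotes the canonical unitary of $\mathcal{A}\rtimes_{\alpha}\mathbb{Z}$ (in its multiplier algebra), with the convention $aS_{\alpha}=S_{\alpha}\alpha(a)$. $f_{\rtimes u}:\mathcal{A}\rtimes_{\alpha}\mathbb{Z}\to\mathcal{B}\rtimes_{\beta}\mathbb{Z}$ is the $*$-homomorphism with $f_{\rtimes u}|_{\mathcal{A}}=f$ and $f_{\rtimes u}(S_{\alpha}a)=S_{\beta}uf(a)$; it is equivariant for the dual $\mathbb{T}$-actions (which fix $\mathcal{A}$, $\mathcal{B}$ and multiply $S_\alpha$, $S_\beta$ by $z$). Equivariantly homotopic means homotopic through a point-norm continuous path of $*$-homomorphisms equivariant for the dual $\mathbb{T}$-actions. *)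

(* Defs.v *)
From HB Require Import structures.
From mathcomp Require Import all_boot all_order all_algebra.
From mathcomp Require Import complex.
From mathcomp Require Import all_classical all_reals all_analysis.
Set Implicit Arguments.
Unset Strict Implicit.
Unset Printing Implicit Defensive.
Import Order.TTheory GRing.Theory Num.Theory.
Import numFieldNormedType.Exports.
Local Open Scope classical_set_scope.
Local Open Scope ring_scope.
Local Open Scope complex_scope.

(* The scalars are the complex numbers R[i] over an arbitrary [R : realType].
   Interior tensor products, C([0,1],A), C([0,1],X), A (x) K and crossed
   products are given by records bundling a realization, its structure maps
   and the properties that determine these up to a unique isomorphism. *)

(** * C*-algebras *)

Record cstarAlg (R : realType) := CStarAlg {
  calg :> completeNormedModType R[i];
  cmul : calg -> calg -> calg;
  star : calg -> calg;
  cmulA : forall a b c, cmul a (cmul b c) = cmul (cmul a b) c;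
  cmul_linl : forall (k : R[i]) a b c,
    cmul (k *: a + b) c = k *: cmul a c + cmul b c;
  cmul_linr : forall (k : R[i]) a b c,
    cmul c (k *: a + b) = k *: cmul c a + cmul c b;
  starK : forall a, star (star a) = a;
  star_antilin : forall (k : R[i]) a b,
    star (k *: a + b) = k^* *: star a + star b;
  starM : forall a b, star (cmul a b) = cmul (star b) (star a);
  cmul_norm : forall a b, `|cmul a b| <= `|a| * `|b|;
  cstar_norm : forall a, `|cmul (star a) a| = `|a| ^+ 2
}.

Definition cpos (R : realType) (A : cstarAlg R) (a : A) : Prop :=
  exists b : A, a = cmul (star b) b.

(* Star-homomorphisms between C*-algebras; continuity is automatic. *)
Record starHom (R : realType) (A B : cstarAlg R) := StarHom {
  sfun :> A -> B;
  sfun_lin : linear sfun;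
  sfunM : forall a b, sfun (cmul a b) = cmul (sfun a) (sfun b);
  sfunS : forall a, sfun (star a) = star (sfun a)
}.

Lemma starHom_comp_lin (R : realType) (A B C : cstarAlg R)
  (g : starHom B C) (f : starHom A B) : linear (fun a => g (f a)).
Proof. by move=> k a b; rewrite !sfun_lin. Qed.

Lemma starHom_compM (R : realType) (A B C : cstarAlg R)
  (g : starHom B C) (f : starHom A B) (a b : A) :
  g (f (cmul a b)) = cmul (g (f a)) (g (f b)).
Proof. by rewrite !sfunM. Qed.

Lemma starHom_compS (R : realType) (A B C : cstarAlg R)
  (g : starHom B C) (f : starHom A B) (a : A) :
  g (f (star a)) = star (g (f a)).
Proof. by rewrite !sfunS. Qed.

Definition starHom_comp (R : realType) (A B C : cstarAlg R)
    (g : starHom B C) (f : starHom A B) : starHom A C :=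
  StarHom (starHom_comp_lin g f) (starHom_compM g f) (starHom_compS g f).

Definition lin_span (R : realType) (V : completeNormedModType R[i])
    (S : set V) : set V :=
  [set v | exists (n : nat) (c : 'I_n -> R[i]) (g : 'I_n -> V),
     (forall i, S (g i)) /\ v = \sum_(i < n) c i *: g i].

Definition sigma_unital (R : realType) (A : cstarAlg R) : Prop :=
  exists e : nat -> A,
    [/\ forall n, cpos (e n),
        forall n, `|e n| <= 1,
        forall n, cpos (e n.+1 - e n),
        forall a, (fun n => cmul (e n) a) @ \oo --> a &
        forall a, (fun n => cmul a (e n)) @ \oo --> a].

(* A realization of A (x) K, where K is the algebra of compact operators on
   l^2(N): [mxu i j a] stands for a (x) e_ij, with (e_ij) the matrix units. *)
Record stabilization (R : realType) (A : cstarAlg R) := Stabilization {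
  stab :> cstarAlg R;
  mxu : nat -> nat -> A -> stab;
  mxu_lin : forall i j, linear (mxu i j);
  mxuM : forall i j k l a b,
    cmul (mxu i j a) (mxu k l b) = if j == k then mxu i l (cmul a b) else 0;
  mxuS : forall i j a, star (mxu i j a) = mxu j i (star a);
  mxu_inj : injective (mxu 0%N 0%N);
  mxu_dense : dense (lin_span [set x | exists i j a, x = mxu i j a])
}.

Definition stable (R : realType) (A : cstarAlg R) : Prop :=
  exists (D : stabilization A) (g : starHom A D), bijective g.

(** * Hilbert modules and adjointable operators *)

Record hilbMod (R : realType) (B : cstarAlg R) := HilbMod {
  hmod :> completeNormedModType R[i];
  ract : hmod -> B -> hmod;
  ip : hmod -> hmod -> B;
  ract_linl : forall (k : R[i]) x y b,
    ract (k *: x + y) b = k *: ract x b + ract y b;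
  ract_linr : forall (k : R[i]) x b c,
    ract x (k *: b + c) = k *: ract x b + ract x c;
  ractA : forall x b c, ract (ract x b) c = ract x (cmul b c);
  ip_linr : forall (k : R[i]) x y z, ip x (k *: y + z) = k *: ip x y + ip x z;
  ip_ract : forall x y b, ip x (ract y b) = cmul (ip x y) b;
  ip_star : forall x y, star (ip x y) = ip y x;
  ip_pos : forall x, cpos (ip x x);
  ip_norm : forall x, `|x| ^+ 2 = `|ip x x|
}.

(* Linearity, B-linearity and boundedness follow from [adjointP]. *)
Record adjointable (R : realType) (B : cstarAlg R) (X : hilbMod B) :=
  Adjointable {
    aop :> X -> X;
    aadj : X -> X;
    adjointP : forall x y, ip (aop x) y = ip x (aadj y)
  }.

Definition unitary_op (R : realType) (B : cstarAlg R) (X : hilbMod B)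
    (u : adjointable X) : Prop := cancel u (aadj u) /\ cancel (aadj u) u.

(* Membership in K(X), the operator-norm closure of the span of the rank one
   operators z |-> x <y,z>. *)
Definition compact_op (R : realType) (B : cstarAlg R) (X : hilbMod B)
    (T : X -> X) : Prop :=
  forall e : R, 0 < e ->
    exists (n : nat) (x y : 'I_n -> X),
      forall z, `|T z - \sum_(i < n) ract (x i) (ip (y i) z)| <= e%:C * `|z|.

Definition hfull (R : realType) (B : cstarAlg R) (X : hilbMod B) : Prop :=
  dense (lin_span [set b : B | exists x y : X, b = ip x y]).

Section self_module.
Context (R : realType) (B : cstarAlg R).

Lemma self_ip_linr (k : R[i]) (x y z : B) :
  cmul (star x) (k *: y + z) = k *: cmul (star x) y + cmul (star x) z.
Proof. exact: cmul_linr. Qed.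

Lemma self_ip_star (x y : B) : star (cmul (star x) y) = cmul (star y) x.
Proof. by rewrite starM starK. Qed.

Lemma self_ip_pos (x : B) : cpos (cmul (star x) x).
Proof. by exists x. Qed.

Definition self_mod : hilbMod B :=
  @HilbMod R B B (@cmul R B) (fun x y => cmul (star x) y)
    (fun k x y b => cmul_linl k x y b) (fun k x b c => cmul_linr k b c x)
    (fun x b c => esym (cmulA x b c)) self_ip_linr
    (fun x y b => cmulA (star x) y b) self_ip_star self_ip_pos
    (fun x => esym (cstar_norm x)).

End self_module.

(* The multiplier algebra M(B), realized as L(B_B). *)
Definition multiplier (R : realType) (B : cstarAlg R) : Type :=
  adjointable (self_mod B).

(** * Correspondences *)

(* By [lactS], lact a is adjointable with adjoint lact (star a), so lact is a
   star-homomorphism from A to L(X).  Non-degeneracy is kept as a separate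
   predicate, which [is_object] and [one_arrow] impose. *)
Record corr (R : realType) (A B : cstarAlg R) := Corr {
  cmod :> hilbMod B;
  lact : A -> cmod -> cmod;
  lact_lin : forall (k : R[i]) a b x,
    lact (k *: a + b) x = k *: lact a x + lact b x;
  lactM : forall a b x, lact (cmul a b) x = lact a (lact b x);
  lactS : forall a x y, ip (lact a x) y = ip x (lact (star a) y)
}.

Definition nondegenerate (R : realType) (A B : cstarAlg R) (X : corr A B) :
  Prop := forall x : X, exists (a : A) (y : X), x = lact a y.

Definition proper (R : realType) (A B : cstarAlg R) (X : corr A B) : Prop :=
  forall a : A, compact_op (@lact R A B X a).

Definition left_injective (R : realType) (A B : cstarAlg R) (X : corr A B) :
  Prop := forall a b : A, (forall x : X, lact a x = lact b x) -> a = b.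

Definition regular (R : realType) (A B : cstarAlg R) (X : corr A B) : Prop :=
  proper X /\ left_injective X.

Definition imprimitivity (R : realType) (A B : cstarAlg R) (X : corr A B) :
  Prop :=
  [/\ hfull X, proper X, left_injective X &
      forall T : X -> X, compact_op T -> exists a : A, forall x, T x = lact a x].

Definition unitary_iso (R : realType) (A B : cstarAlg R) (X Y : corr A B)
    (U : X -> Y) : Prop :=
  [/\ linear U,
      forall (a : A) x, U (lact a x) = lact a (U x),
      forall x (b : B), U (ract x b) = ract (U x) b,
      forall x y, ip (U x) (U y) = ip x y &
      forall y, exists x, U x = y].

Section pull.
Context (R : realType) (A B C : cstarAlg R) (f : starHom A B) (X : corr B C).

Lemma pull_lin (k : R[i]) (a b : A) (x : X) :
  lact (f (k *: a + b)) x = k *: lact (f a) x + lact (f b) x.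
Proof. by rewrite sfun_lin lact_lin. Qed.

Lemma pullM (a b : A) (x : X) :
  lact (f (cmul a b)) x = lact (f a) (lact (f b) x).
Proof. by rewrite sfunM lactM. Qed.

Lemma pullS (a : A) (x y : X) :
  ip (lact (f a) x) y = ip x (lact (f (star a)) y).
Proof. by rewrite sfunS lactS. Qed.

(* X with left action precomposed with f. *)
Definition pull : corr A C := Corr pull_lin pullM pullS.

End pull.

Lemma id_corrS (R : realType) (B : cstarAlg R) (a : B) (x y : self_mod B) :
  @ip R B (self_mod B) (cmul a x) y = @ip R B (self_mod B) x (cmul (star a) y).
Proof. by rewrite /ip /= starM cmulA. Qed.

Definition id_corr (R : realType) (B : cstarAlg R) : corr B B :=
  @Corr R B B (self_mod B) (@cmul R B)
    (fun k a b x => cmul_linl k a b x) (fun a b x => esym (cmulA a b x))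
    (@id_corrS R B).

(* The correspondence _f B. *)
Definition hom_corr (R : realType) (A B : cstarAlg R) (f : starHom A B) :
  corr A B := pull f (id_corr B).

(** * Interior tensor products *)

(* A realization of the interior tensor product of X and Y over B.
   Bilinearity, B-balancedness and compatibility with the right action of
   [tens] follow from [tens_ip]. *)
Record tensor (R : realType) (A B C : cstarAlg R)
    (X : corr A B) (Y : corr B C) := Tensor {
  tcorr :> corr A C;
  tens : X -> Y -> tcorr;
  tens_ip : forall x x' y y',
    ip (tens x y) (tens x' y') = ip y (lact (ip x x') y');
  tens_lact : forall a x y, lact a (tens x y) = tens (lact a x) y;
  tens_dense : dense (lin_span [set w | exists x y, w = tens x y])
}.

(* m is the unitary U (x) V. *)
Definition is_tensor_map (R : realType) (A B C : cstarAlg R)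
    (X X' : corr A B) (Y Y' : corr B C) (T : tensor X Y) (T' : tensor X' Y')
    (U : X -> X') (V : Y -> Y') (m : T -> T') : Prop :=
  unitary_iso m /\
  forall x y, m (tens T x y) = tens T' (U x) (V y).

(* m is the associativity isomorphism from (X (x) Y) (x) Z to
   X (x) (Y (x) Z). *)
Definition is_assoc (R : realType) (A B C D : cstarAlg R)
    (X : corr A B) (Y : corr B C) (Z : corr C D)
    (XY : tensor X Y) (XY_Z : tensor XY Z)
    (YZ : tensor Y Z) (X_YZ : tensor X YZ) (m : XY_Z -> X_YZ) : Prop :=
  unitary_iso m /\
  forall x y z, m (tens XY_Z (tens XY x y) z) = tens X_YZ x (tens YZ y z).

(** * The bicategory *)

Definition is_object (R : realType) (A : cstarAlg R) (X : corr A A) : Prop :=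
  [/\ nondegenerate X, hfull X & regular X].

(* [one_arrow Y X F]: the ways of making F a 1-arrow (B,Y) <- (A,X). *)
Record one_arrow (R : realType) (B A : cstarAlg R)
    (Y : corr B B) (X : corr A A) (F : corr B A) := OneArrow {
  oa_nondegenerate : nondegenerate F;
  oa_full : hfull F;
  oa_proper : proper F;
  oa_YF : tensor Y F;
  oa_FX : tensor F X;
  oa_Phi : oa_YF -> oa_FX;
  oa_unitary : unitary_iso oa_Phi
}.

Record two_arrow (R : realType) (B A : cstarAlg R)
    (Y : corr B B) (X : corr A A) (F G : corr B A)
    (PF : one_arrow Y X F) (PG : one_arrow Y X G) := TwoArrow {
  ta_Psi : F -> G;
  ta_unitary : unitary_iso ta_Psi;
  ta_Psi1 : oa_FX PF -> oa_FX PG;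
  ta_Psi1P : is_tensor_map ta_Psi (fun x : X => x) ta_Psi1;
  ta_1Psi : oa_YF PF -> oa_YF PG;
  ta_1PsiP : is_tensor_map (fun y : Y => y) ta_Psi ta_1Psi;
  ta_square : forall w, ta_Psi1 (oa_Phi w) = oa_Phi (ta_1Psi w)
}.

(* [is_composite PG PF PGF]: PGF is the composite of PG and PF on the
   realization GF of G (x) F, that is, Phi_GF = (1 (x) Phi_F)(Phi_G (x) 1) up
   to the associativity isomorphisms a1, a2, a3. *)
Definition is_composite (R : realType) (C B A : cstarAlg R)
    (Z : corr C C) (Y : corr B B) (X : corr A A)
    (G : corr C B) (F : corr B A)
    (PG : one_arrow Z Y G) (PF : one_arrow Y X F)
    (GF : tensor G F) (PGF : one_arrow Z X GF) : Prop :=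
  exists (ZG_F : tensor (oa_YF PG) F) (GY_F : tensor (oa_FX PG) F)
         (G_YF : tensor G (oa_YF PF)) (G_FX : tensor G (oa_FX PF))
         (a1 : ZG_F -> oa_YF PGF) (m1 : ZG_F -> GY_F) (a2 : GY_F -> G_YF)
         (m2 : G_YF -> G_FX) (a3 : oa_FX PGF -> G_FX),
    [/\ is_assoc a1, is_assoc a2 & is_assoc a3] /\
    [/\ is_tensor_map (@oa_Phi _ _ _ _ _ _ PG) (fun f : F => f) m1,
        is_tensor_map (fun g : G => g) (@oa_Phi _ _ _ _ _ _ PF) m2 &
        forall w, a3 (oa_Phi (a1 w)) = m2 (a2 (m1 w))].

(** * Homotopies *)

(* A realization of C([0,1],A): the elements correspond bijectively to the
   continuous functions from [0,1] to A, with pointwise operations.  The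
   values of [pa_ev] outside [0,1] are irrelevant. *)
Record path_alg (R : realType) (A : cstarAlg R) := PathAlg {
  pa_alg :> cstarAlg R;
  pa_ev : R -> starHom pa_alg A;
  pa_cont : forall f : pa_alg,
    {within `[0, 1]%classic, continuous (fun t : R => pa_ev t f)};
  pa_inj : forall f g : pa_alg,
    (forall t, t \in `[0, 1] -> pa_ev t f = pa_ev t g) -> f = g;
  pa_surj : forall g : R -> A, {within `[0, 1]%classic, continuous g} ->
    exists f : pa_alg, forall t, t \in `[0, 1] -> pa_ev t f = g t
}.

(* A realization of the correspondence C([0,1],X) over C([0,1],A). *)
Record path_corr (R : realType) (A : cstarAlg R) (IA : path_alg A)
    (X : corr A A) := PathCorr {
  pc_corr :> corr IA IA;
  pc_ev : R -> pc_corr -> X;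
  pc_lin : forall t, t \in `[0, 1] -> linear (pc_ev t);
  pc_lact : forall t, t \in `[0, 1] -> forall (f : IA) (x : pc_corr),
    pc_ev t (lact f x) = lact (pa_ev IA t f) (pc_ev t x);
  pc_ract : forall t, t \in `[0, 1] -> forall (x : pc_corr) (f : IA),
    pc_ev t (ract x f) = ract (pc_ev t x) (pa_ev IA t f);
  pc_ip : forall t, t \in `[0, 1] -> forall x y : pc_corr,
    pa_ev IA t (ip x y) = ip (pc_ev t x) (pc_ev t y);
  pc_cont : forall x : pc_corr,
    {within `[0, 1]%classic, continuous (fun t : R => pc_ev t x)};
  pc_inj : forall x y : pc_corr,
    (forall t, t \in `[0, 1] -> pc_ev t x = pc_ev t y) -> x = y;
  pc_surj : forall g : R -> X, {within `[0, 1]%classic, continuous g} ->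
    exists x : pc_corr, forall t, t \in `[0, 1] -> pc_ev t x = g t
}.

(* P is [A_t, eta_t], where A_t = hom_corr (pa_ev IA t): after identifying
   C(I,X) (x) A_t with X by i1 : x (x) a |-> x(t) a, and A_t (x) X with X by
   i2 : a (x) x |-> a x, the map eta_t is the identity. *)
Definition is_ev (R : realType) (A : cstarAlg R) (IA : path_alg A)
    (X : corr A A) (IX : path_corr IA X) (t : R)
    (P : one_arrow IX X (hom_corr (pa_ev IA t))) : Prop :=
  exists (i1 : oa_YF P -> pull (pa_ev IA t) X)
         (i2 : oa_FX P -> pull (pa_ev IA t) X),
    [/\ unitary_iso i1 /\ unitary_iso i2,
        forall (x : IX) (a : A),
          i1 (tens (oa_YF P) x a) = ract (pc_ev t x) a,
        forall (a : A) (x : X), i2 (tens (oa_FX P) a x) = lact a x &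
        forall w, i2 (oa_Phi w) = i1 w].

(* A realization of [H_t, Phi_(H_t)], the composite of [H, Phi_H] and ev_t. *)
Record fibre (R : realType) (B A : cstarAlg R) (Y : corr B B) (X : corr A A)
    (IA : path_alg A) (IX : path_corr IA X) (H : corr B IA)
    (PH : one_arrow Y IX H) (t : R) := Fibre {
  fib_ev : one_arrow IX X (hom_corr (pa_ev IA t));
  fib_evP : is_ev fib_ev;
  fib_corr : tensor H (hom_corr (pa_ev IA t));
  fib_arrow : one_arrow Y X fib_corr;
  fib_composite : is_composite PH fib_ev fib_arrow
}.

Record homotopy (R : realType) (B A : cstarAlg R)
    (Y : corr B B) (X : corr A A) (F G : corr B A)
    (PF : one_arrow Y X F) (PG : one_arrow Y X G) := Homotopy {
  ho_IA : path_alg A;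
  ho_IX : path_corr ho_IA X;
  ho_H : corr B ho_IA;
  ho_PH : one_arrow Y ho_IX ho_H;
  ho_fib0 : fibre ho_PH 0;
  ho_fib1 : fibre ho_PH 1;
  ho_h0 : two_arrow (fib_arrow ho_fib0) PF;
  ho_h1 : two_arrow (fib_arrow ho_fib1) PG
}.

(** * The 1-arrows [_f B, Phi_u] *)

Definition hom_nondegenerate (R : realType) (A B : cstarAlg R)
    (f : starHom A B) : Prop :=
  dense (lin_span [set x : B | exists a b, x = cmul (f a) b]).

(* beta(f(a)) = u f(alpha(a)) u^* in M(B). *)
Definition intertwines (R : realType) (A B : cstarAlg R)
    (alpha : starHom A A) (beta : starHom B B) (f : starHom A B)
    (u : multiplier B) : Prop :=
  forall (a : A) (b : B),
    cmul (beta (f a)) b = u (cmul (f (alpha a)) (aadj u b)).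

(* The structure map of P is Phi_u: it becomes b |-> u b under
   Psi1 : _alpha A (x) _f B -> _(f alpha) B, a (x) b |-> f(a) b, and
   Psi2 : _f B (x) _beta B -> _(beta f) B, b (x) b' |-> beta(b) b'. *)
Definition is_Phi_u (R : realType) (A B : cstarAlg R)
    (alpha : starHom A A) (beta : starHom B B) (f : starHom A B)
    (u : multiplier B)
    (P : one_arrow (hom_corr alpha) (hom_corr beta) (hom_corr f)) : Prop :=
  exists (Psi1 : oa_YF P -> hom_corr (starHom_comp f alpha))
         (Psi2 : oa_FX P -> hom_corr (starHom_comp beta f)),
    [/\ unitary_iso Psi1 /\ unitary_iso Psi2,
        forall (a : A) (b : B), Psi1 (tens (oa_YF P) a b) = cmul (f a) b,
        forall b b' : B, Psi2 (tens (oa_FX P) b b') = cmul (beta b) b' &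
        forall w, Psi2 (oa_Phi w) = u (Psi1 w)].

(** * Crossed products by Z *)

(* A realization of the crossed product of A by Z, universal for covariant
   pairs with the convention a S = S alpha(a). *)
Record crossed_product (R : realType) (A : cstarAlg R)
    (alpha : starHom A A) := CrossedProduct {
  cp_alg :> cstarAlg R;
  cp_in : starHom A cp_alg;
  cp_S : multiplier cp_alg;
  cp_unitary : unitary_op cp_S;
  cp_covariant : forall (a : A) (x : cp_alg),
    cmul (cp_in a) (cp_S x) = cp_S (cmul (cp_in (alpha a)) x);
  cp_nondegenerate : hom_nondegenerate cp_in;
  cp_dense : dense (lin_span [set x : cp_alg | exists (n : nat) (a : A),
    x = iter n cp_S (cp_in a) \/ x = iter n (aadj cp_S) (cp_in a)]);
  cp_universal : forall (D : cstarAlg R) (p : starHom A D) (V : multiplier D),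
    unitary_op V ->
    (forall (a : A) (x : D), cmul (p a) (V x) = V (cmul (p (alpha a)) x)) ->
    exists L : starHom cp_alg D,
      (forall a, L (cp_in a) = p a) /\ (forall x, L (cp_S x) = V (L x))
}.

Definition is_dual_action (R : realType) (A : cstarAlg R)
    (alpha : starHom A A) (P : crossed_product alpha)
    (gamma : R[i] -> starHom P P) : Prop :=
  forall z : R[i], `|z| = 1 ->
    (forall a, gamma z (cp_in P a) = cp_in P a) /\
    (forall x, gamma z (cp_S P x) = z *: cp_S P (gamma z x)).

(* g is f_(x| u). *)
Definition is_crossed_hom (R : realType) (A B : cstarAlg R)
    (alpha : starHom A A) (beta : starHom B B) (f : starHom A B)
    (u : multiplier B)
    (PA : crossed_product alpha) (PB : crossed_product beta)
    (g : starHom PA PB) : Prop :=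
  (forall a, g (cp_in PA a) = cp_in PB (f a)) /\
  (forall a, g (cp_S PA (cp_in PA a)) = cp_S PB (cp_in PB (u (f a)))).

Definition equivariant (R : realType) (P Q : cstarAlg R)
    (gammaP : R[i] -> starHom P P) (gammaQ : R[i] -> starHom Q Q)
    (g : starHom P Q) : Prop :=
  forall z : R[i], `|z| = 1 -> forall x, g (gammaP z x) = gammaQ z (g x).

Definition equivariantly_homotopic (R : realType) (P Q : cstarAlg R)
    (gammaP : R[i] -> starHom P P) (gammaQ : R[i] -> starHom Q Q)
    (g0 g1 : starHom P Q) : Prop :=
  exists phi : R -> starHom P Q,
    [/\ forall x, {within `[0, 1]%classic, continuous (fun t : R => phi t x)},
        forall t, t \in `[0, 1] -> equivariant gammaP gammaQ (phi t),
        forall x, phi 0 x = g0 x &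
        forall x, phi 1 x = g1 x].

(* Main.v *)
Require Import Defs.
From HB Require Import structures.
From mathcomp Require Import all_boot all_order all_algebra.
From mathcomp Require Import complex.
From mathcomp Require Import all_classical all_reals all_analysis.
From mathcomp Require Import ring lra zify.
Set Implicit Arguments.
Unset Strict Implicit.
Unset Printing Implicit Defensive.
Import Order.TTheory GRing.Theory Num.Theory.
Import numFieldNormedType.Exports.
Local Open Scope classical_set_scope.
Local Open Scope ring_scope.
Local Open Scope complex_scope.

(** Let H be the homotopy, an A - C([0,1],B) correspondence, and D = C([0,1],B).
    Stability and sigma-unitality give approximate matrix units in A and D.
    Together with fullness and properness they yield a vector x of H such that
    x D is dense in H and <x,H> is dense in D, and the polar decomposition
    |x| d |-> x d is then a unitary of Hilbert modules D ~ H.  Through it the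
    left action becomes a path of homomorphisms h_t : A -> B and Phi_H a
    strictly continuous path of unitaries u_t of M(B) with
    beta(h_t(a)) u_t = u_t h_t(alpha(a)).  Correcting the trivialization by a
    constant unitary of M(B) gives h_0 = f and u_0 = u, whereas h_1 is an
    isomorphism because H_1 is an imprimitivity bimodule.  The homomorphisms
    a |-> h_t(a), S_alpha |-> S_beta u_t form the required homotopy.

    The C*-algebraic input (contractivity of star-homomorphisms, positivity of
    b^* b, the supremum norm on C([0,1],B)) is obtained without spectral theory
    from square roots, computed by iteration: if a = a^* and a ^ 2 + c ^ 2 = 1
    with c = c^* commuting with a, then a + i c is unitary, so |a| <= 1. *)

(** Maps are built by one extension principle, [umap_extension]: two families with dense spans and
    equal Gram matrices are exchanged by a unitary. It yields the trivialization, the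
    identifications of tensor products, the unitary behind the path u_t and the extensions of
    multipliers to crossed products.

    The obstacle is the vector x. It encodes countably many generators of H as entries of an
    infinite matrix, with rows indexed by the matrix units of A and columns by those of D. Every
    datum recurs infinitely often, and the weights decrease so fast that cutting x with a unit of
    index N isolates a single entry up to an error of order 1/N. Since A and D need not have units,
    e_ij (x) 1 is in general only a multiplier, and e_ij (x) eps_k takes its place.

    A trivialization is determined only up to a unitary of M(D). Normalizing it by the 2-arrow at t
    = 0 makes the path start exactly at f and u, whereas at t = 1 bijectivity of h_1 is enough. *)

(** * Linear identities in a module, by reflection *)

Inductive lexp (K : Type) :=
  | LVar of nat | LZero | LAdd of lexp K & lexp K | LOpp of lexp K
  | LScale of K & lexp K.

Fixpoint lval (K : pzRingType) (V : lmodType K) (env : seq V) (e : lexp K) : V :=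
  match e with
  | LVar i => nth 0 env i
  | LZero => 0
  | LAdd a b => lval env a + lval env b
  | LOpp a => - lval env a
  | LScale k a => k *: lval env a
  end.

Fixpoint lcoef (K : pzRingType) (e : lexp K) (i : nat) : K :=
  match e with
  | LVar j => if eqn i j then 1 else 0
  | LZero => 0
  | LAdd a b => lcoef a i + lcoef b i
  | LOpp a => - lcoef a i
  | LScale k a => k * lcoef a i
  end.

(** A conjunction computed by recursion instead of a quantified statement, so that [cbv] leaves one
    explicit scalar equation per atom. *)
Fixpoint lsame (K : pzRingType) (e1 e2 : lexp K) (n : nat) : Prop :=
  if n is m.+1 then lcoef e1 m = lcoef e2 m /\ lsame e1 e2 m else True.

Lemma lvalE (K : pzRingType) (V : lmodType K) (env : seq V) (e : lexp K) :
  lval env e = \sum_(i < size env) lcoef e i *: nth 0 env i.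
Proof.
elim: e => [j||a IHa b IHb|a IHa|k a IHa] /=; rewrite ?IHa ?IHb.
- case: (ltnP j (size env)) => [lj|gj].
    rewrite (bigD1 (Ordinal lj)) //= eqnE eqxx scale1r big1 ?addr0 // => i ne.
    rewrite ifF ?scale0r //; apply/negP => /eqP e.
    by case/eqP: ne; apply/val_inj.
  rewrite nth_default // big1 // => i _; rewrite ifF ?scale0r //.
  by apply/negP => /eqP e; move: (ltn_ord i); rewrite e ltnNge gj.
- by rewrite big1 // => i _; rewrite scale0r.
- by rewrite -big_split; apply: eq_bigr => i _; rewrite scalerDl.
- by rewrite -sumrN; apply: eq_bigr => i _; rewrite scaleNr.
- by rewrite scaler_sumr; apply: eq_bigr => i _; rewrite scalerA.
Qed.

Lemma lsameP (K : pzRingType) (V : lmodType K) (env : seq V) (e1 e2 : lexp K) :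
  lsame e1 e2 (size env) -> lval env e1 = lval env e2.
Proof.
move=> h; rewrite !lvalE; apply: eq_bigr => -[i /= li] _; congr (_ *: _).
move: (size env) h li; elim=> //= n IH [h1 h2]; rewrite ltnS leq_eqVlt.
by case/orP => [/eqP->//|]; exact: IH.
Qed.

Ltac lmod_add x env :=
  let rec go e := lazymatch e with
    | nil => constr:(true)
    | cons x _ => constr:(false)
    | cons _ ?e' => go e' end in
  let b := go env in
  lazymatch b with true => constr:(cons x env) | _ => constr:(env) end.
Ltac lmod_env x env :=
  lazymatch x with
  | @GRing.add _ ?a ?b => let e := lmod_env a env in lmod_env b e
  | @GRing.opp _ ?a => lmod_env a env
  | @GRing.scale _ _ _ ?a => lmod_env a env
  | @GRing.zero _ => constr:(env)
  | _ => lmod_add x env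
  end.
Ltac lmod_idx x env :=
  lazymatch env with
  | cons x _ => constr:(O)
  | cons _ ?e => let n := lmod_idx x e in constr:(S n)
  end.
Ltac lmod_reify K x env :=
  lazymatch x with
  | @GRing.add _ ?a ?b =>
      let p := lmod_reify K a env in let q := lmod_reify K b env in
      constr:(@LAdd K p q)
  | @GRing.opp _ ?a => let p := lmod_reify K a env in constr:(@LOpp K p)
  | @GRing.scale _ _ ?k ?a =>
      let p := lmod_reify K a env in constr:(@LScale K k p)
  | @GRing.zero _ => constr:(@LZero K)
  | _ => let n := lmod_idx x env in constr:(@LVar K n)
  end.
(* [lmod K] proves identities in a K-module by comparing, by [ring] or [field],
   the coefficients of every subterm that is not a sum, opposite or multiple. *)
Ltac lmod K :=
  lazymatch goal with
  | |- @eq ?T ?a ?b =>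
    let env0 := constr:(@nil T) in
    let env1 := lmod_env a env0 in
    let env := lmod_env b env1 in
    let p := lmod_reify K a env in
    let q := lmod_reify K b env in
    refine (@lsameP K _ env p q _);
    cbv [lsame lcoef eqn size]; repeat split; first [done | ring | by field]
  end.

(** * Norms, limits and closed subspaces *)

Section Norm.
Context (R : realType) (V : completeNormedModType R[i]).
Implicit Types x y z : V.

(** The order of R[i] is only partial; passing to the real part makes [lra] and [nra] available. *)
Definition nrm x : R := complex.Re `|x|.

Lemma normE x : `|x| = (nrm x)%:C.
Proof. by rewrite /nrm RRe_real // normr_real. Qed.

Lemma nrmE x (r : R) : `|x| = r%:C -> nrm x = r.
Proof. by rewrite /nrm => ->. Qed.

Lemma nrm_ge0 x : 0 <= nrm x.
Proof. by rewrite -(lecR 0) -normE normr_ge0. Qed.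

Lemma nrm0 : nrm 0 = 0.
Proof. by apply: nrmE; rewrite normr0. Qed.

Lemma nrm_eq0 x : nrm x = 0 -> x = 0.
Proof. by move=> h; apply/normr0_eq0; rewrite normE h. Qed.

Lemma nrmN x : nrm (- x) = nrm x.
Proof. by rewrite /nrm normrN. Qed.

Lemma nrmB x y : nrm (x - y) = nrm (y - x).
Proof. by rewrite /nrm distrC. Qed.

Lemma nrmD x y : nrm (x + y) <= nrm x + nrm y.
Proof. by rewrite -lecR rmorphD /= -!normE ler_normD. Qed.

Lemma nrmZ (k : R[i]) x : nrm (k *: x) = complex.Re `|k| * nrm x.
Proof.
apply: nrmE; rewrite normrZ normE rmorphM /= RRe_real // normr_real.
Qed.

Lemma nrmZ_real (k : R) x : nrm (k%:C *: x) = `|k| * nrm x.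
Proof. by rewrite nrmZ normc_def /= expr0n addr0 sqrtr_sqr. Qed.

Lemma nrmZr (k : R) x : 0 <= k -> nrm (k%:C *: x) = k * nrm x.
Proof. by move=> k0; rewrite nrmZ ger0_norm // lecR. Qed.

Lemma nrm_half x : nrm (2^-1 *: x) = nrm x / 2.
Proof.
have -> : (2^-1 : R[i]) = (2^-1)%:C by rewrite fmorphV rmorph_nat.
by rewrite nrmZr ?invr_ge0 // mulrC.
Qed.

Lemma nrm_double x : nrm (x + x) = 2 * nrm x.
Proof.
have e : x = 2^-1 *: (x + x) by lmod R[i].
by rewrite {3}e nrm_half; lra.
Qed.

Lemma nrmZi x : nrm ('i *: x) = nrm x.
Proof.
rewrite nrmZ; suff -> : `|'i| = 1 :> R[i] by rewrite mul1r.
by rewrite normc_def /= expr0n expr1n add0r sqrtr1.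
Qed.

Lemma nrm_trans x y z : nrm (x - z) <= nrm (x - y) + nrm (y - z).
Proof.
have := nrmD (x - y) (y - z); suff -> : x - y + (y - z) = x - z by [].
lmod R[i].
Qed.

Lemma nrm_small x : (forall e : R, 0 < e -> nrm x < e) -> x = 0.
Proof.
move=> h; apply: nrm_eq0; apply/eqP; rewrite eq_le nrm_ge0 andbT.
rewrite leNgt; apply/negP => /h; by rewrite ltxx.
Qed.

End Norm.

Section Seq.
Context (R : realType).
Implicit Types V W : completeNormedModType R[i].

Definition tends V (u : nat -> V) (l : V) : Prop :=
  forall e : R, 0 < e -> exists N, forall n, (N <= n)%N -> nrm (u n - l) < e.

Lemma cvg_tends V (u : nat -> V) (l : V) : u @ \oo --> l -> tends u l.
Proof.
move=> /cvgrPdist_lt h e e0; have [|N _ hN] := h e%:C; first by rewrite ltcR.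
exists N => n /hN; by rewrite distrC normE ltcR.
Qed.

Lemma complete_seq V (u : nat -> V) :
  (forall e : R, 0 < e -> exists N, forall m n, (N <= m)%N -> (N <= n)%N ->
     nrm (u m - u n) < e) -> exists l, tends u l.
Proof.
move=> h; suff /cvg_tends hc : u @ \oo --> lim (u @ \oo) by exists (lim (u @ \oo)).
apply/cauchy_cvgP/cauchy_exP => e e0.
have re : (complex.Re e)%:C = e by rewrite RRe_real // gtr0_real.
have [|N hN] := h (complex.Re e); first by rewrite -ltcR re.
exists (u N); exists N => // n /= Nn.
by rewrite -ball_normE /ball_ /= normE -re ltcR hN.
Qed.

Lemma dense_near V (S : set V) : dense S ->
  forall (v : V) (e : R), 0 < e -> exists s, S s /\ nrm (v - s) < e.
Proof.
move=> h v e e0; have [||s [vs Ss]] := h (ball v e%:C).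
- by exists v; apply: ballxx; rewrite ltcR.
- by apply: ball_open; rewrite ltcR.
by exists s; split => //; move: vs; rewrite -ball_normE /ball_ /= normE ltcR.
Qed.

Lemma tends_uniq V (u : nat -> V) a b : tends u a -> tends u b -> a = b.
Proof.
move=> ha hb; apply/eqP; rewrite -subr_eq0; apply/eqP/nrm_small => e e0.
have e2 : 0 < e / 2 by lra.
have [N hN] := ha _ e2; have [M hM] := hb _ e2.
have := hN _ (leq_maxl N M); have := hM _ (leq_maxr N M).
have := nrm_trans a (u (maxn N M)) b; rewrite (nrmB a (u _)); lra.
Qed.

Lemma tends_const V (a : V) : tends (fun=> a) a.
Proof. by move=> e e0; exists 0%N => n _; rewrite subrr nrm0. Qed.

Lemma tends_ext V (u v : nat -> V) a : u =1 v -> tends u a -> tends v a.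
Proof. by move=> uv h e /h [N hN]; exists N => n; rewrite -uv; exact: hN. Qed.

(** Spares the limit proofs the choice of epsilons: a bound up to a fixed factor of any sign is
    enough. *)
Lemma tendsP V (u : nat -> V) a (c : R) :
  (forall e : R, 0 < e ->
    exists N, forall n, (N <= n)%N -> nrm (u n - a) <= c * e) -> tends u a.
Proof.
move=> h e e0; have c0 : 0 < `|c| + 1 by have := normr_ge0 c; lra.
have [|N hN] := h (e / (`|c| + 1)); first by rewrite divr_gt0.
exists N => n /hN /le_lt_trans; apply; rewrite mulrA ltr_pdivrMr //.
by rewrite mulrDr mulr1; have := ler_norm c; nra.
Qed.

Lemma tendsD V (u v : nat -> V) a b :
  tends u a -> tends v b -> tends (fun n => u n + v n) (a + b).
Proof.
move=> hu hv; apply: (@tendsP _ _ _ 2) => e e0.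
have [N hN] := hu e e0; have [M hM] := hv e e0.
exists (maxn N M) => n; rewrite geq_max => /andP[/hN h1 /hM h2].
have -> : u n + v n - (a + b) = (u n - a) + (v n - b) by lmod R[i].
by have := nrmD (u n - a) (v n - b); lra.
Qed.

Lemma tends_map V W (f : V -> W) (c : R) (u : nat -> V) a :
  (forall x y, nrm (f x - f y) <= c * nrm (x - y)) ->
  tends u a -> tends (fun n => f (u n)) (f a).
Proof.
move=> hf hu; apply: (@tendsP _ _ _ `|c|) => e e0; have [N hN] := hu e e0.
exists N => n /hN h; apply: le_trans (hf _ _) _.
have := ler_norm c; have := normr_ge0 c; have := nrm_ge0 (u n - a); nra.
Qed.

Lemma tendsZ V (k : R[i]) (u : nat -> V) a :
  tends u a -> tends (fun n => k *: u n) (k *: a).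
Proof.
apply: (@tends_map _ _ _ (complex.Re `|k|)) => x y.
by rewrite -scalerBr nrmZ.
Qed.

Lemma tends_shift V (u : nat -> V) a : tends u a -> tends (fun n => u n.+1) a.
Proof. by move=> h e /h [N hN]; exists N => n Nn; apply: hN; rewrite leqW. Qed.

Lemma tends_bound V (u : nat -> V) a (b : nat -> R) :
  (forall n, nrm (u n - a) <= b n) ->
  (forall e : R, 0 < e -> exists N, forall n, (N <= n)%N -> b n < e) -> tends u a.
Proof.
move=> h hb e /hb [N hN]; exists N => n /hN; apply: le_lt_trans; exact: h.
Qed.

(** The telescoping majorant [d] gives a rate along with the limit. A rate independent of t later
    makes pointwise limits over [0,1] uniform. *)
Lemma increments_cvg V (u : nat -> V) (d : nat -> R) :
  (forall n, nrm (u n.+1 - u n) <= d n - d n.+1) ->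
  (forall e : R, 0 < e -> exists N, forall n, (N <= n)%N -> d n < e) ->
  (forall n, 0 <= d n) ->
  exists l, tends u l /\ forall n, nrm (u n - l) <= d n.
Proof.
move=> h hd d0.
have hk n k : nrm (u (n + k)%N - u n) <= d n - d (n + k)%N.
  elim: k => [|k IH]; first by rewrite addn0 !subrr nrm0.
  rewrite addnS; have := nrm_trans (u (n + k).+1) (u (n + k)%N) (u n).
  have := h (n + k)%N; lra.
have hN N n : (N <= n)%N -> nrm (u n - u N) <= d N.
  move=> Nn; have := hk N (n - N)%N; rewrite subnKC //; have := d0 n; lra.
have [|l hl] := @complete_seq _ u.
  move=> e e0; have e2 : 0 < e / 2 by lra.
  have [N hN'] := hd _ e2; exists N => m n /hN h1 /hN h2.
  have := hN' N (leqnn N); have := nrm_trans (u m) (u N) (u n).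
  rewrite (nrmB (u N) (u n)); lra.
exists l; split => // n; apply/ler_addgt0Pl => e e0.
have [N hN'] := hl e e0; have h1 := hN' _ (leq_maxl N n).
have h2 := hN n _ (leq_maxr N n).
have := nrm_trans (u n) (u (maxn N n)) l; rewrite (nrmB (u n) (u _)); lra.
Qed.

Definition clin V (P : V -> Prop) : Prop :=
  [/\ P 0, forall k x y, P x -> P y -> P (k *: x + y) &
      forall x, (forall e : R, 0 < e -> exists y, P y /\ nrm (x - y) < e) ->
        P x].

(* The closed linear span of S is V, stated as an induction principle. *)
Definition total V (S : V -> Prop) : Prop :=
  forall P : V -> Prop, clin P -> (forall s, S s -> P s) -> forall x, P x.

Lemma clin_sum V (P : V -> Prop) (I : Type) (r : seq I) (Q : pred I)
    (c : I -> R[i]) (g : I -> V) :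
  clin P -> (forall i, P (g i)) -> P (\sum_(i <- r | Q i) c i *: g i).
Proof.
move=> [P0 PL _] hg; elim/big_rec: _ => // i x _ Px; exact: PL.
Qed.

Lemma clinZ V (P : V -> Prop) k x : clin P -> P x -> P (k *: x).
Proof. by move=> [h0 h _] px; rewrite -[_ *: _]addr0; apply: h. Qed.

Lemma clin_tends V (P : V -> Prop) (u : nat -> V) a :
  clin P -> (forall n, P (u n)) -> tends u a -> P a.
Proof.
move=> [_ _ h] pu hu; apply: h => e /hu [N hN].
by exists (u N); split => //; rewrite nrmB; apply: hN.
Qed.

Lemma dense_total V (S : set V) : dense (lin_span S) -> total S.
Proof.
move=> h P cP SP x; have [_ _ cl] := cP; apply: cl => e e0.
have [_ [[n [c [g [hg ->]]]] hs]] := dense_near h x e0.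
by exists (\sum_(i < n) c i *: g i); split=> //; apply: clin_sum => // i; apply: SP.
Qed.

End Seq.

Local Notation "a ** b" := (cmul a b) (at level 40, left associativity).

Section LinearMaps.
Context (R : realType) (V W : completeNormedModType R[i]) (f : V -> W).
Hypothesis f_lin : linear f.

Lemma linear_fun0 : f 0 = 0.
Proof. by have := f_lin (-1) 0 0; rewrite scaler0 addr0 scaleN1r addNr. Qed.

Lemma linear_funD x y : f (x + y) = f x + f y.
Proof. by have := f_lin 1 x y; rewrite !scale1r. Qed.

Lemma linear_funZ k x : f (k *: x) = k *: f x.
Proof. by have := f_lin k x 0; rewrite linear_fun0 !addr0. Qed.

Lemma linear_funN x : f (- x) = - f x.
Proof. by rewrite -scaleN1r linear_funZ scaleN1r. Qed.

Lemma linear_funB x y : f (x - y) = f x - f y.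
Proof. by rewrite linear_funD linear_funN. Qed.

Lemma linear_fun_sum (I : Type) (r : seq I) (P : pred I) (g : I -> V) :
  f (\sum_(i <- r | P i) g i) = \sum_(i <- r | P i) f (g i).
Proof.
elim/big_rec2: _ => [|i y x _ <-]; [exact: linear_fun0|exact: linear_funD].
Qed.

End LinearMaps.

(** * C*-algebras *)

Section CstarBasics.
Context (R : realType) (A : cstarAlg R).
Implicit Types a b c : A.

Lemma cmul_linear_l c : linear (fun a => a ** c).
Proof. by move=> k a b; rewrite cmul_linl. Qed.
Lemma cmul_linear_r c : linear (fun a => c ** a).
Proof. by move=> k a b; rewrite cmul_linr. Qed.

Lemma cmulDl a b c : (a + b) ** c = a ** c + b ** c.
Proof. exact: (linear_funD (cmul_linear_l c)). Qed.
Lemma cmulDr a b c : c ** (a + b) = c ** a + c ** b.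
Proof. exact: (linear_funD (cmul_linear_r c)). Qed.
Lemma cmulNl a c : (- a) ** c = - (a ** c).
Proof. exact: (linear_funN (cmul_linear_l c)). Qed.
Lemma cmulNr a c : c ** (- a) = - (c ** a).
Proof. exact: (linear_funN (cmul_linear_r c)). Qed.
Lemma cmulZl k a c : (k *: a) ** c = k *: (a ** c).
Proof. exact: (linear_funZ (cmul_linear_l c)). Qed.
Lemma cmulZr k a c : c ** (k *: a) = k *: (c ** a).
Proof. exact: (linear_funZ (cmul_linear_r c)). Qed.
Lemma cmul0l c : 0 ** c = 0.
Proof. exact: (linear_fun0 (cmul_linear_l c)). Qed.
Lemma cmul0r c : c ** 0 = 0.
Proof. exact: (linear_fun0 (cmul_linear_r c)). Qed.

Definition cmulE :=
  (cmulDl, cmulDr, cmulNl, cmulNr, cmulZl, cmulZr, cmul0l, cmul0r, cmulA).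

Lemma cmul_suml (I : Type) (r : seq I) (P : pred I) (g : I -> A) c :
  (\sum_(i <- r | P i) g i) ** c = \sum_(i <- r | P i) g i ** c.
Proof. exact: (linear_fun_sum (cmul_linear_l c)). Qed.

Lemma star0 : star (0 : A) = 0.
Proof.
have := star_antilin (-1) (0 : A) 0.
by rewrite scaler0 addr0 rmorphN1 scaleN1r addNr.
Qed.
Lemma starD a b : star (a + b) = star a + star b.
Proof. by have := star_antilin 1 a b; rewrite rmorph1 !scale1r. Qed.
Lemma starZ k a : star (k *: a) = k^* *: star a.
Proof. by have := star_antilin k a 0; rewrite star0 !addr0. Qed.
Lemma starN a : star (- a) = - star a.
Proof. by rewrite -scaleN1r starZ rmorphN1 scaleN1r. Qed.
Lemma starB a b : star (a - b) = star a - star b.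
Proof. by rewrite starD starN. Qed.

Lemma conj_half : Num.conj (2^-1 : R[i]) = 2^-1.
Proof. by rewrite fmorphV rmorph_nat. Qed.
Lemma conj_real (r : R) : Num.conj (r%:C : R[i]) = r%:C.
Proof. by apply/eqP; rewrite eq_complex /= oppr0 !eqxx. Qed.
Lemma conj_i : Num.conj ('i : R[i]) = - 'i.
Proof. by apply/eqP; rewrite eq_complex /= oppr0 !eqxx. Qed.

Definition starE := (starD, starN, starZ, starM, starK, star0, conj_half,
  conj_real, conj_i).

Lemma nrmM a b : nrm (a ** b) <= nrm a * nrm b.
Proof. by rewrite -lecR rmorphM /= -!normE cmul_norm. Qed.

Lemma nrm_cstar a : nrm (star a ** a) = nrm a ^+ 2.
Proof. by apply: nrmE; rewrite cstar_norm normE rmorphXn. Qed.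

Lemma nrm_star_le a : nrm a <= nrm (star a).
Proof.
have := nrmM (star a) a; rewrite nrm_cstar expr2; have := nrm_ge0 a.
rewrite le_eqVlt => /orP[/eqP <- _|a0]; first exact: nrm_ge0.
by rewrite ler_pM2r.
Qed.

Lemma nrm_star a : nrm (star a) = nrm a.
Proof.
apply/eqP; rewrite eq_le nrm_star_le andbT.
by have := nrm_star_le (star a); rewrite starK.
Qed.

Lemma nrm_cstar' a : nrm (a ** star a) = nrm a ^+ 2.
Proof. by rewrite -(nrm_star a) -nrm_cstar starK. Qed.

Lemma nrm_sa a : star a = a -> nrm (a ** a) = nrm a ^+ 2.
Proof. by move=> h; rewrite -nrm_cstar h. Qed.

Lemma cstar_eq0 a : star a ** a = 0 -> a = 0.
Proof.
by move=> h; apply: nrm_eq0; apply/eqP; rewrite -sqrf_eq0 -nrm_cstar h nrm0.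
Qed.

(** By the C*-identity the test vector [star a] suffices. Elements are thus controlled by their left
    multiplications, even without a unit. *)
Lemma lmul_bound a (c : R) :
  0 <= c -> (forall y, nrm (a ** y) <= c * nrm y) -> nrm a <= c.
Proof.
move=> c0 /(_ (star a)); rewrite nrm_cstar' nrm_star expr2; have := nrm_ge0 a.
by rewrite le_eqVlt => /orP[/eqP <- //|a0]; rewrite ler_pM2r.
Qed.

Lemma lmul_inj a b : (forall y, a ** y = b ** y) -> a = b.
Proof.
move=> h; apply/eqP; rewrite -subr_eq0; apply/eqP; apply: nrm_eq0.
apply/eqP; rewrite eq_le nrm_ge0 andbT; apply: lmul_bound => // y.
by rewrite cmulDl cmulNl h subrr nrm0 mul0r.
Qed.

Lemma tendsM (u v : nat -> A) a b :
  tends u a -> tends v b -> tends (fun n => u n ** v n) (a ** b).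
Proof.
move=> hu hv; apply: (@tendsP _ _ _ _ (nrm b + 1 + nrm a)) => e e0.
have [N hN] := hu e e0; have [M hM] := hv _ e0; have [K hK] := hv 1 ltr01.
exists (maxn N (maxn M K)) => n; rewrite !geq_max.
move=> /andP[/hN h1 /andP[/hM h2 /hK h3]].
have -> : u n ** v n - a ** b = (u n - a) ** v n + a ** (v n - b).
  by rewrite !cmulE; lmod R[i].
apply: le_trans (nrmD _ _) _; have := nrmM (u n - a) (v n).
have := nrmM a (v n - b); have := nrmD (v n - b) b; rewrite subrK.
have := nrm_ge0 a; have := nrm_ge0 b; have := nrm_ge0 (v n).
have := nrm_ge0 (u n - a); nra.
Qed.

Lemma tends_star (u : nat -> A) a : tends u a -> tends (fun n => star (u n)) (star a).
Proof. by apply: (@tends_map _ _ _ _ 1) => x y; rewrite -starB nrm_star mul1r. Qed.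

Lemma tendsMl c (u : nat -> A) a : tends u a -> tends (fun n => c ** u n) (c ** a).
Proof. by apply: tendsM; exact: tends_const. Qed.

Lemma tendsMr c (u : nat -> A) a : tends u a -> tends (fun n => u n ** c) (a ** c).
Proof. by move=> h; apply: tendsM => //; exact: tends_const. Qed.

End CstarBasics.

(** * Square roots by iteration *)

Section SquareRoot.
Context (R : realType).

(** The scalar part of the iterates in the unitization. For t = 0 it vanishes; for t = 1 it
    increases to 1 and also serves as a majorant for the operators. *)
Fixpoint rho (t : R) (n : nat) : R :=
  if n is m.+1 then (t + rho t m ^+ 2) / 2 else 0.

Lemma rho_bound n : 0 <= rho 1 n <= 1.
Proof. elim: n => [|n /andP[h1 h2]] /=; apply/andP; nra. Qed.

Lemma rho_mono n : 0 <= rho 1 n.+1 - rho 1 n.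
Proof. by have /andP[h1 h2] := rho_bound n; rewrite /=; nra. Qed.

(** The fixed point 1 of r |-> (1 + r^2) / 2 is neutral, so the convergence is only of order 1/n.
    The error d becomes d - d^2 / 2, which is increasing for d <= 1 and maps 2 / (n + 2) below 2 /
    (n + 3). *)
Lemma rho_rate n : (1 - rho 1 n) * n.+2%:R <= 2.
Proof.
elim: n => [|n IH] /=; first lra.
have /andP[h1 h2] := rho_bound n; move: IH.
rewrite -(@natr1 R n.+2) -(@natr1 R n.+1) -(@natr1 R n).
have : 0 <= n%:R :> R by []; move: (n%:R : R) => m m0 IH.
move: (rho 1 n) h1 h2 IH => x h1 h2 IH.
have m2 : 0 < m + 2 by lra.
have hx : 1 - x <= 2 / (m + 2) by rewrite ler_pdivlMr; lra.
have h : (1 - x) - (1 - x) ^+ 2 / 2 <= 2 / (m + 2) - (2 / (m + 2)) ^+ 2 / 2.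
  have : 2 / (m + 2) <= 1 by rewrite ler_pdivrMr; lra.
  by move: hx; move: (2 / (m + 2)) => e; nra.
have e : 2 / (m + 2) - (2 / (m + 2)) ^+ 2 / 2 = 2 * (m + 1) / (m + 2) ^+ 2.
  by field; apply/eqP; lra.
have k : 2 * (m + 1) / (m + 2) ^+ 2 * (m + 3) <= 2.
  rewrite mulrAC ler_pdivrMr; first by nra.
  by rewrite exprn_gt0.
rewrite e in h; move: h k; move: (2 * (m + 1) / (m + 2) ^+ 2) => c; nra.
Qed.

Lemma rho_cvg (e : R) :
  0 < e -> exists N, forall n, (N <= n)%N -> 2 * (1 - rho 1 n) < e.
Proof.
move=> e0; have := archi_boundP (ltW (divr_gt0 (ltr0n R 4) e0)).
set N := Num.bound _; rewrite ltr_pdivrMr // => hN; exists N => n Nn.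
have Nn2 : N%:R <= n.+2%:R :> R by rewrite ler_nat; lia.
have := rho_rate n; have := rho_bound n.
have : 0 < n.+2%:R :> R by []; nra.
Qed.

End SquareRoot.

Section Iteration.
Context (R : realType) (A : cstarAlg R).
Implicit Types a b c y : A.

(* With r_n = rho t n - s_n in the unitization, this is the iteration
   r_(n+1) = ((t - a) + r_n ^ 2) / 2, whose limit satisfies
   (1 - r) ^ 2 = 1 - (t - a). *)
Fixpoint sqrt_iter (t : R) a (n : nat) : A :=
  if n is m.+1 then
    2^-1 *: a + (rho t m)%:C *: sqrt_iter t a m
      - 2^-1 *: (sqrt_iter t a m ** sqrt_iter t a m)
  else 0.

Context (t : R) (a : A).
Hypothesis t01 : t = 0 \/ t = 1.
Hypothesis a_contr : forall y, nrm (t%:C *: y - a ** y) <= nrm y.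

Local Notation s := (sqrt_iter t a).
Let r n y := (rho t n)%:C *: y - s n ** y.

Lemma sqrt_iter_rB n y z : r n (y - z) = r n y - r n z.
Proof. by rewrite /r !cmulE; lmod R[i]. Qed.

Lemma rho_dist n : `|rho t n.+1 - rho t n| <= rho 1 n.+1 - rho 1 n.
Proof.
case: t01 => ->; last first.
  have /andP[h1 h2] := rho_bound R n; rewrite ger0_norm //=; nra.
have rho0 k : rho 0 k = 0 by elim: k => //= k ->; rewrite expr0n addr0 mul0r.
rewrite !rho0 subrr normr0 /=; have /andP[h1 h2] := rho_bound R n; nra.
Qed.

Lemma rho_lim n : `|rho t n - t| <= 1 - rho 1 n.
Proof.
have /andP[h1 h2] := rho_bound R n; case: t01 => ->; last first.
  by rewrite ler0_norm; lra.
have rho0 k : rho 0 k = 0 by elim: k => //= k ->; rewrite expr0n addr0 mul0r.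
by rewrite !rho0 subrr normr0; lra.
Qed.

Lemma sqrt_iterS n y :
  r n.+1 y = 2^-1 *: (t%:C *: y - a ** y) + 2^-1 *: r n (r n y).
Proof.
rewrite /r /= !cmulE !rmorphM /= fmorphV rmorphD rmorphXn /= rmorph_nat.
lmod R[i].
Qed.

Lemma sqrt_iter_r n y : nrm (r n y) <= rho 1 n * nrm y.
Proof.
elim: n y => [|n IH] y; first by rewrite /r /= cmul0l scale0r subrr nrm0 mul0r.
rewrite sqrt_iterS; apply: le_trans (nrmD _ _) _.
rewrite !nrm_half [rho 1 n.+1]/=; have := a_contr y.
have /andP[h3 h4] := rho_bound R n; have := IH y; have := IH (r n y).
have := nrm_ge0 y; nra.
Qed.

(** The factorization p^2 - q^2 = p (p - q) + (p - q) q and its scalar counterpart make the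
    increments of the operators follow those of [rho 1]. *)
Lemma sqrt_iter_dr n y :
  nrm (r n.+1 y - r n y) <= (rho 1 n.+1 - rho 1 n) * nrm y.
Proof.
elim: n y => [|n IH] y.
  rewrite [X in _ - X](_ : _ = 0); last by rewrite /r /= cmul0l scale0r subrr.
  by rewrite subr0 [rho 1 0]/= subr0; exact: sqrt_iter_r.
have -> : r n.+2 y - r n.+1 y =
   2^-1 *: (r n.+1 (r n.+1 y - r n y) + (r n.+1 (r n y) - r n (r n y))).
  rewrite (sqrt_iterS n.+1 y) [X in _ - X = _]sqrt_iterS.
  rewrite (sqrt_iter_rB n.+1 (r n.+1 y) (r n y)).
  by lmod R[i].
rewrite nrm_half.
have := nrmD (r n.+1 (r n.+1 y - r n y)) (r n.+1 (r n y) - r n (r n y)).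
have := sqrt_iter_r n.+1 (r n.+1 y - r n y).
have := IH y; have := IH (r n y); have := sqrt_iter_r n y.
have /andP[h3 h4] := rho_bound R n; have /andP[h5 h6] := rho_bound R n.+1.
have h7 := rho_mono R n.
have e : rho (1 : R) n.+2 - rho 1 n.+1 = (rho 1 n.+1 ^+ 2 - rho 1 n ^+ 2) / 2.
  have -> : rho (1 : R) n.+2 = (1 + rho 1 n.+1 ^+ 2) / 2 by [].
  have {2}-> : rho (1 : R) n.+1 = (1 + rho 1 n ^+ 2) / 2 by [].
  by field.
rewrite e.
move=> h8 h9 h10 h11; have := ler_wpM2l h7 h8; have := ler_wpM2l h5 h10.
move: (rho 1 n) (rho 1 n.+1) h9 h11 => p q; lra.
Qed.

Lemma sqrt_iter_ds n :
  nrm (s n.+1 - s n) <= 2 * (1 - rho 1 n) - 2 * (1 - rho 1 n.+1).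
Proof.
have /andP[h3 h4] := rho_bound R n.
have h7 := rho_mono R n.
apply: lmul_bound; first lra.
move=> y; have -> : (s n.+1 - s n) ** y =
    (rho t n.+1 - rho t n)%:C *: y - (r n.+1 y - r n y).
  by rewrite /r rmorphB /= cmulDl cmulNl; lmod R[i].
apply: le_trans (nrmD _ _) _; rewrite nrmN nrmZ_real.
have := sqrt_iter_dr n y; have := ler_wpM2r (nrm_ge0 y) (rho_dist n); lra.
Qed.

Lemma sqrt_iter_star n : star a = a -> star (s n) = s n.
Proof.
move=> sa; elim: n => [|n IH] /=; rewrite !starE //.
by rewrite sa !IH.
Qed.

Lemma sqrt_iter_comm n c : c ** a = a ** c -> c ** s n = s n ** c.
Proof.
move=> ca; elim: n => [|n IH] /=; first by rewrite cmul0l cmul0r.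
rewrite !(cmulDl, cmulDr, cmulNl, cmulNr, cmulZl, cmulZr) ca IH.
by rewrite -[in RHS]cmulA -IH !cmulA IH.
Qed.

(** For t = 1 the equation reads s0^2 = a. For t = 0 it reads (1 + s0)^2 = 1 + a, a root in the
    unitization recorded by its difference from 1. *)
Lemma sqrt_iter_cvg : exists s0 : A,
  [/\ s0 = 2^-1 *: a + t%:C *: s0 - 2^-1 *: (s0 ** s0),
      star a = a -> star s0 = s0,
      forall c, c ** a = a ** c -> c ** s0 = s0 ** c,
      forall n, nrm (s n - s0) <= 2 * (1 - rho 1 n) &
      forall y, nrm (t%:C *: y - s0 ** y) <= nrm y].
Proof.
have [] := increments_cvg sqrt_iter_ds (@rho_cvg R).
  by move=> n; have /andP[_ h] := rho_bound R n; lra.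
move=> s0 [hl hs]; exists s0; split=> //.
- apply: (tends_uniq (tends_shift hl)) => /=.
  apply: tendsD.
    apply: tendsD; first exact: tends_const.
    apply: (@tends_bound _ _ _ _ (fun n => 2 * (1 - rho 1 n) * (1 + nrm s0))).
      move=> n.
      have -> : (rho t n)%:C *: s n - t%:C *: s0 =
          (rho t n)%:C *: (s n - s0) + (rho t n - t)%:C *: s0.
        by rewrite rmorphB /=; lmod R[i].
      apply: le_trans (nrmD _ _) _.
      rewrite !nrmZ_real.
      have h1 : `|rho t n| <= 1.
        have := rho_lim n; have /andP[h1 h2] := rho_bound R n.
        case: t01 => ->; rewrite !ler_norml; lra.
      have := hs n; have := rho_lim n; have := nrm_ge0 s0.
      have := nrm_ge0 (s n - s0); have := normr_ge0 (rho t n).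
      have := normr_ge0 (rho t n - t); nra.
    move=> e e0; have h : 0 < 1 + nrm s0 by have := nrm_ge0 s0; lra.
    have [N hN] := rho_cvg (divr_gt0 e0 h).
    by exists N => n /hN; rewrite ltr_pdivlMr.
  apply: (@tends_ext _ _ (fun n => (- 2^-1) *: (s n ** s n))).
    by move=> n; rewrite scaleNr.
  by rewrite -scaleNr; apply: tendsZ; apply: tendsM.
- move=> sa; apply: (tends_uniq _ hl).
  by apply: tends_ext (tends_star hl) => n; rewrite sqrt_iter_star.
- move=> c ca; apply: (tends_uniq (tendsMl c hl)).
  by apply: tends_ext (tendsMr c hl) => n; rewrite sqrt_iter_comm.
- move=> y; apply/ler_addgt0Pl => e e0.
  have y1 : 0 < 2 * (nrm y + 1) by have := nrm_ge0 y; lra.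
  have [N /(_ N (leqnn N)) hN] := rho_cvg (divr_gt0 e0 y1).
  have -> : t%:C *: y - s0 ** y =
      r N y + ((t - rho t N)%:C *: y + (s N - s0) ** y).
    by rewrite /r rmorphB /= !cmulE; lmod R[i].
  apply: le_trans (nrmD _ _) _.
  have := nrmD ((t - rho t N)%:C *: y) ((s N - s0) ** y).
  rewrite nrmZ_real distrC; have := sqrt_iter_r N y; have := rho_lim N.
  have := nrmM (s N - s0) y; have := hs N; have /andP[h1 h2] := rho_bound R N.
  move: hN; rewrite ltr_pdivlMr // => hN.
  have y0 := nrm_ge0 y => k1 k2 k3 k4.
  have := ler_wpM2r y0 k1; have := ler_wpM2r y0 k3; have : 0 <= 1 - rho (1 : R) N by lra.
  move=> k5; have := mulr_ge0 k5 y0; lra.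
Qed.

End Iteration.

(** * Hilbert modules and correspondences *)

Section HilbertBasics.
Context (R : realType) (B : cstarAlg R) (X : hilbMod B).
Implicit Types (x y z : X) (b c : B).

Lemma ip_linear_r z : linear (ip z : X -> B).
Proof. by move=> k x y; rewrite ip_linr. Qed.

Lemma ipDr x y z : ip z (x + y) = ip z x + ip z y.
Proof. exact: (linear_funD (ip_linear_r z)). Qed.
Lemma ipNr x z : ip z (- x) = - ip z x.
Proof. exact: (linear_funN (ip_linear_r z)). Qed.
Lemma ipZr k x z : ip z (k *: x) = k *: ip z x.
Proof. exact: (linear_funZ (ip_linear_r z)). Qed.
Lemma ip0r z : ip z 0 = 0.
Proof. exact: (linear_fun0 (ip_linear_r z)). Qed.
Lemma ipDl x y z : ip (x + y) z = ip x z + ip y z.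
Proof. by rewrite -ip_star ipDr starD !ip_star. Qed.
Lemma ipNl x z : ip (- x) z = - ip x z.
Proof. by rewrite -ip_star ipNr starN ip_star. Qed.
Lemma ipZl k x z : ip (k *: x) z = Num.conj k *: ip x z.
Proof. by rewrite -ip_star ipZr starZ ip_star. Qed.
Lemma ip0l z : ip 0 z = 0.
Proof. by rewrite -ip_star ip0r star0. Qed.
Lemma ip_ractl x y b : ip (ract x b) y = star b ** ip x y.
Proof. by rewrite -ip_star ip_ract starM ip_star. Qed.

Definition ipE := (ipDr, ipDl, ipNr, ipNl, ipZr, ipZl, ip0r, ip0l).

Lemma nrm_ip x : nrm (ip x x) = nrm x ^+ 2.
Proof. by apply: complexI; rewrite -normE -ip_norm normE rmorphXn. Qed.

Lemma ip_eq0 x : (forall z, ip z x = 0) -> x = 0.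
Proof.
move=> /(_ x) h; apply: nrm_eq0; apply/eqP.
by rewrite -sqrf_eq0 -nrm_ip h nrm0.
Qed.

Lemma ip_ext x y : (forall z, ip z x = ip z y) -> x = y.
Proof.
move=> h; apply/eqP; rewrite -subr_eq0; apply/eqP/ip_eq0 => z.
by rewrite !ipE h subrr.
Qed.

Lemma ract_linear_l b : linear (fun x => ract x b).
Proof. by move=> k x y; rewrite ract_linl. Qed.
Lemma ract_linear_r x : linear (ract x).
Proof. by move=> k b c; rewrite ract_linr. Qed.

Lemma nrm_ract x b : nrm (ract x b) <= nrm x * nrm b.
Proof.
rewrite -(@ler_pXn2r _ 2) ?nnegrE ?mulr_ge0 ?nrm_ge0 // exprMn -!nrm_ip.
rewrite ip_ractl ip_ract; have := nrmM (star b) (ip x x ** b).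
have := nrmM (ip x x) b; rewrite nrm_star.
have := nrm_ge0 b; have := nrm_ge0 (ip x x); nra.
Qed.

Lemma polarization x y : 4 *: ip x y =
  ip (x + y) (x + y) - ip (- x + y) (- x + y)
  + 'i *: (ip ('i *: x + y) ('i *: x + y) - ip (- ('i *: x) + y) (- ('i *: x) + y)).
Proof.
rewrite !ipE !conj_i.
have ii : 'i * 'i = -1 :> R[i] by rewrite -expr2 sqr_i.
rewrite !(scalerDr, scalerN, scalerA, mulrN, mulNr, mulrA, ii, opprK, mul1r).
lmod R[i].
Qed.

(* The constant 4 is not optimal; polarization only uses that the given norm
   satisfies the triangle inequality. *)
Lemma nrm_ip_le x y : nrm (ip x y) <= 4 * nrm x * nrm y.
Proof.
have key x' y' : nrm x' <= 1 -> nrm y' <= 1 -> nrm (ip x' y') <= 4.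
  move=> h1 h2.
  have q z w : nrm z <= 1 -> nrm w <= 1 -> nrm (ip (z + w) (z + w)) <= 4.
    move=> hz hw; rewrite nrm_ip; have := nrmD z w; have := nrm_ge0 (z + w); nra.
  have h : nrm (4 *: ip x' y') <= 16.
    rewrite polarization; apply: le_trans (nrmD _ _) _; rewrite nrmZi.
    have := nrmD (ip (x' + y') (x' + y')) (- ip (- x' + y') (- x' + y')).
    have := nrmD (ip ('i *: x' + y') ('i *: x' + y'))
      (- ip (- ('i *: x') + y') (- ('i *: x') + y')).
    rewrite !nrmN; have := q x' y' h1 h2; have := q (- x') y'; rewrite nrmN.
    have := q ('i *: x') y'; have := q (- ('i *: x')) y'; rewrite nrmN !nrmZi.
    move=> /(_ h1 h2) q1 /(_ h1 h2) q2 /(_ h1 h2) q3; lra.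
  have h4 : (4 : R[i]) = (4 : R)%:C by rewrite rmorph_nat.
  by move: h; rewrite h4 nrmZr //; lra.
have [x0|x0] := eqVneq (nrm x) 0; first by rewrite (nrm_eq0 x0) ip0l !nrm0 mulr0 mul0r.
have [y0|y0] := eqVneq (nrm y) 0; first by rewrite (nrm_eq0 y0) ip0r !nrm0 mulr0.
have px : 0 < nrm x by rewrite lt_neqAle eq_sym x0 nrm_ge0.
have py : 0 < nrm y by rewrite lt_neqAle eq_sym y0 nrm_ge0.
have := key ((nrm x)^-1%:C *: x) ((nrm y)^-1%:C *: y).
rewrite !nrmZr ?invr_ge0 ?nrm_ge0 // !mulVf // => /(_ (lexx _) (lexx _)).
rewrite ipZr ipZl conj_real !nrmZr ?invr_ge0 ?nrm_ge0 //.
rewrite mulrA -invfM ler_pdivrMl ?mulr_gt0 //; lra.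
Qed.

Lemma adj_linear (T S : X -> X) :
  (forall x y, ip (T x) y = ip x (S y)) -> linear T.
Proof.
move=> h k x y; apply: ip_ext => z.
have h' a : ip z (T a) = ip (S z) a by rewrite -ip_star h ip_star.
by rewrite !ipE !h' !ipE.
Qed.

Lemma adj_ract (T S : X -> X) :
  (forall x y, ip (T x) y = ip x (S y)) ->
  forall x b, T (ract x b) = ract (T x) b.
Proof.
move=> h x b; apply: ip_ext => z.
have h' a : ip z (T a) = ip (S z) a by rewrite -ip_star h ip_star.
by rewrite ip_ract !h' ip_ract.
Qed.

End HilbertBasics.

Section CorrBasics.
Context (R : realType) (A B : cstarAlg R) (X : corr A B).
Implicit Types (a b r : A) (x y : X).

Lemma lact_linear_l x : linear (fun a => lact a x).
Proof. by move=> k a b; rewrite lact_lin. Qed.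

Lemma lact_linear_r a : linear (lact a : X -> X).
Proof. by apply: adj_linear => x y; exact: lactS. Qed.

Lemma lact_ract a x (b : B) : lact a (ract x b) = ract (lact a x) b.
Proof. by apply: (adj_ract (S := lact (star a))) => *; exact: lactS. Qed.

Lemma lactDl a b x : lact (a + b) x = lact a x + lact b x.
Proof. exact: (linear_funD (lact_linear_l x)). Qed.
Lemma lactNl a x : lact (- a) x = - lact a x.
Proof. exact: (linear_funN (lact_linear_l x)). Qed.
Lemma lact0l x : lact 0 x = 0.
Proof. exact: (linear_fun0 (lact_linear_l x)). Qed.
Lemma lactZl k a x : lact (k *: a) x = k *: lact a x.
Proof. exact: (linear_funZ (lact_linear_l x)). Qed.
Lemma lactDr a x y : lact a (x + y) = lact a x + lact a y.
Proof. exact: (linear_funD (lact_linear_r a)). Qed.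
Lemma lactNr a x : lact a (- x) = - lact a x.
Proof. exact: (linear_funN (lact_linear_r a)). Qed.
Lemma lactZr k a x : lact a (k *: x) = k *: lact a x.
Proof. exact: (linear_funZ (lact_linear_r a)). Qed.
Lemma lact0r a : lact a (0 : X) = 0.
Proof. exact: (linear_fun0 (lact_linear_r a)). Qed.

Definition lactE := (lactDl, lactNl, lactZl, lact0l, lactDr, lactNr, lactZr, lact0r).

(* a + i (1 - r) acts as a unitary, and a and 1 - r are half-sums of it and
   its adjoint. *)
Lemma unit_trick a r : star a = a -> star r = r -> a ** r = r ** a ->
  a ** a = r + r - r ** r ->
  forall x, nrm (lact a x) <= nrm x /\ nrm (x - lact r x) <= nrm x.
Proof.
move=> sa sr ar aa x.
have ii : 'i * 'i = -1 :> R[i] by rewrite -expr2 sqr_i.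
have iso (k : R[i]) : Num.conj k = - k -> k * k = -1 ->
    nrm (lact a x + k *: (x - lact r x)) = nrm x.
  move=> ck kk; set w := _ + _.
  apply/eqP; rewrite -(@eqrXn2 _ 2) ?nrm_ge0 // -!nrm_ip; apply/eqP; congr nrm.
  have e v : ip w v = ip x (lact a v - k *: v + k *: lact r v).
    by rewrite /w !ipE ck !lactS sa sr; lmod R[i].
  rewrite e; congr ip; rewrite /w !lactE -!lactM aa ar !lactE.
  by rewrite !(scalerDr, scalerN, scalerA, mulrN, mulNr, kk); lmod R[i].
have h1 := iso 'i (conj_i R) ii.
have h2 := iso (- 'i); rewrite rmorphN /= conj_i mulrNN in h2.
move: (h2 erefl ii) => {}h2.
have := nrmD (lact a x + 'i *: (x - lact r x)) (lact a x + - 'i *: (x - lact r x)).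
have := nrmD (lact a x + 'i *: (x - lact r x)) (- (lact a x + - 'i *: (x - lact r x))).
have -> : lact a x + 'i *: (x - lact r x) + (lact a x + - 'i *: (x - lact r x)) =
  lact a x + lact a x by rewrite scaleNr; lmod R[i].
have -> : lact a x + 'i *: (x - lact r x) - (lact a x + - 'i *: (x - lact r x)) =
  'i *: (x - lact r x) + 'i *: (x - lact r x) by rewrite scaleNr; lmod R[i].
rewrite nrmN h1 h2 -scalerDr nrmZi.
rewrite !nrm_double; lra.
Qed.

End CorrBasics.

(** * Boundedness of left actions and contractivity of star-homomorphisms *)

Section Contractive.
Context (R : realType).
Implicit Types A B : cstarAlg R.

(** Here r is 1 - (1 - t)^(1/2), which lies in A even if the unit does not: r = - s for the root 1 +
    s of 1 - t. *)
Lemma sqrt_compl A (t : A) : star t = t -> nrm t <= 1 ->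
  exists r : A, [/\ star r = r, r + r - r ** r = t &
    forall c, c ** t = t ** c -> c ** r = r ** c].
Proof.
move=> st t1.
have [||s [hs ss sc _ _]] := @sqrt_iter_cvg R A 0 (- t); first by left.
  move=> y; rewrite scale0r sub0r cmulNl opprK; have := nrmM t y.
  have := nrm_ge0 y; nra.
exists (- s); split.
- by rewrite starN ss // starN st.
- rewrite cmulNl cmulNr opprK.
  have -> : - s - s - s ** s = - (2%:R *: s) - s ** s by rewrite scaler_nat mulr2n opprD.
  by rewrite {1}hs; lmod R[i].
- move=> c ct; rewrite cmulNr cmulNl sc // cmulNr cmulNl ct //.
Qed.

Lemma lact_sa_contr A B (X : corr A B) (a : A) (x : X) :
  star a = a -> nrm a <= 1 -> nrm (lact a x) <= nrm x.
Proof.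
move=> sa a1; have [||r [sr hr cr]] := @sqrt_compl A (a ** a).
- by rewrite starM sa.
- by rewrite nrm_sa //; have := nrm_ge0 a; nra.
have ar : a ** r = r ** a by apply: cr; rewrite cmulA.
by have [] := unit_trick sa sr ar (esym hr) x.
Qed.

Lemma lact_sa_bound A B (X : corr A B) (a : A) (x : X) :
  star a = a -> nrm (lact a x) <= nrm a * nrm x.
Proof.
move=> sa; have [a0|a0] := eqVneq (nrm a) 0.
  by rewrite (nrm_eq0 a0) lact0l !nrm0 mul0r.
have pa : 0 < nrm a by rewrite lt_neqAle eq_sym a0 nrm_ge0.
have := @lact_sa_contr _ _ X ((nrm a)^-1%:C *: a) x.
rewrite starZ conj_real sa lactZl !nrmZr ?invr_ge0 ?nrm_ge0 // mulVf //.
by move=> /(_ erefl (lexx _)); rewrite ler_pdivrMl.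
Qed.

(** The 2 is the square root of the 4 in [nrm_ip_le]: |a x|^2 = |<x, a^* a x>|, and a^* a is
    self-adjoint. *)
Lemma lact_bound A B (X : corr A B) (a : A) (x : X) :
  nrm (lact a x) <= 2 * nrm a * nrm x.
Proof.
have h := @lact_sa_bound _ _ X (star a ** a) x.
rewrite starM starK nrm_cstar in h; have {}h := h erefl.
have := nrm_ip_le x (lact (star a ** a) x).
rewrite lactM -lactS nrm_ip -lactM; have := nrm_ge0 a; have := nrm_ge0 x.
move=> x0 a0 h2; rewrite -(@ler_pXn2r _ 2) ?nnegrE ?mulr_ge0 ?nrm_ge0 //.
apply: (le_trans h2); rewrite !exprMn.
have : nrm x * nrm (lact (star a ** a) x) <= nrm x * (nrm a ^+ 2 * nrm x).
  exact: ler_wpM2l.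
lra.
Qed.

Lemma starHom_sa_contr A B (f : starHom A B) (a : A) :
  star a = a -> nrm (f a) <= nrm a.
Proof.
move=> sa; apply: lmul_bound; first exact: nrm_ge0.
by move=> y; exact: (@lact_sa_bound _ _ (hom_corr f) a y).
Qed.

Lemma starHom_contr A B (f : starHom A B) (a : A) : nrm (f a) <= nrm a.
Proof.
rewrite -(@ler_pXn2r _ 2) ?nnegrE ?nrm_ge0 // -!nrm_cstar -sfunS -Defs.sfunM.
by apply: starHom_sa_contr; rewrite starM starK.
Qed.

End Contractive.

(** * Positive elements *)

Section Positivity.
Context (R : realType) (A : cstarAlg R).
Implicit Types a b c p q r s t v w y z : A.

(* The unit of the unitization is avoided throughout: the condition
   |M - a| <= M is tested on left multiplication operators. *)
Definition pos a : Prop :=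
  star a = a /\ exists2 M : R, 0 <= M &
    forall y, nrm (M%:C *: y - a ** y) <= M * nrm y.

(** 1 - s^2 equals (1 - r)^2, and 1 - r is a contraction by [unit_trick]. *)
Lemma sq_contr s y : star s = s -> nrm s <= 1 -> nrm (y - s ** s ** y) <= nrm y.
Proof.
move=> ss s1; have [||r [sr hr cr]] := @sqrt_compl R A (s ** s).
- by rewrite starM ss.
- by rewrite nrm_sa //; have := nrm_ge0 s; nra.
have sr' : s ** r = r ** s by apply: cr; rewrite cmulA.
have h := @unit_trick _ _ _ (id_corr A) _ _ ss sr sr' (esym hr).
have -> : y - s ** s ** y = (y - r ** y) - r ** (y - r ** y).
  by rewrite -hr !cmulE; lmod R[i].
by have [_ h1] := h (y - r ** y); have [_ h2] := h y; exact: le_trans h1 h2.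
Qed.

Lemma pos_sq s : star s = s -> pos (s ** s).
Proof.
move=> ss; split; first by rewrite starM ss.
exists (nrm s ^+ 2) => [|y]; first by rewrite exprn_ge0 ?nrm_ge0.
have [s0|s0] := eqVneq (nrm s) 0.
  by rewrite (nrm_eq0 s0) !cmul0l nrm0 expr0n scale0r subr0 nrm0 mul0r.
have ps : 0 < nrm s by rewrite lt_neqAle eq_sym s0 nrm_ge0.
have := @sq_contr ((nrm s)^-1%:C *: s) y.
rewrite starZ conj_real ss nrmZr ?invr_ge0 ?nrm_ge0 // mulVf // => /(_ erefl (lexx _)).
set s' := _ *: s => h.
have es : s = (nrm s)%:C *: s'.
  by rewrite /s' scalerA -rmorphM /= divff // rmorph1 scale1r.
have -> : (nrm s ^+ 2)%:C *: y - (s ** s) ** y = (nrm s ^+ 2)%:C *: (y - s' ** s' ** y).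
  rewrite scalerDr scalerN.
  have k (c : R) x : c%:C *: x ** (c%:C *: x) ** y = (c ^+ 2)%:C *: (x ** x ** y).
    by rewrite rmorphXn /= !cmulE; lmod R[i].
  by rewrite -k -es; lmod R[i].
by rewrite nrmZr ?exprn_ge0 ?nrm_ge0 // ler_wpM2l // exprn_ge0 ?nrm_ge0.
Qed.

(** Immediate for the norm condition chosen as definition of [pos], but not for elements of the form
    b^* b. *)
Lemma posD a b : pos a -> pos b -> pos (a + b).
Proof.
move=> [sa [M M0 hM]] [sb [N N0 hN]]; split; first by rewrite starD sa sb.
exists (M + N) => [|y]; first exact: addr_ge0.
have -> : (M + N)%:C *: y - (a + b) ** y =
    (M%:C *: y - a ** y) + (N%:C *: y - b ** y).
  by rewrite rmorphD /= !cmulE; lmod R[i].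
by apply: le_trans (nrmD _ _) _; rewrite mulrDl lerD.
Qed.

Lemma posZ (k : R) a : 0 <= k -> pos a -> pos (k%:C *: a).
Proof.
move=> k0 [sa [M M0 hM]]; split; first by rewrite starZ conj_real sa.
exists (k * M) => [|y]; first exact: mulr_ge0.
have -> : (k * M)%:C *: y - (k%:C *: a) ** y = k%:C *: (M%:C *: y - a ** y).
  by rewrite rmorphM /= !cmulE; lmod R[i].
by rewrite nrmZr // -mulrA ler_wpM2l.
Qed.

Lemma pos_sqrt a : pos a -> exists s,
  [/\ star s = s, pos s, s ** s = a & forall c, c ** a = a ** c -> c ** s = s ** c].
Proof.
move=> [sa [M M0 hM]]; have [Mz|Mz] := eqVneq M 0.
  have -> : a = 0.
    apply: nrm_eq0; apply/eqP; rewrite eq_le nrm_ge0 andbT; apply: lmul_bound => // y.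
    by have := hM y; rewrite Mz scale0r sub0r nrmN.
  exists 0; split=> [||| c _]; rewrite ?star0 ?cmul0l ?cmul0r //.
  by have := @pos_sq 0; rewrite star0 cmul0l; apply.
have pM : 0 < M by rewrite lt_neqAle eq_sym Mz.
have [||s [hs ss sc _ hp]] := @sqrt_iter_cvg R A 1 (M^-1%:C *: a); first by right.
  move=> y; rewrite rmorph1 scale1r.
  have -> : y - M^-1%:C *: a ** y = M^-1%:C *: (M%:C *: y - a ** y).
    rewrite !cmulE scalerDr scalerA -rmorphM /= mulVf // rmorph1 scale1r.
    by lmod R[i].
  by rewrite nrmZr ?invr_ge0 // ler_pdivrMl.
have ps : pos s.
  split; first by rewrite ss // starZ conj_real sa.
  by exists 1 => // y; rewrite mul1r.
have s2 : s ** s = M^-1%:C *: a.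
  move: hs; rewrite rmorph1 scale1r => hs.
  have k (x z : A) : z ** z = x + (2 *: z - 2 *: (2^-1 *: x + z - 2^-1 *: (z ** z))).
    by lmod R[i].
  by rewrite (k (M^-1%:C *: a)) -hs subrr addr0.
exists ((Num.sqrt M)%:C *: s); split.
- by rewrite starZ conj_real ss // starZ conj_real sa.
- by apply: posZ => //; exact: sqrtr_ge0.
- rewrite !cmulE scalerA s2 scalerA -!rmorphM /= -expr2 sqr_sqrtr //.
  by rewrite divff // rmorph1 scale1r.
- by move=> c ca; rewrite cmulZl cmulZr sc // cmulZl cmulZr ca.
Qed.

(** The normal element n = s + i t has n^* n = s^2 + t^2 and real part s, so |s| <= |n|. *)
Lemma sq_mono s t : star s = s -> star t = t -> s ** t = t ** s ->
  nrm (s ** s) <= nrm (s ** s + t ** t).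
Proof.
move=> ss st ts; pose n := s + 'i *: t.
have ii : 'i * 'i = -1 :> R[i] by rewrite -expr2 sqr_i.
have sn : star n = s - 'i *: t by rewrite /n !starE ss st scaleNr.
have -> : s ** s + t ** t = star n ** n.
  rewrite sn /n !cmulE ts.
  by rewrite !(scalerDr, scalerN, scalerA, mulrN, mulNr, ii); lmod R[i].
rewrite nrm_cstar nrm_sa // ler_pXn2r ?nnegrE ?nrm_ge0 //.
have -> : s = 2^-1 *: (n + star n) by rewrite sn /n; lmod R[i].
by rewrite nrm_half; have := nrmD n (star n); rewrite nrm_star; lra.
Qed.

(* Compares the norms of z^* (1 - z z^* ) and (1 - z^* z) z^*. *)
Lemma no_negative_square z v w : star v = v -> star w = w ->
  star z ** z = - (v ** v) -> z ** star z = w ** w -> nrm z = 1 -> False.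
Proof.
move=> sv sw zv zw z1.
have nw : nrm w = 1.
  by apply/eqP; rewrite -(@eqrXn2 _ 2) ?nrm_ge0 // -nrm_sa // -zw nrm_cstar' z1.
have nv : nrm v = 1.
  by apply/eqP; rewrite -(@eqrXn2 _ 2) ?nrm_ge0 // -nrm_sa // -nrmN -zv nrm_cstar z1.
pose e := star z - star z ** (z ** star z).
have e1 : nrm e <= 1.
  rewrite -(@ler_pXn2r _ 2) ?nnegrE ?nrm_ge0 // -nrm_cstar expr1n.
  have -> : star e ** e = (w - w ** w ** w) ** (w - w ** w ** w).
    have -> : star e ** e = z ** star z - z ** star z ** (z ** star z)
        - z ** star z ** (z ** star z) + z ** star z ** (z ** star z) ** (z ** star z).
      by rewrite /e !starE !cmulE; lmod R[i].
    by rewrite zw !cmulE; lmod R[i].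
  rewrite nrm_sa; last by rewrite !starE sw !cmulA.
  by rewrite expr_le1 ?nrm_ge0 // -nw; apply: sq_contr; rewrite ?nw.
have e2 : star z ** (z ** star z) = - (v ** v ** star z) by rewrite cmulA zv cmulNl.
have ee : nrm e ^+ 2 = nrm (v ** v + 2 *: (v ** v ** v ** v) + v ** v ** v ** v ** v ** v).
  rewrite -nrm_cstar' /e e2 opprK.
  have -> : (star z + v ** v ** star z) ** star (star z + v ** v ** star z) =
    star z ** z + star z ** z ** (v ** v) + v ** v ** (star z ** z)
      + v ** v ** (star z ** z) ** (v ** v).
    by rewrite !starE sv !cmulE; lmod R[i].
  by rewrite zv -nrmN; congr nrm; rewrite !cmulE; lmod R[i].
have svv : star (v ** v) = v ** v by rewrite starM sv.
have svvv : star (v ** v ** v) = v ** v ** v by rewrite !starM sv cmulA.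
(* The split 2 = 25/16 + 7/16: with s = (5/4) v^2 and t^2 = v^2 + (7/16) v^4 + v^6 one gets |e|^2 =
   |s^2 + t^2| >= |s^2| = 25/16 > 1, against [e1]. *)
have k0 : (0 : R) <= 7%:R / 16%:R by [].
have [t [st _ tt tc]] :=
  pos_sqrt (posD (posD (pos_sq sv) (posZ k0 (pos_sq svv))) (pos_sq svvv)).
pose s := (5%:R / 4%:R)%:C *: (v ** v).
have ss : star s = s by rewrite /s starZ conj_real starM sv.
have st' : s ** t = t ** s by rewrite /s cmulZl cmulZr tc // !cmulE.
have := sq_mono ss st st'; rewrite tt.
rewrite (_ : s ** s + _ =
   v ** v + 2 *: (v ** v ** v ** v) + v ** v ** v ** v ** v ** v); last first.
  rewrite /s !rmorphM !fmorphV !rmorph_nat !cmulE; lmod R[i].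
rewrite -ee nrm_sa // /s nrmZr // nrm_sa // nv expr1n.
by have := nrm_ge0 e; nra.
Qed.

(* Kaplansky's trick: for p = b^* b, q = (p ^ 2) ^ (1/2) and n = q - p, the
   element z = b n has z^* z = - n q n <= 0; hence z = 0 and then p = q. *)
Theorem star_mul_sq b : exists2 s, star s = s & star b ** b = s ** s.
Proof.
have [p ep] : exists p, p = star b ** b by exists (star b ** b).
have sp : star p = p by rewrite ep starM starK.
have [q [sq posq qq cq]] := pos_sqrt (pos_sq sp).
have pq : p ** q = q ** p by apply: cq; rewrite cmulA.
have [r [sr _ rr cr]] := pos_sqrt posq.
have pr : p ** r = r ** p by apply: cr.
have qr : q ** r = r ** q by apply: cr.
pose n := q - p; have sn : star n = n by rewrite /n starB sq sp.
have nr : n ** r = r ** n by rewrite /n !cmulE qr pr.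
have pn : p ** n = - (q ** n) by rewrite /n !cmulE -qq pq; lmod R[i].
have nn : n ** n = 2 *: (q ** n) by rewrite /n !cmulE -qq pq; lmod R[i].
have en : n = q - p by [].
clearbody n; pose z := b ** n; pose v := r ** n.
have sv : star v = v by rewrite /v starM sn sr.
have zv : star z ** z = - (v ** v).
  have -> : star z ** z = n ** (p ** n) by rewrite /z starM sn ep !cmulA.
  by rewrite pn -rr /v cmulNr !cmulA nr.
have z0 : z = 0.
  have [z0|z0] := eqVneq (nrm z) 0; first exact: nrm_eq0.
  exfalso; have pz : 0 < nrm z by rewrite lt_neqAle eq_sym z0 nrm_ge0.
  have [w [sw _ ww _]] : exists w, [/\ star w = w, pos w, w ** w = z ** star z &
      forall c, c ** (z ** star z) = (z ** star z) ** c -> c ** w = w ** c].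
    (* z z^* + z^* z is half of h^2 + k^2 with h, k self-adjoint, and z^* z = - v^2; so z z^* is a
       sum of squares and has a root w. *)
    apply: pos_sqrt; pose h := z + star z; pose k := 'i *: (z - star z).
    have -> : z ** star z = v ** v + (2^-1)%:C *: (h ** h + k ** k).
      have ii : 'i * 'i = -1 :> R[i] by rewrite -expr2 sqr_i.
      have -> : h ** h + k ** k = 2 *: (z ** star z) + 2 *: (star z ** z).
        rewrite /h /k !cmulE.
        by rewrite !(scalerDr, scalerN, scalerA, mulrN, mulNr, ii); lmod R[i].
      by rewrite zv fmorphV rmorph_nat; lmod R[i].
    have sh : star h = h by rewrite /h starD starK addrC.
    have sk : star k = k by rewrite /k !starE; lmod R[i].
    apply: posD; first exact: pos_sq.
    by apply: posZ; rewrite ?invr_ge0 //; apply: posD; exact: pos_sq.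
  pose c := (nrm z)^-1.
  have c0 : 0 <= c by rewrite invr_ge0 nrm_ge0.
  apply: (@no_negative_square (c%:C *: z) (c%:C *: v) (c%:C *: w));
    rewrite ?starZ ?conj_real ?sv ?sw //.
  - by rewrite !(cmulZl, cmulZr) zv !scalerN.
  - by rewrite !(cmulZl, cmulZr) ww.
  - by rewrite nrmZr // mulVf.
exists r => //; rewrite rr -ep.
have qn : q ** n = 0.
  by apply/eqP; rewrite -oppr_eq0 -pn ep -cmulA -/z z0 cmul0r.
have n0 : n = 0 by apply: cstar_eq0; rewrite sn nn qn scaler0.
by move/eqP: n0; rewrite en subr_eq0 => /eqP.
Qed.

End Positivity.

(** * Closed subspaces, bounded linear maps and total families *)

Section Closed.
Context (R : realType).
Implicit Types V W : completeNormedModType R[i].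

Definition bounded_fun V W (f : V -> W) : Prop :=
  exists c : R, forall x, nrm (f x) <= c * nrm x.

Lemma clin_preim V W (f : V -> W) (P : W -> Prop) :
  linear f -> bounded_fun f -> clin P -> clin (fun x => P (f x)).
Proof.
move=> lf [c hc] [P0 PL Pc]; split.
- by rewrite linear_fun0.
- by move=> k x y px py; rewrite lf; apply: PL.
- move=> x hx; apply: Pc => e e0.
  have c0 : 0 < `|c| + 1 by have := normr_ge0 c; lra.
  have [y [py xy]] := hx _ (divr_gt0 e0 c0); exists (f y); split=> //.
  rewrite -linear_funB //; apply: le_lt_trans (hc _) _.
  rewrite ltr_pdivlMr // in xy; have := ler_norm c; have := nrm_ge0 (x - y).
  nra.
Qed.

Lemma clin_ker V : clin (fun x : V => x = 0).
Proof.
split=> // [k x y -> ->|x hx]; first by rewrite scaler0 addr0.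
by apply: nrm_small => e /hx [y [-> ]]; rewrite subr0.
Qed.

Lemma clin_eq V W (f g : V -> W) :
  linear f -> linear g -> bounded_fun f -> bounded_fun g ->
  clin (fun x => f x = g x).
Proof.
move=> lf lg [c hc] [d hd].
have [||K1 K2 K3] := @clin_preim _ _ (fun x => f x - g x) _ _ _ (clin_ker W).
- by move=> k x y; rewrite lf lg; lmod R[i].
- exists (c + d) => x; have := nrmD (f x) (- g x); rewrite nrmN.
  by have := hc x; have := hd x; lra.
have E x : (f x = g x) <-> (f x - g x = 0).
  by split=> [->|/eqP]; rewrite ?subrr // subr_eq0 => /eqP.
split; first exact/E.
- by move=> k x y /E hx /E hy; apply/E; apply: K2.
- move=> x hx; apply/E; apply: K3 => e /hx [y [/E hy xy]].
  by exists y.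
Qed.

Definition tot V (J : Type) (F : J -> V) : Prop := total (fun x => exists j, x = F j).

Lemma totP V (J : Type) (F : J -> V) : tot F ->
  forall P : V -> Prop, clin P -> (forall j, P (F j)) -> forall x, P x.
Proof. by move=> h P cP hP; apply: h => // _ [j ->]. Qed.

Lemma totI V (J : Type) (F : J -> V) :
  (forall P : V -> Prop, clin P -> (forall j, P (F j)) -> forall x, P x) -> tot F.
Proof. by move=> h P cP hP; apply: h => // j; apply: hP; exists j. Qed.

Lemma tot_eq V W (J : Type) (F : J -> V) (f g : V -> W) : tot F ->
  linear f -> linear g -> bounded_fun f -> bounded_fun g ->
  (forall j, f (F j) = g (F j)) -> forall x, f x = g x.
Proof. by move=> h lf lg bf bg e; apply: (totP h) => //; exact: clin_eq. Qed.

Lemma inv_small (e : R) : 0 < e ->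
  exists N, forall n, (N <= n)%N -> n.+1%:R^-1 < e.
Proof.
move=> e0; have := archi_boundP (ltW (divr_gt0 ltr01 e0)).
set N := Num.bound _ => hN; exists N => n Nn.
rewrite -[X in X < _]mul1r ltr_pdivrMr //; move: hN; rewrite ltr_pdivrMr //.
have : N%:R <= n.+1%:R :> R by rewrite ler_nat; lia.
nra.
Qed.

Lemma approx_seq V (P : V -> Prop) x :
  (forall e : R, 0 < e -> exists y, P y /\ nrm (x - y) < e) ->
  exists u : nat -> V, (forall n, P (u n)) /\ tends u x.
Proof.
move=> hx; have pn n : 0 < n.+1%:R^-1 :> R by rewrite invr_gt0.
have /choice [u hu] n := hx _ (pn n).
exists u; split=> [n|e /inv_small [N hN]]; first by case: (hu n).
exists N => n /hN; apply: lt_trans; rewrite nrmB; by case: (hu n).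
Qed.

(** Approximants of x are related to a sequence that is Cauchy because the relation is isometric;
    its limit is related to x because the relation is closed. *)
Lemma isometric_domain V W (C : V -> W -> Prop) :
  C 0 0 ->
  (forall k x y x' y', C x y -> C x' y' -> C (k *: x + x') (k *: y + y')) ->
  (forall u v x y, (forall n, C (u n) (v n)) -> tends u x -> tends v y -> C x y) ->
  (forall x y, C x y -> nrm x = nrm y) ->
  clin (fun x => exists y, C x y).
Proof.
move=> C0 CL CC Cn; split; first by exists 0.
  by move=> k x x' [y h] [y' h']; exists (k *: y + y'); apply: CL.
move=> x /approx_seq [u [/choice [v huv] hu]].
have [|y hy] := @complete_seq _ _ v; last by exists y; apply: CC huv hu hy.
move=> e e0; have e2 : 0 < e / 2 by lra.
have [N hN] := hu _ e2; exists N => m n /hN hm /hN hn.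
have C1 := CL (-1) _ _ _ _ (huv n) (huv m).
rewrite !scaleN1r ![- _ + _]addrC in C1; rewrite -(Cn _ _ C1).
by have := nrm_trans (u m) x (u n); rewrite (nrmB x); lra.
Qed.

End Closed.

(** * Unitaries between Hilbert modules *)

Section UMap.
Context (R : realType) (B : cstarAlg R).
Implicit Types X Y Z : hilbMod B.

(** B-linearity is not listed because it follows from the other conditions, see [umap_ract]. *)
Definition umap X Y (U : X -> Y) : Prop :=
  [/\ linear U, forall x y, ip (U x) (U y) = ip x y & forall y, exists x, U x = y].

Lemma ip_nrm X Y (x : X) (y : Y) : ip x x = ip y y -> nrm x = nrm y.
Proof.
by move=> h; apply/eqP; rewrite -(@eqrXn2 _ 2) ?nrm_ge0 // -!nrm_ip h.
Qed.

Lemma umap_nrm X Y (U : X -> Y) x : umap U -> nrm (U x) = nrm x.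
Proof. by move=> [_ h _]; apply: ip_nrm. Qed.

Lemma umap_bounded X Y (U : X -> Y) : umap U -> bounded_fun U.
Proof. by move=> h; exists 1 => x; rewrite umap_nrm // mul1r. Qed.

Lemma umap_inj X Y (U : X -> Y) : umap U -> injective U.
Proof.
move=> h x y e; apply/eqP; rewrite -subr_eq0; apply/eqP/nrm_eq0.
by rewrite -(umap_nrm _ h); case: h => lU _ _; rewrite linear_funB // e subrr nrm0.
Qed.

Lemma umap_ract X Y (U : X -> Y) x b : umap U -> U (ract x b) = ract (U x) b.
Proof.
move=> [_ h s]; apply: ip_ext => z; have [w <-] := s z.
by rewrite ip_ract !h ip_ract.
Qed.

Lemma umap_adj X Y (U : X -> Y) : umap U -> exists V : Y -> X,
  [/\ umap V, cancel U V, cancel V U & forall x y, ip (U x) y = ip x (V y)].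
Proof.
move=> hU; have [lU iU sU] := hU; have [V hV] := choice sU.
have UV : cancel V U by [].
have VU : cancel U V by move=> x; apply: (umap_inj hU).
exists V; split=> // [|x y]; last by rewrite -iU UV.
split=> [k x y|x y|x]; last by exists (U x).
- by apply: (umap_inj hU); rewrite lU !UV.
- by rewrite -iU !UV.
Qed.

Lemma umap_comp X Y Z (U : X -> Y) (V : Y -> Z) :
  umap U -> umap V -> umap (fun x => V (U x)).
Proof.
move=> [lU iU sU] [lV iV sV]; split=> [k x y|x y|z]; first by rewrite lU lV.
  by rewrite iV iU.
by have [y <-] := sV z; have [x <-] := sU y; exists x.
Qed.

Lemma umap_tot X Y (J : Type) (U : X -> Y) (F : J -> X) :
  umap U -> tot F -> tot (fun j => U (F j)).
Proof.
move=> hU h; apply: totI => P cP hP y; have [lU _ sU] := hU.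
have [x <-] := sU y.
exact: (totP h (clin_preim lU (umap_bounded hU) cP) hP).
Qed.

(* U is the least closed linear relation containing all the pairs
   (F j, F' j); it preserves inner products. *)
Theorem umap_extension X Y (J : Type) (F : J -> X) (F' : J -> Y) :
  tot F -> tot F' -> (forall i j, ip (F i) (F j) = ip (F' i) (F' j)) ->
  exists U : X -> Y, umap U /\ forall j, U (F j) = F' j.
Proof.
move=> tF tF' hF.
pose cl2 (Q : X -> Y -> Prop) := [/\ Q 0 0,
   forall k x y x' y', Q x y -> Q x' y' -> Q (k *: x + x') (k *: y + y') &
   forall u v x y, (forall n, Q (u n) (v n)) -> tends u x -> tends v y -> Q x y].
pose C x y := forall Q, cl2 Q -> (forall j, Q (F j) (F' j)) -> Q x y.
have C0 : C 0 0 by move=> Q [].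
have CL k x y x' y' : C x y -> C x' y' -> C (k *: x + x') (k *: y + y').
  by move=> h h' Q cQ hQ; have [_ QL _] := cQ; apply: QL; [apply: h|apply: h'].
have CC u v x y : (forall n, C (u n) (v n)) -> tends u x -> tends v y -> C x y.
  move=> h hu hv Q cQ hQ; have [_ _ Qc] := cQ.
  by apply: (Qc u v) => // n; apply: h.
have CF j : C (F j) (F' j) by move=> Q cQ; apply.
have tip (Z : hilbMod B) (z : Z) u w : tends u w -> tends (fun n => ip z (u n)) (ip z w).
  apply: (@tends_map _ _ _ _ (4 * nrm z)) => x y.
  by rewrite -(linear_funB (ip_linear_r z)) nrm_ip_le.
have cip x' y' : cl2 (fun x y => ip x' x = ip y' y).
  split; first by rewrite !ip0r.
    by move=> k x y x2 y2 h1 h2; rewrite !ipE h1 h2.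
  move=> u v x y h /(tip _ x') hx /(tip _ y') hy.
  by apply: tends_uniq hx _; apply: tends_ext hy => n; rewrite h.
(* By minimality of C the inner products are compared by induction on C, in one variable and then in
   the other. *)
have iso1 j x y : C x y -> ip (F j) x = ip (F' j) y.
  by move=> /(_ _ (cip (F j) (F' j))); apply=> i; exact: hF.
have iso x' y' x y : C x' y' -> C x y -> ip x' x = ip y' y.
  move=> h /(_ _ (cip x' y')); apply=> j.
  by rewrite -ip_star (iso1 _ _ _ h) ip_star.
have Cn x y : C x y -> nrm x = nrm y by move=> h; apply: ip_nrm; exact: iso.
have CB x y x' y' : C x y -> C x' y' -> C (x - x') (y - y').
  move=> h h'; have := CL (-1) _ _ _ _ h' h.
  by rewrite !scaleN1r ![- _ + _]addrC.
have domC x : exists y, C x y.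
  move: x; apply: (totP tF) => [|j]; last by exists (F' j).
  exact: isometric_domain.
have ranC y : exists x, C x y.
  move: y; apply: (totP tF') => [|j]; last by exists (F j).
  apply: (@isometric_domain _ Y X (fun y x => C x y)) => //.
  - by move=> k x y x' y'; exact: CL.
  - by move=> u v x y h hu hv; apply: (CC v u).
  - by move=> x y /Cn.
have [U hU] := choice domC.
exists U; split=> [|j].
  split=> [k x y|x y|y].
  - apply/eqP; rewrite -subr_eq0; apply/eqP/nrm_eq0.
    by rewrite -(Cn _ _ (CB _ _ _ _ (hU _) (CL k _ _ _ _ (hU x) (hU y)))) subrr nrm0.
  - by rewrite -(iso _ _ _ _ (hU x) (hU y)).
  - have [x hx] := ranC y; exists x.
    apply/eqP; rewrite -subr_eq0; apply/eqP/nrm_eq0.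
    by rewrite -(Cn _ _ (CB _ _ _ _ (hU x) hx)) subrr nrm0.
apply/eqP; rewrite -subr_eq0; apply/eqP/nrm_eq0.
by rewrite -(Cn _ _ (CB _ _ _ _ (hU _) (CF j))) subrr nrm0.
Qed.

End UMap.

(** * Continuous paths *)

Section Paths.
Context (R : realType).
Implicit Types V W : completeNormedModType R[i].

Definition pcont V (g : R -> V) : Prop :=
  forall t : R, t \in `[0, 1] -> forall e : R, 0 < e -> exists2 d : R, 0 < d &
    forall s : R, s \in `[0, 1] -> `|s - t| < d -> nrm (g s - g t) < e.

Lemma within_pcont V (g : R -> V) :
  {within `[0, 1]%classic, continuous g} <-> pcont g.
Proof.
rewrite subspace_continuousP; split=> h t tI.
  move=> e e0; have /cvgrPdist_lt/(_ e%:C) := h t tI.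
  rewrite ltcR => /(_ e0); rewrite near_withinE => /nbhs_ballP [d /= d0 hd].
  exists d => // s sI st; have := hd s; rewrite /ball /= distrC => /(_ st sI).
  by rewrite distrC normE ltcR.
apply/cvgrPdist_lt => e e0.
have re : (complex.Re e)%:C = e by rewrite RRe_real // gtr0_real.
have [|d d0 hd] := h t tI (complex.Re e); first by rewrite -ltcR re.
rewrite near_withinE; apply/nbhs_ballP; exists d => //= s.
rewrite /ball /= distrC => st sI; rewrite distrC normE -re ltcR.
exact: hd.
Qed.

(** Compactness of [0,1], in the near-covering form. *)
Lemma uniform_on_I (P : nat -> R -> Prop) :
  (forall t : R, t \in `[0, 1] -> exists2 d : R, 0 < d & exists N,
     forall s : R, s \in `[0, 1] -> `|s - t| < d -> forall n, (N <= n)%N -> P n s) ->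
  exists N, forall n, (N <= n)%N -> forall t : R, t \in `[0, 1] -> P n t.
Proof.
move=> h.
have /compact_near_coveringP/(_ nat \oo (fun n t => t \in `[0, 1] -> P n t) _) :=
  @segment_compact R 0 1.
case=> [t tI|N _ hN]; last by exists N => n Nn t tI; exact: hN.
have [d d0 [N hN]] := h t tI.
exists (ball t d, [set n | (N <= n)%N]) => /=.
  by split; [exact: nbhsx_ballx|exists N].
by move=> [s n] /= [ts Nn] sI; apply: hN => //; move: ts; rewrite /ball /= distrC.
Qed.

Lemma pcontD V (f g : R -> V) : pcont f -> pcont g -> pcont (fun t => f t + g t).
Proof.
move=> hf hg t tI e e0; have e2 : 0 < e / 2 by lra.
have [d d0 hd] := hf t tI _ e2; have [c c0 hc] := hg t tI _ e2.
exists (Num.min d c) => [|s sI]; first by rewrite lt_min d0.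
rewrite lt_min => /andP[/(hd _ sI) h1 /(hc _ sI) h2].
have -> : f s + g s - (f t + g t) = (f s - f t) + (g s - g t) by lmod R[i].
by have := nrmD (f s - f t) (g s - g t); lra.
Qed.

Lemma pcont_const V (a : V) : pcont (fun=> a).
Proof. by move=> t tI e e0; exists 1 => // s _ _; rewrite subrr nrm0. Qed.

Lemma pcont_ext V (f g : R -> V) :
  (forall t : R, t \in `[0, 1] -> f t = g t) -> pcont f -> pcont g.
Proof.
move=> fg h t tI e e0; have [d d0 hd] := h t tI e e0.
by exists d => // s sI; rewrite -!fg //; exact: hd.
Qed.

(* Strong continuity suffices, because the maps F s are uniformly Lipschitz. *)
Lemma pcont_app V W (F : R -> V -> W) (c : R) (g : R -> V) :
  (forall t : R, t \in `[0, 1] -> forall x y, nrm (F t x - F t y) <= c * nrm (x - y)) ->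
  (forall x, pcont (F ^~ x)) -> pcont g -> pcont (fun t => F t (g t)).
Proof.
move=> hF cF hg t tI e e0; have c0 : 0 < 2 * (`|c| + 1) by have := normr_ge0 c; lra.
have e2 : 0 < e / 2 by lra.
have [d d0 hd] := hg t tI _ (divr_gt0 e0 c0); have [b b0 hb] := cF (g t) t tI _ e2.
exists (Num.min d b) => [|s sI]; first by rewrite lt_min d0.
rewrite lt_min => /andP[/(hd _ sI) h1 /(hb _ sI) h2].
apply: le_lt_trans (nrm_trans _ (F s (g t)) _) _.
rewrite ltr_pdivlMr // in h1; have := hF s sI (g s) (g t); have := ler_norm c.
have := nrm_ge0 (g s - g t); nra.
Qed.

Lemma pcont_map V W (f : V -> W) (c : R) (g : R -> V) :
  (forall x y, nrm (f x - f y) <= c * nrm (x - y)) -> pcont g -> pcont (fun t => f (g t)).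
Proof.
move=> hf; apply: (@pcont_app _ _ (fun=> f) c) => // x; exact: pcont_const.
Qed.

Lemma pcontZ V (k : R[i]) (g : R -> V) : pcont g -> pcont (fun t => k *: g t).
Proof.
apply: (@pcont_map _ _ _ (complex.Re `|k|)) => x y; by rewrite -scalerBr nrmZ.
Qed.

Lemma pcont_lim V (u : nat -> R -> V) (g : R -> V) :
  (forall n, pcont (u n)) ->
  (forall e : R, 0 < e -> exists n, forall t : R, t \in `[0, 1] -> nrm (u n t - g t) < e) ->
  pcont g.
Proof.
move=> hu h t tI e e0; have e3 : 0 < e / 3 by lra.
have [n hn] := h _ e3; have [d d0 hd] := hu n t tI _ e3.
exists d => // s sI st; have := nrm_trans (g s) (u n s) (g t).
have := nrm_trans (u n s) (u n t) (g t); have := hd s sI st; have := hn s sI.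
have := hn t tI; rewrite (nrmB (u n s) (g s)); lra.
Qed.

Lemma pcontM (A : cstarAlg R) (f g : R -> A) :
  pcont f -> pcont g -> pcont (fun t => f t ** g t).
Proof.
move=> hf hg t tI e e0.
have K0 : 0 < nrm (f t) + nrm (g t) + 1.
  by have := nrm_ge0 (f t); have := nrm_ge0 (g t); lra.
set K := _ + _ in K0.
have e1 : 0 < Num.min 1 (e / (2 * K)) by rewrite lt_min ltr01 divr_gt0 ?mulr_gt0.
have [d d0 hd] := hf t tI _ e1; have [c c0 hc] := hg t tI _ e1.
exists (Num.min d c) => [|s sI]; first by rewrite lt_min d0.
rewrite lt_min => /andP[/(hd _ sI) h1 /(hc _ sI) h2].
move: h1 h2; rewrite !lt_min !ltr_pdivlMr ?mulr_gt0 // => /andP[h1 h1'] /andP[h2 h2'].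
have -> : f s ** g s - f t ** g t = f s ** (g s - g t) + (f s - f t) ** g t.
  by rewrite !cmulE; lmod R[i].
apply: le_lt_trans (nrmD _ _) _.
have h3 := nrmM (f s) (g s - g t); have h4 := nrmM (f s - f t) (g t).
have h5 := nrmD (f s - f t) (f t); rewrite subrK in h5.
have h6 : nrm (f s) <= K by rewrite /K; have := nrm_ge0 (g t); lra.
have h7 : nrm (g t) <= K by rewrite /K; have := nrm_ge0 (f t); lra.
have := ler_wpM2r (nrm_ge0 (g s - g t)) h6.
have := ler_wpM2l (nrm_ge0 (f s - f t)) h7; lra.
Qed.

End Paths.

(** * The norm and the constant elements of C([0,1],A) *)

Section PathAlgebra.
Context (R : realType) (A : cstarAlg R) (IA : path_alg A).
Local Notation ev := (pa_ev IA).

Lemma pcont_sqrt_iter (t : R) (a : R -> A) n :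
  pcont a -> pcont (fun s => sqrt_iter t (a s) n).
Proof.
move=> ha; elim: n => [|n IH] /=; first exact: pcont_const.
apply: pcontD; first by apply: pcontD; exact: pcontZ.
apply: (@pcont_ext _ _ (fun s => (- 2^-1) *: (sqrt_iter t (a s) n ** sqrt_iter t (a s) n))).
  by move=> s _; rewrite scaleNr.
by apply: pcontZ; apply: pcontM.
Qed.

Lemma path_pcont (f : IA) : pcont (fun t => ev t f).
Proof. by apply/within_pcont; exact: pa_cont. Qed.

Lemma path_mk (g : R -> A) : pcont g ->
  exists f : IA, forall t : R, t \in `[0, 1] -> ev t f = g t.
Proof. by move=> /within_pcont; exact: pa_surj. Qed.

(** [IA] comes with some C*-norm, so the supremum bound has to be forced by algebra. The pointwise
    s(t) with (1 + s)^2 = 1 - g^2 vary continuously, since the iteration converges uniformly in t;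
    they form an element of [IA], and [unit_trick] applies inside [IA]. *)
Lemma path_norm_sa (g : IA) : star g = g ->
  (forall t : R, t \in `[0, 1] -> nrm (ev t g) <= 1) -> nrm g <= 1.
Proof.
move=> sg hg; pose a t := - (ev t g ** ev t g).
have sgt t : star (ev t g) = ev t g by rewrite -sfunS sg.
have /choice [s hs] t : exists s : A, t \in `[0, 1] ->
  [/\ star s = s, a t = s + s + s ** s, ev t g ** s = s ** ev t g &
      forall n, nrm (sqrt_iter 0 (a t) n - s) <= 2 * (1 - rho 1 n)].
  have [tI|] := boolP (t \in `[0, 1]); last by exists 0.
  have [||s [e ss sc hn _]] := @sqrt_iter_cvg R A 0 (a t); first by left.
    move=> y; rewrite scale0r sub0r -cmulNl /a opprK.
    apply: le_trans (nrmM _ _) _; rewrite ler_piMl ?nrm_ge0 // nrm_sa //.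
    by rewrite expr_le1 ?nrm_ge0 // hg.
  exists s => _; split=> //.
  - by apply: ss; rewrite /a starN starM sgt.
  - rewrite {1 2}e; lmod R[i].
  - by apply: sc; rewrite /a cmulNr cmulNl cmulA.
have cs : pcont s.
  apply: (@pcont_lim _ _ (fun n t => sqrt_iter 0 (a t) n)).
    move=> n; apply: pcont_sqrt_iter; rewrite /a.
    apply: (@pcont_ext _ _ (fun t => (-1) *: (ev t g ** ev t g))).
      by move=> t _; rewrite scaleN1r.
    by apply: pcontZ; apply: pcontM; exact: path_pcont.
  move=> e /rho_cvg [n hn]; exists n => t tI.
  by have [_ _ _ h] := hs t tI; apply: le_lt_trans (h n) (hn n _).
have [r hr] := path_mk cs.
have key y : nrm (g ** y) <= nrm y.
  have [||||h _] := @unit_trick _ _ _ (id_corr IA) g (- r) _ _ _ _ y => //.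
  - apply: (@pa_inj _ _ IA) => t tI; have [h _ _ _] := hs t tI.
    by rewrite starN !(linear_funN (sfun_lin _)) sfunS hr // h.
  - apply: (@pa_inj _ _ IA) => t tI; have [_ _ h _] := hs t tI.
    by rewrite cmulNr cmulNl !(linear_funN (sfun_lin _)) !Defs.sfunM hr // h.
  - apply: (@pa_inj _ _ IA) => t tI; have [_ h _ _] := hs t tI.
    rewrite cmulNr cmulNl opprK !(linear_funD (sfun_lin _), linear_funN (sfun_lin _)).
    by rewrite !Defs.sfunM hr // -[LHS]opprK -/(a t) h; lmod R[i].
by apply: lmul_bound => // y; rewrite mul1r.
Qed.

Lemma path_norm (f : IA) (C : R) :
  0 <= C -> (forall t : R, t \in `[0, 1] -> nrm (ev t f) <= C) -> nrm f <= C.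
Proof.
(* Adding e allows f to be divided by the bound even if C = 0. *)
move=> C0 hf; apply/ler_addgt0Pl => e e0; have Ce : 0 < e + C by lra.
have [c0 ci] : 0 < (e + C)^-1 /\ 0 <= (e + C)^-1.
  by rewrite invr_ge0 invr_gt0; split=> //; exact: ltW.
pose g := (e + C)^-1%:C *: f.
have : nrm (star g ** g) <= 1.
  apply: path_norm_sa => [|t tI]; first by rewrite starM starK.
  rewrite Defs.sfunM sfunS nrm_cstar expr_le1 ?nrm_ge0 //.
  rewrite /g (linear_funZ (sfun_lin _)) nrmZr // ler_pdivrMl // mulr1.
  by have := hf t tI; lra.
by rewrite nrm_cstar expr_le1 ?nrm_ge0 // /g nrmZr // ler_pdivrMl // mulr1.
Qed.

Lemma path_cst : exists c : A -> IA, forall a (t : R), t \in `[0, 1] -> ev t (c a) = a.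
Proof.
have /choice [c hc] (a : A) : exists f : IA, forall t : R, t \in `[0, 1] -> ev t f = a.
  by apply: path_mk; exact: pcont_const.
by exists c.
Qed.

(** The bound C spreads the convergence at t to a neighbourhood of t; compactness then makes it
    uniform, which is convergence in the norm of [IA] by [path_norm]. *)
Lemma path_uniform (c : A -> IA) (Q : nat -> A) (C : R) :
  (forall a (t : R), t \in `[0, 1] -> ev t (c a) = a) ->
  (forall n, nrm (Q n) <= C) -> (forall a, tends (fun n => Q n ** a) a) ->
  forall f : IA, tends (fun n => c (Q n) ** f) f.
Proof.
move=> hc QC hQ f e e0.
have [|N hN] := @uniform_on_I _ (fun n t => nrm (Q n ** ev t f - ev t f) < e / 2).
  move=> t tI; have e4 : 0 < e / 4 by lra.
  have C1 : 0 < 4 * (`|C| + 1) by have := normr_ge0 C; lra.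
  have [N hN] := hQ (ev t f) _ e4.
  have [d d0 hd] := path_pcont f tI (divr_gt0 e0 C1).
  exists d => //; exists N => s sI /(hd s sI) h1 n /hN h2.
  rewrite ltr_pdivlMr // in h1.
  have -> : Q n ** ev s f - ev s f = Q n ** (ev s f - ev t f)
      + ((Q n ** ev t f - ev t f) - (ev s f - ev t f)).
    by rewrite !cmulE; lmod R[i].
  apply: le_lt_trans (nrmD _ _) _.
  have := nrmD (Q n ** ev t f - ev t f) (- (ev s f - ev t f)); rewrite nrmN.
  have := nrmM (Q n) (ev s f - ev t f); have := ler_norm C; have := QC n.
  move: (nrm_ge0 (ev s f - ev t f)) (normr_ge0 C) => n0 C0 h3 h4.
  have := ler_wpM2r n0 (le_trans h3 h4); nra.
exists N => n Nn; apply: (@le_lt_trans _ _ (e / 2)); last lra.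
apply: path_norm => [|t tI]; first by rewrite divr_ge0 // ltW.
by rewrite linear_funB ?Defs.sfunM ?hc //; [exact/ltW/hN|exact: sfun_lin].
Qed.

End PathAlgebra.

(** * Approximate matrix units and trivialization *)

Section Dominant.
Context (R : realType) (V : completeNormedModType R[i]).

(* Any positive sequence with lam (n+1) / lam n -> 0 and lam (n+1) <= lam n / 2
   would do. *)
Definition lam (n : nat) : R := (n.+1)`!%:R^-1.

Lemma lam_gt0 n : 0 < lam n.
Proof. by rewrite invr_gt0 ltr0n fact_gt0. Qed.

Lemma lamS n : lam n.+1 * n.+2%:R = lam n.
Proof.
rewrite /lam [(n.+2)`!]factS natrM invfM -mulrA mulrCA mulVf ?mulr1 //.
Qed.

Lemma lam_half n : lam n <= 2 * lam n - 2 * lam n.+1.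
Proof.
have := lamS n; have := lam_gt0 n.+1.
have : 2 <= n.+2%:R :> R by rewrite (ler_nat R 2).
nra.
Qed.

Lemma lam_cvg (C e : R) : 0 < e ->
  exists N, forall n, (N <= n)%N -> C * (2 * lam n) < e.
Proof.
move=> e0; have C0 : 0 < 2 * (`|C| + 1) by have := normr_ge0 C; lra.
have [N hN] := inv_small (divr_gt0 e0 C0); exists N => n /hN.
rewrite ltr_pdivlMr // => h.
have : lam n <= n.+1%:R^-1.
  rewrite lef_pV2 ?posrE ?ltr0n ?fact_gt0 // ler_nat factS leq_pmulr //.
  exact: fact_gt0.
have l0 := lam_gt0 n => hl; apply: le_lt_trans h.
rewrite mulrC; have := ler_wpM2r (ltW C0) hl.
have : 2 * lam n * C <= 2 * lam n * `|C| by rewrite ler_wpM2l ?ler_norm ?mulr_ge0 // ltW.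
move=> h1 h2; apply: le_trans h1 (le_trans _ h2).
by rewrite !mulrDr mulr1 mulrA [lam n * 2]mulrC lerDl; nra.
Qed.

Lemma lam_series (w : nat -> V) (C : R) : 0 <= C -> (forall n, nrm (w n) <= C) ->
  exists l, tends (fun n => \sum_(k < n) (lam k)%:C *: w k) l /\
    forall n, nrm (\sum_(k < n) (lam k)%:C *: w k - l) <= C * (2 * lam n).
Proof.
move=> C0 hw; apply: (increments_cvg (d := fun n => C * (2 * lam n))).
- move=> n; rewrite big_ord_recr /= addrAC subrr add0r nrmZr; last exact/ltW/lam_gt0.
  rewrite -mulrBr mulrC; have := lam_half n; have := hw n; have := lam_gt0 n; nra.
- by move=> e; exact: lam_cvg.
- by move=> n; rewrite !mulr_ge0 // ltW // lam_gt0.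
Qed.

(** The first term that may be nonzero, freed from its weight, is recovered up to the tail of the
    series, whose relative size is at most C times 2 lam (N+1) / lam N = 2 / (N+2). *)
Lemma lam_dominant (w : nat -> V) (C : R) N (l : V) : 0 <= C ->
  (forall n, nrm (w n) <= C) -> (forall n, (n < N)%N -> w n = 0) ->
  tends (fun n => \sum_(k < n) (lam k)%:C *: w k) l ->
  nrm (w N - (lam N)^-1%:C *: l) <= 2 * C / N.+2%:R.
Proof.
move=> C0 hw w0 hl; have [l' [hl' bl]] := lam_series C0 hw.
rewrite -(tends_uniq hl hl') in bl => {l' hl'}.
have := bl N.+1; rewrite big_ord_recr /= big1 ?add0r => [|[i iN] _]; last first.
  by rewrite w0 // scaler0.
have l0 := lam_gt0 N; have li : 0 <= (lam N)^-1 by rewrite invr_ge0 ltW.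
have -> : (lam N)%:C *: w N - l = (lam N)%:C *: (w N - (lam N)^-1%:C *: l).
  by rewrite scalerBr scalerA -rmorphM /= divff ?gt_eqF // rmorph1 scale1r.
rewrite nrmZr ?(ltW l0) // => h; rewrite ler_pdivlMr // -(ler_pM2l (lam_gt0 N.+1)).
move: h; move: (nrm _) => q; rewrite -(lamS N).
by move: (lam N.+1) (N.+2%:R : R) => L K; lra.
Qed.

End Dominant.

(** The exponent of 2 in n takes every value infinitely often. Recurrence at large indices is what
    makes the error in [cyclic_vector] small. *)
Lemma enum_often (K : countType) : exists en : nat -> option K,
  forall x N, exists n, (N <= n)%N /\ en n = Some x.
Proof.
exists (fun n => unpickle (logn 2 n)) => x N.
exists (2 ^ pickle x * (2 * N).+1)%N; split.
  by have := expn_gt0 2 (pickle x); nia.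
rewrite lognM ?expn_gt0 // pfactorK // lognE /= dvdn2 /= mul2n odd_double /= addn0.
by rewrite pickleK.
Qed.

Section ApproximateMatrixUnits.
Context (R : realType).

(* The elements e_ij (x) eps_k of K (x) A, for an approximate unit (eps_k). *)
Definition amu (A : cstarAlg R) (m : nat -> nat -> nat -> A) : Prop :=
  [/\ forall i j k j' l k', j != j' -> m i j k ** m j' l k' = 0,
      forall i j k, star (m i j k) = m j i k,
      forall i j k, nrm (m i j k) <= 1,
      forall i n k, tends (fun l => m i n k ** m n i l) (m i i k) &
      (forall n, nrm (\sum_(i < n) m i i n) <= 2) /\
      forall a, tends (fun n => (\sum_(i < n) m i i n) ** a) a].

(** Constant paths do it: they remain an approximate unit by [path_uniform], so no realization of
    the stabilization of C([0,1],A) enters. *)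
Lemma amu_path (A : cstarAlg R) (IA : path_alg A)
    (m : nat -> nat -> nat -> A) : amu m ->
  exists m' : nat -> nat -> nat -> IA, amu m'.
Proof.
move=> [m1 m2 m3 m4 [m5 m6]]; have [c hc] := path_cst IA.
have cM a b : c (a ** b) = c a ** c b.
  by apply: (@pa_inj _ _ IA) => t tI; rewrite Defs.sfunM !hc.
have cn a : nrm (c a) <= nrm a.
  by apply: path_norm => [|t tI]; rewrite ?nrm_ge0 ?hc.
have clin_c : linear c.
  by move=> k a b; apply: (@pa_inj _ _ IA) => t tI; rewrite sfun_lin !hc.
exists (fun i j k => c (m i j k)); split.
- by move=> i j k j' l k' jj; rewrite -cM m1 // linear_fun0.
- by move=> i j k; apply: (@pa_inj _ _ IA) => t tI; rewrite sfunS !hc.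
- by move=> i j k; apply: le_trans (cn _) _.
- move=> i n k; apply: (@tends_ext _ _ (fun l => c (m i n k ** m n i l))) => [l|].
    by rewrite cM.
  apply: (@tends_map _ _ _ c 1) => // a b.
  by rewrite -linear_funB // mul1r.
- split=> [n|f]; first by rewrite -linear_fun_sum //; exact: le_trans (cn _) _.
  apply: (@tends_ext _ _ (fun n => c (\sum_(i < n) m i i n) ** f)) => [n|].
    by rewrite linear_fun_sum.
  exact: (@path_uniform _ _ IA c _ 2).
Qed.

Lemma starHom_inv (A B : cstarAlg R) (g : starHom A B) : bijective g ->
  exists gi : starHom B A, cancel g gi /\ cancel gi g.
Proof.
move=> [h gK hK].
have l : linear h.
  by move=> k a b; apply: (can_inj gK); rewrite sfun_lin !hK.
have m : forall a b, h (a ** b) = h a ** h b.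
  by move=> a b; apply: (can_inj gK); rewrite Defs.sfunM !hK.
have s : forall a, h (star a) = star (h a).
  by move=> a; apply: (can_inj gK); rewrite sfunS !hK.
by exists (StarHom l m s).
Qed.

(** By orthogonality, 1 minus the sum of the e_i^2 is the product of the 1 - e_i^2, each a
    contraction by [sq_contr]. *)
Lemma contr_sum_sq (A : cstarAlg R) (e : nat -> A) n y :
  (forall i, star (e i) = e i) -> (forall i, nrm (e i) <= 1) ->
  (forall i j, i != j -> e i ** e j = 0) ->
  nrm (y - (\sum_(i < n) e i ** e i) ** y) <= nrm y.
Proof.
move=> es e1 e0; elim: n y => [|n IH] y; first by rewrite big_ord0 cmul0l subr0.
rewrite big_ord_recr /=; set s := \sum_(i < n) _.
have se : s ** (e n ** e n) = 0.
  rewrite /s cmul_suml big1 // => -[i iN] _ /=.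
  by rewrite cmulA -(cmulA (e i)) e0 ?cmul0r ?cmul0l // ltn_eqF.
have -> : y - (s + e n ** e n) ** y = (y - e n ** e n ** y) - s ** (y - e n ** e n ** y).
  have -> : s ** (y - e n ** e n ** y) = s ** y.
    by rewrite cmulDr cmulNr cmulA se cmul0l subr0.
  by rewrite cmulDl; lmod R[i].
by apply: le_trans (IH _) _; apply: sq_contr.
Qed.

Lemma stable_amu (A : cstarAlg R) : stable A -> sigma_unital A ->
  exists m : nat -> nat -> nat -> A, amu m.
Proof.
move=> [D [g /starHom_inv [gi [gK giK]]]] [e [epos e1 _ eL eR]].
have mu0 i j : mxu D i j 0 = 0 by apply: linear_fun0; exact: mxu_lin.
have diag i : exists h : starHom A D, forall a, h a = mxu D i i a.
  have l := @mxu_lin _ _ D i i.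
  have m : forall a b, mxu D i i (a ** b) = mxu D i i a ** mxu D i i b.
    by move=> a b; rewrite mxuM eqxx.
  have s : forall a, mxu D i i (star a) = star (mxu D i i a) by move=> a; rewrite mxuS.
  by exists (StarHom l m s).
have mun i j a : nrm (mxu D i j a) <= nrm a.
  rewrite -(@ler_pXn2r _ 2) ?nnegrE ?nrm_ge0 // -!nrm_cstar mxuS mxuM eqxx.
  by have [h <-] := diag j; exact: starHom_contr.
have en n : nrm (e n) <= 1 by rewrite -lecR -normE.
have /choice [r hr] (n : nat) : exists r : A, star r = r /\ e n = r ** r.
  by have [b ->] := epos n; have [s ss hs] := star_mul_sq b; exists s.
have es n : star (e n) = e n by have [h ->] := hr n; rewrite starM h.
have rn n : nrm (r n) <= 1.
  by have [h h2] := hr n; have := en n; rewrite h2 nrm_sa // expr_le1 ?nrm_ge0.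
pose m i j k := gi (mxu D i j (e k)).
(* With e_n = r_n^2 the sum Q is a sum of orthogonal squares, so |1 - Q| <= 1 on left
   multiplications, and |Q| <= 1 + |1 - Q|. *)
have bnd n : nrm (\sum_(i < n) m i i n) <= 2.
  apply: lmul_bound => // y.
  have := @contr_sum_sq A (fun i => gi (mxu D i i (r n))) n y.
  have -> : \sum_(i < n) gi (mxu D i i (r n)) ** gi (mxu D i i (r n)) =
      \sum_(i < n) m i i n.
    apply: eq_bigr => i _; rewrite -Defs.sfunM mxuM eqxx.
    by have [_ <-] := hr n.
  move=> h; have {}h : nrm (y - (\sum_(i < n) m i i n) ** y) <= nrm y.
    apply: h => [i|i|i j ij].
    - by rewrite -sfunS mxuS; have [-> _] := hr n.
    - exact: le_trans (starHom_contr _ _) (le_trans (mun _ _ _) (rn _)).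
    - by rewrite -Defs.sfunM mxuM (negPf ij) (linear_fun0 (sfun_lin _)).
  have := nrmD y (- (y - (\sum_(i < n) m i i n) ** y)).
  by rewrite nrmN opprB addrC subrK; lra.
exists m; split=> //.
- move=> i j k j' l k' jj.
  by rewrite /m -Defs.sfunM mxuM (negPf jj) (linear_fun0 (sfun_lin _)).
- by move=> i j k; rewrite /m -sfunS mxuS es.
- by move=> i j k; exact: le_trans (starHom_contr _ _) (le_trans (mun _ _ _) (en _)).
- move=> i n k; apply: (@tends_ext _ _ (fun l => gi (mxu D i i (e k ** e l)))).
    by move=> l; rewrite /m -Defs.sfunM mxuM eqxx.
  apply: (@tends_map _ _ _ (fun a => gi (mxu D i i a)) 1) (cvg_tends (eR _)) => x y.
  rewrite mul1r -(linear_funB (sfun_lin _)) -(linear_funB (@mxu_lin _ _ D i i)).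
  exact: le_trans (starHom_contr _ _) (mun _ _ _).
- split=> // a; rewrite -[a]gK; move: (g a) => {a} a.
  pose P (d : D) := tends (fun n => (\sum_(i < n) m i i n) ** gi d) (gi d).
  suff : P a by [].
  apply: (dense_total (@mxu_dense _ _ D)) a; last first.
    move=> _ [i [j [a ->]]] d d0; rewrite /P.
    (* From n > i on, the sum contains the diagonal unit of row i. *)
    have [N hN] := cvg_tends (eL a) d0; exists (maxn N i.+1) => n.
    rewrite geq_max => /andP[Nn li].
    have -> : (\sum_(k < n) m k k n) ** gi (mxu D i j a) = gi (mxu D i j (e n ** a)).
      rewrite cmul_suml (bigD1 (Ordinal li)) //= big1 ?addr0 => [|k ki].
        by rewrite /m -Defs.sfunM mxuM eqxx.
      rewrite /m -Defs.sfunM mxuM ifF ?(linear_fun0 (sfun_lin _)) //.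
      by apply/negbTE; apply: contra ki => /eqP e'; apply/eqP/val_inj.
    rewrite -(linear_funB (sfun_lin _)) -(linear_funB (@mxu_lin _ _ D i j)).
    exact: le_lt_trans (starHom_contr _ _) (le_lt_trans (mun _ _ _) (hN n Nn)).
  split.
  - rewrite /P (linear_fun0 (sfun_lin _)).
    by apply: tends_ext (tends_const _) => n; rewrite cmul0r.
  - move=> k x y Px Py; rewrite /P sfun_lin.
    apply: (@tends_ext _ _ (fun n => k *: ((\sum_(i < n) m i i n) ** gi x)
       + (\sum_(i < n) m i i n) ** gi y)) => [n|]; first by rewrite cmulDr cmulZr.
    by apply: tendsD => //; apply: tendsZ.
  - move=> x hx d d0; have [|y [Py xy]] := hx (d / 4); first lra.
    have [|N hN] := Py (d / 4); first lra.
    exists N => n /hN h; set Q := \sum_(i < n) m i i n in h *.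
    have -> : Q ** gi x - gi x = Q ** gi (x - y) + ((Q ** gi y - gi y) - gi (x - y)).
      by rewrite (linear_funB (sfun_lin _)) !cmulE; lmod R[i].
    apply: le_lt_trans (nrmD _ _) _.
    have := nrmD (Q ** gi y - gi y) (- gi (x - y)); rewrite nrmN.
    have := nrmM Q (gi (x - y)); have := starHom_contr gi (x - y).
    have := bnd n; rewrite -/Q; have := nrm_ge0 (gi (x - y)); have := nrm_ge0 Q; nra.
Qed.

End ApproximateMatrixUnits.

(** * The cyclic vector and the trivialization of a correspondence *)

Section Trivialization.
Context (R : realType).

Lemma lact_bounded (A B : cstarAlg R) (X : corr A B) (a : A) :
  bounded_fun (lact a : X -> X).
Proof. by exists (2 * nrm a) => x; exact: lact_bound. Qed.

Lemma ip_bounded (B : cstarAlg R) (X : hilbMod B) (x : X) : bounded_fun (ip x).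
Proof. by exists (4 * nrm x) => y; exact: nrm_ip_le. Qed.

Lemma cmul_bounded (B : cstarAlg R) (b : B) : bounded_fun (fun c : B => b ** c).
Proof. by exists (nrm b) => c; exact: nrmM. Qed.

Lemma ract_bounded (B : cstarAlg R) (X : hilbMod B) (x : X) : bounded_fun (ract x).
Proof. by exists (nrm x) => c; exact: nrm_ract. Qed.

Lemma lact_tends (A B : cstarAlg R) (X : corr A B) (u : nat -> A) a (x : X) :
  tends u a -> tends (fun n => lact (u n) x) (lact a x).
Proof.
apply: (@tends_map _ _ _ (fun a => lact a x) (2 * nrm x)) => b c.
rewrite -(linear_funB (lact_linear_l x)); apply: le_trans (lact_bound _ _) _.
by rewrite mulrAC.
Qed.

Lemma bounded_tends (V W : completeNormedModType R[i]) (f : V -> W) u a :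
  linear f -> bounded_fun f -> tends u a -> tends (fun n => f (u n)) (f a).
Proof.
move=> lf [c hc]; apply: (@tends_map _ _ _ f c) => x y.
by rewrite -linear_funB.
Qed.

Lemma clin_suml (V : completeNormedModType R[i]) (P : V -> Prop) n (g : 'I_n -> V) :
  clin P -> (forall i, P (g i)) -> P (\sum_(i < n) g i).
Proof.
move=> cP h; have -> : \sum_(i < n) g i = \sum_(i < n) 1 *: g i.
  by apply: eq_bigr => i _; rewrite scale1r.
exact: clin_sum.
Qed.

Lemma amu_lact (A B : cstarAlg R) (X : corr A B) m : Defs.nondegenerate X ->
  @amu R A m -> forall P : X -> Prop, clin P ->
  (forall j k x, P (lact (m j j k) x)) -> forall x, P x.
Proof.
move=> nd [_ _ _ _ [_ mQ]] P cP h x; have [a [y ->]] := nd x.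
apply: (clin_tends cP _ (lact_tends y (mQ a))) => n.
rewrite lactM; set z := lact a y.
have -> : lact (\sum_(i < n) m i i n) z = \sum_(i < n) lact (m i i n) z.
  by rewrite (linear_fun_sum (lact_linear_l z)).
exact: clin_suml.
Qed.

Lemma amu_lmul (B : cstarAlg R) m : @amu R B m -> forall P : B -> Prop, clin P ->
  (forall j k x, P (m j j k ** x)) -> forall x, P x.
Proof.
move=> [_ _ _ _ [_ mQ]] P cP h x; apply: (clin_tends cP _ (mQ x)) => n.
by rewrite cmul_suml; apply: clin_suml.
Qed.

Section Generators.
Context (A B : cstarAlg R) (X : corr A B).
Context (m : nat -> nat -> nat -> A) (p : nat -> nat -> nat -> B).
Hypotheses (Xfull : hfull X) (Xprop : Defs.proper X) (Xnd : Defs.nondegenerate X).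
Hypotheses (mA : @amu R A m) (pB : @amu R B p).

(** The n-th diagonal sum Q_n acts as a compact operator, hence is within 1/(n+1) of a finite sum of
    rank one operators. Their left vectors, over all n, generate X because Q_n z tends to z. *)
Lemma left_generators : exists xi : nat * nat -> X,
  tot (fun j : (nat * nat) * B => ract (xi j.1) j.2).
Proof.
have [_ _ _ _ [_ mQ]] := mA.
have pn (n : nat) : 0 < n.+1%:R^-1 :> R by rewrite invr_gt0.
have /choice [xi hxi] (n : nat) : exists x : nat -> X, exists N, exists y : 'I_N -> X,
   forall z, nrm (lact (\sum_(i < n) m i i n) z - \sum_(i < N) ract (x i) (ip (y i) z))
     <= n.+1%:R^-1 * nrm z.
  have [N [x [y h]]] := Xprop (\sum_(i < n) m i i n) (pn n).
  (* Padding each finite family by 0 gives the single index set nat * nat. *)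
  exists (fun k => if insub k is Some i then x i else 0), N, y => z.
  rewrite -lecR rmorphM /= -!normE.
  have -> // : \sum_(i < N) ract (if insub (val i) is Some i0 then x i0 else 0) (ip (y i) z)
     = \sum_(i < N) ract (x i) (ip (y i) z).
  by apply: eq_bigr => i _; rewrite valK.
exists (fun k => xi k.1 k.2); apply: totI => P cP hP z.
have tz : tends (fun n => lact (\sum_(i < n) m i i n) z) z.
  have [a [y ->]] := Xnd z.
  by apply: tends_ext (lact_tends y (mQ a)) => n; rewrite lactM.
have [_ _ Pc] := cP; apply: Pc => e e0.
have e2 : 0 < e / 2 by lra.
have z1 : 0 < 2 * (nrm z + 1) by have := nrm_ge0 z; lra.
have [N1 h1] := tz _ e2; have [N2 h2] := inv_small (divr_gt0 e0 z1).
set n := maxn N1 N2; have {}h1 := h1 n (leq_maxl _ _); have {}h2 := h2 n (leq_maxr _ _).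
have [N [y hy]] := hxi n; exists (\sum_(i < N) ract (xi n i) (ip (y i) z)); split.
  by apply: clin_suml => // i; exact: (hP ((n, nat_of_ord i), ip (y i) z)).
apply: le_lt_trans (nrm_trans _ (lact (\sum_(i < n) m i i n) z) _) _.
rewrite nrmB; have := hy z; move: h2 (pn n); rewrite ltr_pdivlMr //.
by move: (n.+1%:R^-1) => c; lra.
Qed.

(** By fullness Q_n is within 1/(n+1) of a finite sum of inner products; multiplied by b on the
    right, these sums approximate b. *)
Lemma right_generators : exists xi : nat * nat -> X,
  tot (fun j : (nat * nat) * X => ip (xi j.1) j.2).
Proof.
have [_ _ _ _ [_ mQ]] := pB.
have pn (n : nat) : 0 < n.+1%:R^-1 :> R by rewrite invr_gt0.
have /choice [xi hxi] (n : nat) : exists x : nat -> X, exists N, exists y : 'I_N -> X,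
   nrm (\sum_(i < n) p i i n - \sum_(i < N) ip (x i) (y i)) < n.+1%:R^-1.
  have [s [[N [c [g [hg es]]]] hs]] := dense_near Xfull (\sum_(i < n) p i i n) (pn n).
  have /choice [x hx] (i : 'I_N) : exists w : X * X, g i = ip w.1 w.2.
    by have [w [w' ->]] := hg i; exists (w, w').
  exists (fun k => if insub k is Some i then (x i).1 else 0), N, (fun i => c i *: (x i).2).
  rewrite (_ : \sum_(i < N) _ = s) // es; apply: eq_bigr => i _.
  by rewrite valK ipZr hx.
exists (fun k => xi k.1 k.2); apply: totI => P cP hP b.
have [_ _ Pc] := cP; apply: Pc => e e0.
have e2 : 0 < e / 2 by lra.
have z1 : 0 < 2 * (nrm b + 1) by have := nrm_ge0 b; lra.
have [N1 h1] := mQ b _ e2; have [N2 h2] := inv_small (divr_gt0 e0 z1).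
set n := maxn N1 N2; have {}h1 := h1 n (leq_maxl _ _); have {}h2 := h2 n (leq_maxr _ _).
have [N [y hy]] := hxi n; exists ((\sum_(i < N) ip (xi n i) (y i)) ** b); split.
  rewrite cmul_suml; apply: clin_suml => // i; rewrite -ip_ract.
  exact: (hP ((n, nat_of_ord i), ract (y i) b)).
apply: le_lt_trans (nrm_trans _ ((\sum_(i < n) p i i n) ** b) _) _.
rewrite nrmB; move: hy; set s := \sum_(i < N) _; set q := \sum_(i < n) _ in h1 * => hy.
have -> : q ** b - s ** b = (q - s) ** b by rewrite !cmulE.
have := nrmM (q - s) b; move: h2 (pn n) hy; rewrite ltr_pdivlMr //.
move: (n.+1%:R^-1) => c h2 c0 /ltW /(ler_wpM2r (nrm_ge0 b)); lra.
Qed.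

Lemma generators : exists xi : bool * (nat * nat) -> X,
  [/\ forall k, nrm (xi k) <= 1,
      tot (fun j : (bool * (nat * nat)) * B => ract (xi j.1) j.2) &
      tot (fun j : (bool * (nat * nat)) * X => ip (xi j.1) j.2)].
Proof.
have [x hx] := left_generators; have [y hy] := right_generators.
(* Dividing by 1 + |z| bounds the norm by 1 and leaves z = 0 harmless. *)
pose nz (z : X) := (1 + nrm z)^-1%:C *: z.
have nz0 (z : X) : 0 < 1 + nrm z by have := nrm_ge0 z; lra.
have nzK z : z = (1 + nrm z)%:C *: nz z.
  by rewrite /nz scalerA -rmorphM /= divff ?(gt_eqF (nz0 z)) ?rmorph1 ?scale1r.
exists (fun k => nz (if k.1 then x k.2 else y k.2)); split.
- move=> k; move: (if _ then _ else _) => z; rewrite /nz nrmZr ?invr_ge0 ?(ltW (nz0 z)) //.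
  by rewrite ler_pdivrMl // mulr1; lra.
- apply: totI => P cP hP; apply: (totP hx) => // -[k b] /=.
  rewrite (nzK (x k)) (linear_funZ (ract_linear_l b)).
  by apply: clinZ => //; exact: (hP ((true, k), b)).
- apply: totI => P cP hP; apply: (totP hy) => // -[k b] /=.
  rewrite (nzK (y k)) ipZl.
  by apply: clinZ => //; exact: (hP ((false, k), b)).
Qed.

Local Notation idx := ((bool * (nat * nat)) * (nat * nat * nat * nat))%type.

(* In matrix form over the two systems of matrix units, x has, for each
   enumerated index n, one entry in row j < n and column n, and one in row n
   and column j. *)
Lemma cyclic_vector : exists x : X,
  tot (fun b => ract x b) /\ tot (fun y => ip x y).
Proof.
have [m1 m2 m3 m4 [m5 m6]] := mA; have [p1 p2 p3 p4 [p5 p6]] := pB.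
have [xi [xi1 xiL xiR]] := generators.
have [en hen] := enum_often idx.
(* Because j < n is strict, column N meets only [z N] and some [z' n] with n > N, and row N only
   [z' N] and some [z n] with n > N. Thus the N-th term is the leading one after either cut. *)
pose z n : X := if en n is Some (g, (j, k, i, k')) then
  if (j < n)%N then lact (m j j k) (ract (xi g) (p i n k')) else 0 else 0.
pose z' n : X := if en n is Some (g, (j, k, i, k')) then
  if (j < n)%N then lact (m n i k) (ract (xi g) (p j j k')) else 0 else 0.
have bnd a b g : nrm a <= 1 -> nrm b <= 1 -> nrm (lact a (ract (xi g) b)) <= 2.
  move=> a1 b1; apply: le_trans (lact_bound _ _) _.
  have := nrm_ract (xi g) b; have := xi1 g; have := nrm_ge0 (xi g).
  have := nrm_ge0 (ract (xi g) b); have := nrm_ge0 a; have := nrm_ge0 b.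
  move=> q1 q2 q3 q4 q5 q6; have q7 : nrm (ract (xi g) b) <= 1 by nra.
  nra.
have z2 n : nrm (z n) <= 2.
  rewrite /z; case: (en n) => [[g [[[j k] i] k']]|]; last by rewrite nrm0.
  by case: ifP => _; rewrite ?nrm0 // bnd.
have z2' n : nrm (z' n) <= 2.
  rewrite /z'; case: (en n) => [[g [[[j k] i] k']]|]; last by rewrite nrm0.
  by case: ifP => _; rewrite ?nrm0 // bnd.
have zz n : nrm (z n + z' n) <= 4.
  by have := nrmD (z n) (z' n); have := z2 n; have := z2' n; lra.
have [|x [hx _]] := lam_series (C := 4) _ zz; first by [].
have zv n N i l : n != N -> forall d, ract (z n) (p N i l ** d) = 0.
  move=> nN d; rewrite /z; case: (en n) => [[g [[[j k] i'] k']]|]; last first.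
    by rewrite (linear_fun0 (ract_linear_l _)).
  case: ifP => _; last by rewrite (linear_fun0 (ract_linear_l _)).
  by rewrite -lact_ract ractA cmulA p1 // cmul0l (linear_fun0 (ract_linear_r _)) lact0r.
have zv' n N i l : (n <= N)%N -> forall d, ract (z' n) (p N i l ** d) = 0.
  move=> nN d; rewrite /z'; case: (en n) => [[g [[[j k] i'] k']]|]; last first.
    by rewrite (linear_fun0 (ract_linear_l _)).
  case: ifP => jn; last by rewrite (linear_fun0 (ract_linear_l _)).
  rewrite -lact_ract ractA cmulA p1 ?cmul0l ?(linear_fun0 (ract_linear_r _)) ?lact0r //.
  by rewrite ltn_eqF // (leq_trans jn).
have ze n N i l : (n <= N)%N -> forall e, ip (z n) (lact (m N i l) e) = 0.
  move=> nN d; rewrite /z; case: (en n) => [[g [[[j k] i'] k']]|]; last first.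
    by rewrite ip0l.
  case: ifP => jn; last by rewrite ip0l.
  by rewrite lactS m2 -lactM m1 ?lact0l ?ip0r // ltn_eqF // (leq_trans jn).
have ze' n N i l : n != N -> forall e, ip (z' n) (lact (m N i l) e) = 0.
  move=> nN d; rewrite /z'; case: (en n) => [[g [[[j k] i'] k']]|]; last first.
    by rewrite ip0l.
  case: ifP => jn; last by rewrite ip0l.
  by rewrite lactS m2 -lactM m1 ?lact0l ?ip0r.
have dom (W : completeNormedModType R[i]) (f : X -> W) (c : R) N : linear f ->
    0 <= c -> (forall y, nrm (f y) <= c * nrm y) ->
    (forall n, (n < N)%N -> f (z n + z' n) = 0) ->
    nrm (f (z N + z' N) - (lam R N)^-1%:C *: f x) <= 8 * c / N.+1%:R.
  move=> lf c0 hc f0; apply: (@le_trans _ _ (2 * (c * 4) / N.+2%:R)).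
    apply: (@lam_dominant R W (fun n => f (z n + z' n))) => //.
    + exact: mulr_ge0.
    + by move=> n; apply: le_trans (hc _) _; rewrite ler_wpM2l.
    apply: (@tends_ext _ _ (fun n => f (\sum_(k < n) (lam R k)%:C *: (z k + z' k)))).
      move=> n; rewrite linear_fun_sum //; apply: eq_bigr => k _.
      by rewrite linear_funZ.
    by apply: bounded_tends => //; exists c.
  rewrite (_ : 2 * (c * 4) = 8 * c); last lra.
  by apply: ler_wpM2l; rewrite ?mulr_ge0 // lef_pV2 ?posrE ?ltr0n // ler_nat.
have big (C e : R) (t : idx) : 0 <= C -> 0 < e -> exists N, [/\ en N = Some t,
    (t.2.1.1.1 < N)%N & 8 * C / N.+1%:R < e].
  move=> C0 e0; have d0 : 0 < 8 * C + 1 by lra.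
  have [N0 hN0] := inv_small (divr_gt0 e0 d0).
  have [N [NN0 eN]] := hen t (maxn N0 t.2.1.1.1.+1); exists N.
  move: NN0; rewrite geq_max => /andP[/hN0 h jN]; split=> //.
  move: h; rewrite ltr_pdivlMr //; have : 0 < N.+1%:R^-1 :> R by rewrite invr_gt0.
  by move: (N.+1%:R^-1) => c; lra.
exists x; split.
- apply: totI => P cP hP.
  (* The two approximate units reduce density to vectors cut on both sides by diagonal matrix
     units. *)
  suff key g j k i k' d : P (lact (m j j k) (ract (xi g) (p i i k' ** d))).
    apply: (amu_lact Xnd mA) => // j k.
    apply: (@totP _ _ _ _ xiL (fun x => P (lact (m j j k) x))) => [|[g b] /=].
      exact: (@clin_preim _ _ _ (lact (m j j k)) P (lact_linear_r _) (lact_bounded _ _) cP).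
    apply: (amu_lmul pB (P := fun b => P (lact (m j j k) (ract (xi g) b)))) => //.
    apply: (@clin_preim _ _ _ (ract (xi g)) (fun x => P (lact (m j j k) x))
      (ract_linear_r (xi g)) (ract_bounded (xi g))).
    exact: (@clin_preim _ _ _ (lact (m j j k)) P (lact_linear_r _) (lact_bounded _ _) cP).
  have [_ _ Pc] := cP; apply: Pc => e e0; have e2 : 0 < e / 2 by lra.
  (* N is chosen before l: the bound depends on |d| only, so it holds for the later L, which depends
     on N. *)
  have [N [eN jN hN]] := big _ _ (g, (j, k, i, k')) (nrm_ge0 d) e2.
  have ht : tends (fun l => lact (m j j k) (ract (xi g) (p i N k' ** p N i l ** d)))
              (lact (m j j k) (ract (xi g) (p i i k' ** d))).
    apply: (bounded_tends (lact_linear_r _) (lact_bounded _ _)).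
    apply: (bounded_tends (ract_linear_r _) (ract_bounded _)).
    exact: tendsMr (p4 _ _ _).
  have [L /(_ L (leqnn L)) hL] := ht _ e2.
  have zN : z N = lact (m j j k) (ract (xi g) (p i N k')) by rewrite /z eN jN.
  have hc (y : X) : nrm (ract y (p N i L ** d)) <= nrm d * nrm y.
    apply: le_trans (nrm_ract _ _) _; rewrite mulrC ler_wpM2r ?nrm_ge0 //.
    apply: le_trans (nrmM _ _) _; rewrite ler_piMl ?nrm_ge0 //; exact: p3.
  have h0 n : (n < N)%N -> ract (z n + z' n) (p N i L ** d) = 0.
    move=> nN; rewrite (linear_funD (ract_linear_l _)) zv ?ltn_eqF //.
    by rewrite zv' ?addr0 // ltnW.
  have := dom _ (fun y => ract y (p N i L ** d)) (nrm d) N (ract_linear_l _)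
    (nrm_ge0 d) hc h0.
  move: hL; rewrite (linear_funD (ract_linear_l _)) zv' // addr0 zN.
  rewrite -lact_ract ractA cmulA => h1 h2.
  exists (ract x ((lam R N)^-1%:C *: (p N i L ** d))); split; first exact: hP.
  apply: le_lt_trans (nrm_trans _ (lact (m j j k) (ract (xi g) (p i N k' ** p N i L ** d))) _) _.
  rewrite nrmB (linear_funZ (ract_linear_r x)).
  by have := le_lt_trans h2 hN; lra.
- apply: totI => P cP hP.
  suff key g j k i k' e : P (p j j k' ** ip (xi g) (lact (m i i k) e)).
    apply: (amu_lmul pB) => // j k'.
    apply: (@totP _ _ _ _ xiR (fun b => P (p j j k' ** b))) => [|[g e] /=].
      exact: (@clin_preim _ _ _ (fun b => p j j k' ** b) P (cmul_linear_r _)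
        (cmul_bounded _) cP).
    apply: (amu_lact Xnd mA (P := fun e => P (p j j k' ** ip (xi g) e))) => //.
    apply: (@clin_preim _ _ _ (ip (xi g)) (fun b => P (p j j k' ** b))
      (ip_linear_r (xi g)) (ip_bounded (xi g))).
    exact: (@clin_preim _ _ _ (fun b => p j j k' ** b) P (cmul_linear_r _)
      (cmul_bounded _) cP).
  have [_ _ Pc] := cP; apply: Pc => d d0; have d2 : 0 < d / 2 by lra.
  (* 4 comes from [nrm_ip_le], 2 from [lact_bound] for the vector v below. *)
  have C0 : 0 <= 4 * (2 * nrm e) by rewrite !mulr_ge0 ?nrm_ge0.
  have [N [eN jN hN]] := big _ _ (g, (j, k, i, k')) C0 d2.
  have ht : tends (fun l => p j j k' ** ip (xi g) (lact (m i N k ** m N i l) e))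
              (p j j k' ** ip (xi g) (lact (m i i k) e)).
    apply: tendsMl; apply: (bounded_tends (ip_linear_r _) (ip_bounded _)).
    exact: lact_tends (m4 _ _ _).
  have [L /(_ L (leqnn L)) hL] := ht _ d2.
  have zN : z' N = lact (m N i k) (ract (xi g) (p j j k')) by rewrite /z' eN jN.
  set v := lact (m N i L) e.
  have hc (y : X) : nrm (ip v y) <= 4 * (2 * nrm e) * nrm y.
    apply: le_trans (nrm_ip_le _ _) _; rewrite ler_wpM2r ?nrm_ge0 //.
    rewrite ler_wpM2l //; apply: le_trans (lact_bound _ _) _.
    have := m3 N i L; have := nrm_ge0 e; nra.
  have h0 n : (n < N)%N -> ip v (z n + z' n) = 0.
    move=> nN; rewrite ipDr -(ip_star (z n)) -(ip_star (z' n)) /v.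
    rewrite (ze n N i L (ltnW nN)) (ze' n N) ?ltn_eqF //.
    by rewrite star0 addr0.
  have := dom _ (ip v) _ N (ip_linear_r v) C0 hc h0.
  rewrite ipDr -(ip_star (z N)) {1}/v (ze N N i L (leqnn N)) star0 add0r zN.
  rewrite -nrm_star starB starZ conj_real !ip_star.
  have -> : ip (lact (m N i k) (ract (xi g) (p j j k'))) v =
      p j j k' ** ip (xi g) (lact (m i N k ** m N i L) e).
    by rewrite lactS m2 -lactM ip_ractl p2.
  move=> h2; exists (ip x ((lam R N)^-1%:C *: v)); split; first exact: hP.
  apply: le_lt_trans (nrm_trans _ (p j j k' ** ip (xi g) (lact (m i N k ** m N i L) e)) _) _.
  by rewrite nrmB ipZr; have := le_lt_trans h2 hN; lra.
Qed.

Theorem trivialization : exists U : self_mod B -> X, umap U.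
Proof.
have [x [tx tix]] := cyclic_vector.
have [b hb] := ip_pos x; have [s ss hs] := star_mul_sq b; rewrite hs in hb.
have [|||U [hU _]] := @umap_extension _ B (self_mod B) X B (fun d => s ** d) (ract x).
(* The range of s contains s (s d) = <x, x d>; as x D is dense in X and <x, X> is dense in B, so is
   s B. *)
- apply: totI => P cP hP; apply: (totP tix) => // y.
  apply: (@totP _ _ _ _ tx (fun y => P (ip x y))) => [|d].
    exact: (@clin_preim _ _ _ (ip x) P (ip_linear_r _) (ip_bounded _) cP).
  by rewrite ip_ract hb -cmulA; exact: hP.
- exact: tx.
- by move=> d d'; rewrite ip_ractl ip_ract hb /ip /= starM ss !cmulA.
by exists U.
Qed.

End Generators.
End Trivialization.

(** * From the homotopy to a path of homomorphisms *)

Section CompactOperators.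
Context (R : realType).

(** A rank one operator on B_B is left multiplication by some x y^*. By [lmul_bound] approximation
    of operators is approximation in B, and B is complete. *)
Lemma compact_lmul (B : cstarAlg R) (T : self_mod B -> self_mod B) :
  compact_op T -> exists b : B, forall z, T z = b ** z.
Proof.
move=> cT; have pn (n : nat) : 0 < n.+1%:R^-1 :> R by rewrite invr_gt0.
have /choice [b hb] (n : nat) : exists b : B, forall z : B,
    nrm ((T z : B) - b ** z) <= n.+1%:R^-1 * nrm z.
  have [N [x [y h]]] := cT _ (pn n).
  exists (\sum_(i < N) (x i : B) ** star (y i : B)) => z.
  rewrite -lecR rmorphM /= -!normE; have := h z.
  suff -> : \sum_(i < N) ract (x i) (ip (y i) z) =
    (\sum_(i < N) (x i : B) ** star (y i : B)) ** z by [].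
  by rewrite cmul_suml; apply: eq_bigr => i _; rewrite /= cmulA.
have bnd (m n : nat) : nrm (b m - b n) <= m.+1%:R^-1 + n.+1%:R^-1.
  apply: lmul_bound; first by rewrite addr_ge0 // ltW.
  move=> z; have -> : (b m - b n) ** z = ((T z : B) - b n ** z) - ((T z : B) - b m ** z).
    by rewrite cmulDl cmulNl; lmod R[i].
  apply: le_trans (nrmD _ _) _; rewrite nrmN mulrDl addrC.
  by apply: lerD; exact: hb.
have [e e0|l hl] := @complete_seq _ _ b.
  have e2 : 0 < e / 2 by lra.
  have [N hN] := inv_small e2; exists N => m n /hN h1 /hN h2.
  apply: le_lt_trans (bnd m n) _; move: h1 h2.
  by move: (m.+1%:R^-1) (n.+1%:R^-1) => x y; lra.
exists l => z; apply: (@tends_uniq _ _ (fun n => b n ** z)); last exact: tendsMr.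
move=> e e0; have z1 : 0 < nrm z + 1 by have := nrm_ge0 z; lra.
have [N hN] := inv_small (divr_gt0 e0 z1); exists N => n /hN.
rewrite ltr_pdivlMr // nrmB => h; apply: le_lt_trans (hb n z) _.
by have := pn n; move: h; move: (n.+1%:R^-1) => c; lra.
Qed.

(** Replacing b by b e_N turns the multiplication into one rank one operator, at the cost |b - b
    e_N|. *)
Lemma lmul_compact (B : cstarAlg R) (b : B) : sigma_unital B ->
  compact_op (fun z : self_mod B => b ** z : self_mod B).
Proof.
move=> [e [_ _ _ _ /(_ b) /cvg_tends h]] d d0; have [N hN] := h d d0.
exists 1%N, (fun=> b), (fun=> star (e N)) => z; rewrite big_ord1 /= starK.
rewrite normE (normE z) -rmorphM lecR.
have -> : (b ** z - b ** (e N ** z) : B) = (b - b ** e N) ** z.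
  by rewrite cmulDl cmulNl cmulA.
apply: le_trans (nrmM _ _) _; rewrite ler_wpM2r ?nrm_ge0 // nrmB ltW //.
exact: hN.
Qed.

Lemma compact_umap (B : cstarAlg R) (X Y : hilbMod B) (U : X -> Y) (S : X -> X)
    (T : Y -> Y) : umap U -> (forall x, T (U x) = U (S x)) ->
  compact_op T -> compact_op S.
Proof.
move=> hU TS cT e e0; have [V [hV UK VK UV]] := umap_adj hU.
have [N [x [y h]]] := cT e e0; exists N, (fun i => V (x i)), (fun i => V (y i)) => z.
have := h (U z); rewrite TS !normE -!rmorphM !lecR (umap_nrm _ hU).
suff -> : U (S z) - \sum_(i < N) ract (x i) (ip (y i) (U z)) =
   U (S z - \sum_(i < N) ract (V (x i)) (ip (V (y i)) z)) by rewrite umap_nrm.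
have [lU iU _] := hU; rewrite (linear_funB lU) (linear_fun_sum lU).
congr (_ + - _); apply: eq_bigr => i _; by rewrite umap_ract // VK -(iU (V _)) VK.
Qed.

(** Properness makes the left action, transported by U, compact on D_D, hence left multiplication by
    elements of D. *)
Lemma compact_lact_hom (A D : cstarAlg R) (E : corr A D) (U : self_mod D -> E) :
  umap U -> Defs.proper E ->
  exists h : starHom A D, forall a d, U (h a ** d) = lact a (U d).
Proof.
move=> hU pE; have [V [hV UK VK UV]] := umap_adj hU.
have /choice [h hh] (a : A) : exists b : D, forall d, U (b ** d) = lact a (U d).
  have : compact_op (fun d => V (lact a (U d))).
    apply: (compact_umap hU _ (pE a)) => d; by rewrite VK.
  by move=> /compact_lmul [b hb]; exists b => d; rewrite -hb VK.
have Ui := umap_inj hU; have [lU iU _] := hU.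
have l : linear h.
  move=> k a b; apply: lmul_inj => d; apply: Ui.
  by rewrite hh lact_lin -!hh cmul_linl lU.
have m : forall a b, h (a ** b) = h a ** h b.
  by move=> a b; apply: lmul_inj => d; apply: Ui; rewrite hh lactM -!hh cmulA.
have s : forall a, h (star a) = star (h a).
  move=> a; apply: lmul_inj => d; apply: (@ip_ext _ D (self_mod D)) => z.
  rewrite -iU hh -[a in RHS]starK.
  have -> : ip (U z) (lact (star a) (U d)) = ip (lact a (U z)) (U d) by rewrite lactS.
  by rewrite -hh iU starK /ip /= starM cmulA.
by exists (StarHom l m s).
Qed.

End CompactOperators.

Section Tensors.
Context (R : realType).

Lemma unitary_iso_umap (A B : cstarAlg R) (X Y : corr A B) (U : X -> Y) :
  unitary_iso U -> umap U.
Proof. by move=> [lU _ _ iU sU]; split. Qed.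

Lemma tens_tot (A B C : cstarAlg R) (X : corr A B) (Y : corr B C) (T : tensor X Y)
    (J : Type) (U : J -> X) : (forall x, exists j, U j = x) ->
  tot (fun j : J * Y => tens T (U j.1) j.2).
Proof.
move=> sU; apply: totI => P cP hP w; apply: (dense_total (@tens_dense _ _ _ _ _ _ T)) => //.
by move=> _ [x [y ->]]; have [j <-] := sU x; exact: (hP (j, y)).
Qed.

(** The defect pairs to 0 with every elementary tensor by [tens_ip], and these are total. *)
Lemma tens_linear_l (A B C : cstarAlg R) (X : corr A B) (Y : corr B C) (T : tensor X Y) y :
  linear (fun x => tens T x y).
Proof.
move=> k x x'; apply/eqP; rewrite -subr_eq0; apply/eqP/ip_eq0.
have hid (x0 : X) : exists j, id j = x0 by exists x0.
set w := _ - _.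
apply: (@totP _ _ _ _ (tens_tot (T := T) (U := id) hid) (fun z => ip z w = 0))
  => [|[x0 y0] /=].
  split.
  - by rewrite ip0l.
  - by move=> k' z z' h h'; rewrite ipDl ipZl h h' scaler0 addr0.
  - move=> z hz; apply: nrm_small => e e0.
    have w0 : 0 < 4 * nrm w + 1 by have := nrm_ge0 w; lra.
    have [z' [h zz']] := hz _ (divr_gt0 e0 w0).
    have -> : ip z w = ip (z - z') w by rewrite ipDl ipNl h subr0.
    apply: le_lt_trans (nrm_ip_le _ _) _; rewrite ltr_pdivlMr // in zz'.
    by have := nrm_ge0 (z - z'); have := nrm_ge0 w; lra.
rewrite /w !ipE !tens_ip !ipE !lactE !ipE; lmod R[i].
Qed.

Lemma tens_bounded_l (A B C : cstarAlg R) (X : corr A B) (Y : corr B C) (T : tensor X Y) y :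
  bounded_fun (fun x => tens T x y).
Proof.
exists (4 * nrm y) => x; rewrite -(@ler_pXn2r _ 2) ?nnegrE ?mulr_ge0 ?nrm_ge0 //.
rewrite -nrm_ip tens_ip; apply: le_trans (nrm_ip_le _ _) _.
have := lact_bound (X := Y) (ip x x) y; rewrite nrm_ip => h.
have := ler_wpM2l (nrm_ge0 y) h; have := nrm_ge0 y; have := nrm_ge0 x.
have : 0 <= (nrm x * nrm y) ^+ 2 by rewrite sqr_ge0.
by lra.
Qed.

End Tensors.

Section PathMaps.
Context (R : realType) (B : cstarAlg R) (D : path_alg B).
Local Notation ev := (pa_ev D).

Lemma evB t x y : ev t (x - y) = ev t x - ev t y.
Proof. exact: (linear_funB (sfun_lin _)). Qed.

Lemma ev_inj (x y : D) : (forall t : R, t \in `[0, 1] -> ev t x = ev t y) -> x = y.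
Proof. exact: pa_inj. Qed.

Lemma path_umap (W : self_mod B -> self_mod B) : umap W ->
  exists DW : self_mod D -> self_mod D,
    umap DW /\ forall (t : R) (d : D), t \in `[0, 1] -> ev t (DW d) = W (ev t d).
Proof.
move=> hW; have [lW iW sW] := hW.
have mk (V : self_mod B -> self_mod B) : umap V -> exists DV : D -> D,
    forall d (t : R), t \in `[0, 1] -> ev t (DV d) = V (ev t d).
  move=> hV; have /choice [DV hDV] (d : D) : exists dv : D, forall t : R, t \in `[0, 1] ->
      ev t dv = V (ev t d); last by exists DV.
  apply: path_mk; apply: (@pcont_map _ B B V 1); last exact: path_pcont.
  move=> x y; have [lV _ _] := hV; rewrite mul1r -[(V x : B) - V y](linear_funB lV).
  by rewrite (@umap_nrm _ _ _ _ V (x - y) hV).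
have [DW hDW] := mk _ hW; have [V [hV WV VW _]] := umap_adj hW; have [DV hDV] := mk _ hV.
exists DW; split=> [|t d tI]; last exact: hDW.
split=> [k x y|x y|y]; last first.
- by exists (DV y); apply: ev_inj => t tI; rewrite hDW // hDV // VW.
- apply: ev_inj => t tI; rewrite /ip /= !Defs.sfunM !sfunS !hDW //.
  exact: (iW (ev t x) (ev t y)).
- by apply: ev_inj => t tI; rewrite hDW // sfun_lin lW sfun_lin !hDW.
Qed.

End PathMaps.

Section Fibres.
Context (R : realType) (A B : cstarAlg R) (D : path_alg B) (E : corr A D).
Context (p : nat -> nat -> nat -> B) (U : self_mod D -> E) (h : starHom A D).
Hypotheses (pB : amu p) (hU : umap U).
Hypothesis Uh : forall a d, U (h a ** d) = lact a (U d).
Local Notation ev := (pa_ev D).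

Lemma umap_ipE (d d' : D) : ip (U d) (U d') = star d ** d'.
Proof. by have [_ -> _] := hU. Qed.

Lemma umap_total : forall x, exists d, U d = x.
Proof. by have [_ _ s] := hU. Qed.

(** The trivialization at t: U d (x) b |-> d(t) b identifies the fibre with B, and a acts as
    multiplication by h_t(a). *)
Lemma fibre_umap (t : R) (T : tensor E (hom_corr (ev t))) (K : corr A B) (Psi : T -> K) :
  t \in `[0, 1] -> unitary_iso Psi -> exists W : self_mod B -> K,
    [/\ umap W, forall (d : D) (b : B), W (ev t d ** b) = Psi (tens T (U d) b) &
        forall a x, W (ev t (h a) ** x) = lact a (W x)].
Proof.
move=> tI hPsi; have hP := unitary_iso_umap hPsi; have [_ lP _ iP _] := hPsi.
have [c hc] := path_cst D.
have [||[d b] [d' b']|W [hW hWF]] := @umap_extension _ B (self_mod B) K (D * B)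
   (fun j => ev t j.1 ** j.2) (fun j => Psi (tens T (U j.1) j.2)).
- apply: totI => P cP hP'; apply: (amu_lmul pB) => // j k x.
  by have := hP' (c (p j j k), x); rewrite /= hc.
- exact: (umap_tot hP (tens_tot (T := T) umap_total)).
- rewrite iP tens_ip umap_ipE /= /ip /= starM Defs.sfunM sfunS !cmulA //.
have tW : tot (fun j : D * B => ev t j.1 ** j.2 : self_mod B).
  apply: totI => P cP hP'; apply: (amu_lmul pB) => // j k x.
  by have := hP' (c (p j j k), x); rewrite /= hc.
have WF d b : W (ev t d ** b) = Psi (tens T (U d) b) := hWF (d, b).
exists W; split=> // a x.
have [lW _ _] := hW.
apply: (@tot_eq _ _ _ _ _ (fun x => W (ev t (h a) ** x)) (fun x => lact a (W x)) tW).
- by move=> l y z; rewrite cmul_linr lW.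
- by move=> l y z; rewrite lW (lact_linear_r a).
- exists (nrm (ev t (h a))) => y; rewrite (umap_nrm _ hW); exact: nrmM.
- by exists (2 * nrm a) => y; rewrite -[nrm y](umap_nrm _ hW); exact: lact_bound.
- by move=> [d b] /=; rewrite cmulA -Defs.sfunM !WF Uh -lP tens_lact.
Qed.

End Fibres.

Section PathOfHoms.
Context (R : realType) (A B : cstarAlg R) (alpha : starHom A A) (beta : starHom B B).
Context (D : path_alg B) (IX : path_corr D (hom_corr beta)) (E : corr A D).
Context (PH : one_arrow (hom_corr alpha) IX E).
Context (p : nat -> nat -> nat -> B) (U : self_mod D -> E) (h : starHom A D).
Hypotheses (beta_aut : bijective beta) (pB : amu p) (hU : umap U).
Hypothesis Uh : forall a d, U (h a ** d) = lact a (U d).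
Local Notation ev := (pa_ev D).
Local Notation xev t x := (@pc_ev _ _ _ _ IX t x : B).

(* The identification of H (x) C([0,1], _beta B) with C([0,1],B). *)
Lemma right_identification : exists Psi2 : oa_FX PH -> self_mod D,
  umap Psi2 /\ forall (d : D) (x : IX) (t : R), t \in `[0, 1] ->
    ev t (Psi2 (tens (oa_FX PH) (U d) x)) = beta (ev t d) ** xev t x.
Proof.
have [bi [bK biK]] := starHom_inv beta_aut.
have [c hc] := path_cst D; have [_ _ _ _ [p5 p6]] := pB.
have xc (x : IX) : pcont (fun t => xev t x).
  by apply/within_pcont; exact: (@pc_cont _ _ _ _ IX).
have /choice [mk hmk] (j : D * IX) : exists f : D, forall t : R, t \in `[0, 1] ->
    ev t f = beta (ev t j.1) ** xev t j.2.
  apply: path_mk; apply: pcontM; last exact: xc.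
  apply: (@pcont_map _ B B beta 1); last exact: path_pcont.
  by move=> x y; rewrite mul1r -(linear_funB (sfun_lin beta)); exact: starHom_contr.
have [||[d x] [d' x']|Psi2 [hP PE]] := @umap_extension _ D (oa_FX PH) (self_mod D) (D * IX)
   (fun j => tens (oa_FX PH) (U j.1) j.2) mk.
- exact: (tens_tot (T := oa_FX PH) (umap_total hU)).
- apply: totI => P cP hP f.
  (* Since beta is onto, Q_n f has the form beta(d) x, with d the constant path beta^-1(Q_n) and x
     the path f itself. *)
  have [x hx] : exists x : IX, forall t : R, t \in `[0, 1] -> xev t x = ev t f.
    by apply: (@pc_surj _ _ _ _ IX); apply/within_pcont; exact: path_pcont.
  apply: (clin_tends cP _ (path_uniform hc p5 p6 f)) => n.
  suff -> : c (\sum_(i < n) p i i n) ** f = mk (c (bi (\sum_(i < n) p i i n)), x) by [].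
  by apply: ev_inj => t tI; rewrite hmk // Defs.sfunM !hc // biK hx.
- rewrite tens_ip (umap_ipE hU) /=; apply: ev_inj => t tI.
  rewrite (@pc_ip _ _ _ _ IX) // (@pc_lact _ _ _ _ IX) //.
  have -> : ev t (star (mk (d, x)) ** mk (d', x')) =
      star (beta (ev t d) ** xev t x) ** (beta (ev t d') ** xev t x').
    by rewrite Defs.sfunM sfunS !hmk.
  change (star (xev t x) ** (beta (ev t (star d ** d')) ** xev t x') =
      star (beta (ev t d) ** xev t x) ** (beta (ev t d') ** xev t x')).
  by rewrite !Defs.sfunM !sfunS starM !cmulA.
exists Psi2; split=> // d x t tI; have -> := PE (d, x).
by rewrite hmk.
Qed.

Context (Psi2 : oa_FX PH -> self_mod D).
Hypothesis hPsi2 : umap Psi2.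
Hypothesis Psi2E : forall (d : D) (x : IX) (t : R), t \in `[0, 1] ->
  ev t (Psi2 (tens (oa_FX PH) (U d) x)) = beta (ev t d) ** xev t x.
Hypothesis E_nd : Defs.nondegenerate E.

(** V is Psi2 Phi_H Psi1^-1 for Psi1 : a (x) U d |-> h(a) d. Left linearity of Phi_H gives the
    intertwining relation: b acts as h(alpha(b)) on the source and as beta(h(b)) on the target. *)
Lemma path_unitary : exists V : self_mod D -> self_mod D,
  [/\ umap V,
      forall a d, V (h a ** d) = Psi2 (oa_Phi (tens (oa_YF PH) a (U d))) &
      forall a d (t : R), t \in `[0, 1] ->
        ev t (V (h (alpha a) ** d)) = beta (ev t (h a)) ** ev t (V d)].
Proof.
have hPhi := oa_unitary PH; have [_ lPhi _ _ _] := hPhi.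
have hdec d : exists a d', d = h a ** d'.
  have [a [y e]] := E_nd (U d); have [d' ed] := umap_total hU y.
  by exists a, d'; apply: (umap_inj hU); rewrite Uh ed.
have [||[a d] [a' d']|V [hV VE]] := @umap_extension _ D (self_mod D) (self_mod D) (A * D)
   (fun j => h j.1 ** j.2) (fun j => Psi2 (oa_Phi (tens (oa_YF PH) j.1 (U j.2)))).
- by apply: totI => P cP hP d; have [a [d' ->]] := hdec d; exact: (hP (a, d')).
- apply: (umap_tot hPsi2); apply: (umap_tot (unitary_iso_umap hPhi)).
  apply: totI => P cP hP.
  apply: (totP (tens_tot (T := oa_YF PH) (U := id) _)) => // [a|[a y] /=].
    by exists a.
  by have [d <-] := umap_total hU y; exact: (hP (a, d)).
- have [_ -> _] := hPsi2; have [_ _ _ -> _] := hPhi; rewrite tens_ip -Uh (umap_ipE hU).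
  by rewrite /ip /= Defs.sfunM sfunS starM !cmulA.
have VF a d : V (h a ** d) = Psi2 (oa_Phi (tens (oa_YF PH) a (U d))) := VE (a, d).
exists V; split=> // b d t tI.
have P2 (w : oa_FX PH) : ev t (Psi2 (lact b w)) = beta (ev t (h b)) ** ev t (Psi2 w).
  have [l2 _ _] := hPsi2; move: w.
  apply: (@tot_eq _ _ _ _ _ (fun w => ev t (Psi2 (lact b w)))
     (fun w => beta (ev t (h b)) ** ev t (Psi2 w)) (tens_tot (T := oa_FX PH) (umap_total hU))).
  - by move=> k x y; rewrite (lact_linear_r b) l2 sfun_lin.
  - by move=> k x y; rewrite l2 sfun_lin cmul_linr.
  - exists (2 * nrm b) => w; apply: le_trans (starHom_contr _ _) _.
    by rewrite (umap_nrm _ hPsi2); exact: lact_bound.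
  - exists (nrm (beta (ev t (h b)))) => w; apply: le_trans (nrmM _ _) _.
    rewrite ler_wpM2l ?nrm_ge0 //; apply: le_trans (starHom_contr _ _) _.
    by rewrite (umap_nrm _ hPsi2).
  - by move=> [d' x] /=; rewrite tens_lact -Uh !Psi2E // !Defs.sfunM cmulA.
have [a [d' ->]] := hdec d.
rewrite cmulA -Defs.sfunM !VF -P2; congr (ev t (Psi2 _)).
by rewrite -lPhi tens_lact.
Qed.

(** V preserves the D-valued inner product, so (V d)(t) depends on d(t) only; hence V acts fibrewise
    and u_t is read off on constant paths. *)
Lemma fibre_unitaries (V : self_mod D -> self_mod D) : umap V ->
  (forall a d (t : R), t \in `[0, 1] ->
     ev t (V (h (alpha a) ** d)) = beta (ev t (h a)) ** ev t (V d)) ->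
  exists u : R -> self_mod B -> self_mod B,
    [/\ forall t : R, t \in `[0, 1] -> umap (u t),
        forall (t : R) d, t \in `[0, 1] -> ev t (V d) = u t (ev t d),
        forall b, pcont (u ^~ b) &
        forall (t : R) a b, t \in `[0, 1] ->
          u t (ev t (h (alpha a)) ** b) = beta (ev t (h a)) ** u t b].
Proof.
move=> hV VI; have [lV iV sV] := hV; have [c hc] := path_cst D.
have clin_c : linear c by move=> k a b; apply: ev_inj => t tI; rewrite sfun_lin !hc.
pose u (t : R) (b : self_mod B) : self_mod B := ev t (V (c b)).
have iVt (t : R) (x y : D) : t \in `[0, 1] ->
    star (ev t (V x)) ** ev t (V y) = star (ev t x) ** ev t y.
  by move=> tI; rewrite -!sfunS -!Defs.sfunM; congr (ev t _); exact: iV.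
have uE (t : R) d : t \in `[0, 1] -> ev t (V d) = u t (ev t d).
  move=> tI; apply/eqP; rewrite -subr_eq0; apply/eqP; apply: cstar_eq0.
  rewrite /u -evB -(linear_funB lV) iVt //.
  by rewrite evB hc // subrr cmul0r.
exists u; split=> //.
- move=> t tI; split=> [k x y|x y|y].
  + by rewrite /u clin_c lV sfun_lin.
  + by rewrite /ip /= iVt // !hc.
  + by have [d hd] := sV (c y); exists (ev t d); rewrite -uE // hd hc.
- by move=> b; exact: path_pcont.
- move=> t a b tI; rewrite -[b in LHS](hc b t) // -Defs.sfunM -uE // VI //.
Qed.

End PathOfHoms.

(** * The two ends of the homotopy *)

Section Endpoints.
Context (R : realType) (A B : cstarAlg R).

(** Through W, B acts on G by compact operators, and these all come from A; faithfulness of the two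
    actions gives bijectivity. *)
Lemma imprimitivity_bij (k : starHom A B) (G : corr A B) (W : self_mod B -> G) :
  umap W -> (forall a x, W (k a ** x) = lact a (W x)) -> sigma_unital B ->
  imprimitivity G -> bijective k.
Proof.
move=> hW Wk sB [_ _ inj surj]; have [V [hV WV VW _]] := umap_adj hW.
have kinj : injective k.
  move=> a b e; apply: inj => y; rewrite -(VW y) -!Wk e //.
have /choice [g gK] (b : B) : exists a, k a = b.
  have cS := compact_umap (S := fun y => W (b ** V y)) hV _ (lmul_compact b sB).
  have [|a ha] := surj _ (cS _); first by move=> y; rewrite WV.
  exists a; apply: lmul_inj => x; apply: (umap_inj hW).
  by rewrite Wk -ha WV.
by exists g => // a; apply: kinj; rewrite gK.
Qed.

Context (D : path_alg B) (E : corr A D) (p : nat -> nat -> nat -> B).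
Hypothesis pB : amu p.
Local Notation ev := (pa_ev D).

Section StartHom.
Context (f : starHom A B) (t : R) (T : tensor E (hom_corr (ev t))) (Psi : T -> hom_corr f).
Hypotheses (tI : t \in `[0, 1]) (hPsi : unitary_iso Psi).

(** W is the unitary of M(B) by which U and [Psi] differ over t; U is composed with its inverse,
    acting as a constant path. *)
Lemma normalise (U : self_mod D -> E) : umap U -> Defs.proper E ->
  exists U' : self_mod D -> E, umap U' /\
    forall d b, Psi (tens T (U' d) b) = ev t d ** b :> B.
Proof.
move=> hU /(compact_lact_hom hU) [h Uh].
have [W [hW WP _]] := fibre_umap pB hU Uh tI hPsi.
have [V [hV WV VW _]] := umap_adj hW.
have [DV [hDV DVE]] := path_umap D (W := V) hV.
exists (fun d => U (DV d)); split; first exact: umap_comp hDV hU.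
move=> d b; rewrite -WP DVE //.
have := @umap_ract _ _ (self_mod B) _ W (V (ev t d)) b hW; rewrite VW.
exact.
Qed.

Lemma start_hom (U : self_mod D -> E) (h : starHom A D) : umap U ->
  (forall a d, U (h a ** d) = lact a (U d)) ->
  (forall d b, Psi (tens T (U d) b) = ev t d ** b :> B) ->
  forall a, ev t (h a) = f a.
Proof.
move=> hU Uh PE; have [W [hW WP Wh]] := fibre_umap pB hU Uh tI hPsi.
have [c hc] := path_cst D; have [lW _ _] := hW.
have Wid (x : B) : W x = x.
  apply: (amu_lmul pB (P := fun x => W x = x)) => [|j k y].
    apply: (@clin_eq _ B B W id) => //; first exact: (umap_bounded hW).
    by exists 1 => y; rewrite mul1r.
  by rewrite -(hc (p j j k) t) // WP PE.
by move=> a; apply: lmul_inj => x; have := Wh a x; rewrite !Wid.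
Qed.

End StartHom.

Section StartUnitary.
Context (alpha : starHom A A) (beta : starHom B B) (f : starHom A B) (u : multiplier B).
Context (IX : path_corr D (hom_corr beta)) (PH : one_arrow (hom_corr alpha) IX E).
Context (PF : one_arrow (hom_corr alpha) (hom_corr beta) (hom_corr f)).
Context (t : R) (fib : fibre PH t) (tau : two_arrow (fib_arrow fib) PF).
Context (U : self_mod D -> E) (h : starHom A D).
Context (Psi2 : oa_FX PH -> self_mod D) (V : self_mod D -> self_mod D).
Hypotheses (tI : t \in `[0, 1]) (beta_aut : bijective beta) (hU : umap U).
Hypothesis PF_u : is_Phi_u u PF.
Hypothesis tauE : forall d b,
  ta_Psi tau (tens (fib_corr fib) (U d) b) = ev t d ** b :> B.
Hypothesis hPsi2 : umap Psi2.
Hypothesis Psi2E : forall (d : D) (x : IX), ev t (Psi2 (tens (oa_FX PH) (U d) x)) =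
  beta (ev t d) ** (@pc_ev _ _ _ _ IX t x : B).
Hypothesis VE : forall a d, V (h a ** d) = Psi2 (oa_Phi (tens (oa_YF PH) a (U d))).

(** The tensor (a (x) U d) (x) b is chased through the square that defines the composite with ev_t.
    One side becomes V at t by [key2]; the other becomes u by [key1], the square of [tau] and the
    form of Phi_u. *)
Lemma start_unitary a d b : u (f a ** (ev t d ** b)) = ev t (V (h a ** d)) ** b.
Proof.
have [bi [bK biK]] := starHom_inv beta_aut; have [c hc] := path_cst D.
have [i1 [i2 [[ui1 ui2] i1E i2E iPhi]]] := fib_evP fib.
have [Q1 [Q2 [[uQ1 uQ2] Q1E Q2E QPhi]]] := PF_u.
have [ZGF [GYF [GYF' [GFX [a1 [m1 [a2 [m2 [a3 [[A1 A2 A3] [M1 M2 sq]]]]]]]]]]] :=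
  fib_composite fib.
set Pev := fib_ev fib in i1 i2 ui1 ui2 i1E i2E iPhi GYF' GFX a2 m2 a3 A2 A3 M2 sq *.
have hi2 := unitary_iso_umap ui2; have [_ li2 _ ii2 si2] := ui2.
(* The isomorphism of H (x) (B_t (x) _beta B) with B. *)
have [|||chi [hchi chiE]] := @umap_extension _ B GFX (self_mod B) (D * oa_FX Pev)
   (fun j => tens GFX (U j.1) j.2) (fun j => beta (ev t j.1) ** (i2 j.2 : B)).
- exact: (tens_tot (T := GFX) (umap_total hU)).
- apply: totI => P cP hP; apply: (amu_lmul pB) => // j k x.
  have [y ey] := si2 x; have := hP (c (bi (p j j k)), y).
  by rewrite /= hc // biK ey.
- move=> [d1 y] [d2 y']; rewrite tens_ip (umap_ipE hU) -ii2 li2 /=.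
  rewrite /ip /= !Defs.sfunM !sfunS starM !cmulA //.
have chiE' d1 y : chi (tens GFX (U d1) y) = beta (ev t d1) ** (i2 y : B) := chiE (d1, y).
have [ha1 E1] := A1; have [ha2 E2] := A2; have [ha3 E3] := A3.
have [hm1 F1] := M1; have [hm2 F2] := M2.
have hT1 := ta_Psi1P tau; have [hT1u T1E] := hT1.
have [hT2u T2E] := ta_1PsiP tau.
have uchi1 : umap (fun y => chi (a3 y)) := umap_comp (unitary_iso_umap ha3) hchi.
have uQT : umap (fun y => Q2 (ta_Psi1 tau y)) :=
  umap_comp (unitary_iso_umap hT1u) (unitary_iso_umap uQ2).
(* Both sides send (U d (x) c) (x) x to beta(d(t) c) x. *)
have key1 (y : oa_FX (fib_arrow fib)) : Q2 (ta_Psi1 tau y) = chi (a3 y).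
  move: y; apply: (@tot_eq _ _ _ _ _ _ (fun y => chi (a3 y))
    (tens_tot (T := oa_FX (fib_arrow fib)) (U := id) (fun w => ex_intro _ w erefl))).
  - by case: uQT.
  - by case: uchi1.
  - exact: umap_bounded.
  - exact: umap_bounded.
  move=> [w x] /=; move: w.
  have lin (V1 : oa_FX (fib_arrow fib) -> self_mod B) : umap V1 ->
      linear (fun w => V1 (tens (oa_FX (fib_arrow fib)) w x)) /\
      bounded_fun (fun w => V1 (tens (oa_FX (fib_arrow fib)) w x)).
    move=> hV1; have [lV1 _ _] := hV1; split.
      by move=> k w w'; rewrite (tens_linear_l (oa_FX (fib_arrow fib))) lV1.
    have [r hr] := tens_bounded_l (oa_FX (fib_arrow fib)) x.
    by exists r => w; rewrite (umap_nrm _ hV1).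
  have [l1 b1] := lin _ uQT; have [l2 b2] := lin _ uchi1.
  apply: (tot_eq (tens_tot (T := fib_corr fib) (umap_total hU)) l1 l2 b1 b2).
  move=> [d1 b1'] /=; rewrite T1E Q2E tauE E3 chiE' i2E /=.
  by rewrite Defs.sfunM cmulA.
have umc : umap (fun w => chi (m2 (a2 w))).
  exact: umap_comp (unitary_iso_umap ha2) (umap_comp (unitary_iso_umap hm2) hchi).
(* Both sides send U d (x) x to beta(d(t)) x(t) b; on the left this uses that eta_t is the identity
   of the fibre. *)
have key2 (w : oa_FX PH) : chi (m2 (a2 (tens GYF w b))) = ev t (Psi2 w) ** b.
  move: w; have [lmc _ _] := umc; have [lP2 _ _] := hPsi2.
  apply: (@tot_eq _ _ _ _ _ (fun w => chi (m2 (a2 (tens GYF w b))))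
    (fun w => ev t (Psi2 w) ** b) (tens_tot (T := oa_FX PH) (umap_total hU))).
  - by move=> k w w'; rewrite (tens_linear_l GYF) lmc.
  - by move=> k w w'; rewrite lP2 sfun_lin cmul_linl.
  - have [r hr] := tens_bounded_l GYF b; exists r => w.
    by rewrite (umap_nrm _ umc).
  - exists (nrm b) => w; apply: le_trans (nrmM _ _) _; rewrite mulrC ler_wpM2l ?nrm_ge0 //.
    by apply: le_trans (starHom_contr _ _) _; rewrite (umap_nrm _ hPsi2).
  - move=> [d1 x] /=; rewrite E2 F2 chiE' iPhi i1E Psi2E /=.
    by rewrite cmulA.
have := sq (tens ZGF (tens (oa_YF PH) a (U d)) b).
rewrite E1 F1 => /(congr1 chi); rewrite key2 -VE -key1 ta_square QPhi T2E Q1E tauE.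
by [].
Qed.

End StartUnitary.
End Endpoints.

(** * Crossed products *)

Section Multipliers.
Context (R : realType) (B : cstarAlg R).

Lemma unitary_op_umap (v : multiplier B) :
  unitary_op v -> umap (v : self_mod B -> self_mod B).
Proof.
move=> [vK Kv]; split=> [|x y|y]; last by exists (aadj v y).
- by apply: (adj_linear (S := aadj v)) => x y; exact: adjointP.
- by rewrite adjointP vK.
Qed.

Lemma umap_cmul (U : self_mod B -> self_mod B) (x y : B) :
  umap U -> U (x ** y) = U x ** y :> B.
Proof. exact: (@umap_ract _ _ (self_mod B) (self_mod B) U x y). Qed.

Lemma umap_unitary_op (U : self_mod B -> self_mod B) : umap U ->
  exists v : multiplier B, unitary_op v /\ forall x, v x = U x.
Proof.
move=> hU; have [V [_ UV VU adj]] := umap_adj hU.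
by exists (Adjointable adj).
Qed.

End Multipliers.

Section CrossedProducts.
Context (R : realType).
Implicit Types A B Q : cstarAlg R.

(** [ub] is the image of the unitary u in the multiplier algebra of the crossed product. *)
Definition extends B (beta : starHom B B) (P : crossed_product beta)
    (u : self_mod B -> self_mod B) (ub : self_mod P -> self_mod P) : Prop :=
  umap ub /\ forall b y, ub (cp_in P b ** y) = cp_in P (u b) ** y.

(** Expresses L(S_alpha) = S_beta u without extending L to multipliers. *)
Definition crossed_hom A B (alpha : starHom A A) (beta : starHom B B)
    (PA : crossed_product alpha) (PB : crossed_product beta) (h : starHom A B)
    (ub : self_mod PB -> self_mod PB) (L : starHom PA PB) : Prop :=
  (forall a, L (cp_in PA a) = cp_in PB (h a)) /\
  (forall x, L (cp_S PA x) = cp_S PB (ub (L x))).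

Lemma cp_S_umap B (beta : starHom B B) (P : crossed_product beta) :
  umap (cp_S P : self_mod P -> self_mod P).
Proof. by apply: unitary_op_umap; exact: cp_unitary. Qed.

Arguments cp_S_umap {B beta} P.

Lemma cp_in_tot B (beta : starHom B B) (P : crossed_product beta) :
  tot (fun j : B * P => cp_in P j.1 ** j.2).
Proof.
apply: totI => Q cQ hQ x.
apply: (dense_total (@cp_nondegenerate _ _ _ P)) => // _ [b [y ->]].
exact: (hQ (b, y)).
Qed.

Arguments cp_in_tot {B beta} P.

Lemma extends_exists B (beta : starHom B B) (P : crossed_product beta) u :
  umap u -> exists ub, @extends B beta P u ub.
Proof.
move=> hu; have [_ iu su] := hu.
have iu' (b b' : B) : star (u b : B) ** (u b' : B) = star b ** b' := iu b b'.
have [||[b y] [b' y']|ub [hub E]] := @umap_extension _ P (self_mod P) (self_mod P) (B * P)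
   (fun j => cp_in P j.1 ** j.2) (fun j => cp_in P (u j.1) ** j.2).
- exact: cp_in_tot.
- apply: totI => Q cQ hQ; apply: (totP (cp_in_tot P)) => // -[b y] /=.
  by have [b' <-] := su b; exact: (hQ (b', y)).
- rewrite /ip /= !starM -!sfunS -!cmulA ![cp_in P _ ** (cp_in P _ ** _)]cmulA.
  by rewrite -!Defs.sfunM iu'.
by exists ub; split=> // b y; exact: (E (b, y)).
Qed.

Lemma comp_linear (V W Z : completeNormedModType R[i]) (f : V -> W) (g : W -> Z) :
  linear f -> linear g -> linear (fun x => g (f x)).
Proof. by move=> lf lg k x y; rewrite lf lg. Qed.

Lemma comp_bounded (V W Z : completeNormedModType R[i]) (f : V -> W) (g : W -> Z) :
  bounded_fun f -> bounded_fun g -> bounded_fun (fun x => g (f x)).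
Proof.
move=> [c hc] [d hd]; exists (`|d| * c) => x; apply: le_trans (hd _) _.
have := hc x; have := nrm_ge0 (f x); have := ler_norm d; have := normr_ge0 d.
rewrite -mulrA => d0 dd f0 h; apply: le_trans (ler_wpM2r f0 dd) _.
exact: ler_wpM2l.
Qed.

Lemma starHom_bounded A B (f : starHom A B) : bounded_fun f.
Proof. by exists 1 => x; rewrite mul1r; exact: starHom_contr. Qed.

Lemma umap_linear B (X Y : hilbMod B) (U : X -> Y) : umap U -> linear U.
Proof. by case. Qed.

Lemma in_tot_eq B (beta : starHom B B) (P : crossed_product beta)
    (V : completeNormedModType R[i]) (f g : P -> V) :
  linear f -> linear g -> bounded_fun f -> bounded_fun g ->
  (forall b y, f (cp_in P b ** y) = g (cp_in P b ** y)) -> forall x, f x = g x.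
Proof.
move=> lf lg bf bg e; apply: (tot_eq (cp_in_tot P) lf lg bf bg) => -[b y].
exact: e.
Qed.

(** The pair (h, S_beta u) is covariant: h(a) S_beta u = S_beta beta(h(a)) u = S_beta u
    h(alpha(a)). *)
Lemma crossed_exists A B (alpha : starHom A A) (beta : starHom B B)
    (PA : crossed_product alpha) (PB : crossed_product beta) (h : starHom A B) u ub :
  @extends B beta PB u ub ->
  (forall a b, u (h (alpha a) ** b) = beta (h a) ** u b) ->
  exists L, @crossed_hom A B alpha beta PA PB h ub L.
Proof.
move=> [hub ubE] hu; have hS := cp_S_umap PB.
have [v [uv vE]] := umap_unitary_op (umap_comp hub hS).
have cov a x : cmul (starHom_comp (cp_in PB) h a) (v x) =
    v (cmul (starHom_comp (cp_in PB) h (alpha a)) x).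
  rewrite !vE /= cp_covariant; congr (cp_S PB _); move: x.
  have lub := umap_linear hub; have bub := umap_bounded hub.
  apply: in_tot_eq => [||||b y].
  - exact: (comp_linear lub (cmul_linear_r _)).
  - exact: (comp_linear (cmul_linear_r (cp_in PB (h (alpha a)))) lub).
  - exact: (comp_bounded bub (cmul_bounded _)).
  - exact: (comp_bounded (cmul_bounded (cp_in PB (h (alpha a)))) bub).
  - by rewrite ubE !cmulA -!Defs.sfunM ubE hu.
have [L [L1 L2]] := cp_universal PA uv cov.
by exists L; split=> // x; rewrite L2 vE.
Qed.

(** Induction on n for S^n a, and for S^-n a after cancelling W. W stands for S_alpha, S_beta u or z
    S_beta u, according to the use. *)
Lemma crossed_uniq A (alpha : starHom A A) (PA : crossed_product alpha) Q
    (L1 L2 : starHom PA Q) (W : Q -> Q) : injective W ->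
  (forall a, L1 (cp_in PA a) = L2 (cp_in PA a)) ->
  (forall x, L1 (cp_S PA x) = W (L1 x)) -> (forall x, L2 (cp_S PA x) = W (L2 x)) ->
  forall x, L1 x = L2 x.
Proof.
move=> iW e0 e1 e2; apply: (dense_total (@cp_dense _ _ _ PA)).
  by apply: clin_eq; (exact: sfun_lin || exact: starHom_bounded).
have [_ SS] := cp_unitary PA.
move=> _ [n [a [->|->]]]; elim: n => [|n IH] //=.
- by rewrite e1 e2 IH.
- by apply: iW; rewrite -e1 -e2 !SS.
Qed.

Lemma clin_pcont (V W : completeNormedModType R[i]) (F : R -> V -> W) :
  (forall t : R, t \in `[0, 1] -> linear (F t)) ->
  (forall (t : R) x, t \in `[0, 1] -> nrm (F t x) <= nrm x) ->
  clin (fun x => pcont (F ^~ x)).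
Proof.
move=> lF nF; split.
- apply: (pcont_ext _ (pcont_const 0)) => t tI.
  by rewrite (linear_fun0 (lF t tI)).
- move=> k x y cx cy; apply: (@pcont_ext _ _ (fun t => k *: F t x + F t y)).
    by move=> t tI; rewrite lF.
  by apply: pcontD => //; exact: pcontZ.
- move=> x /approx_seq [w [cw hw]]; apply: (pcont_lim cw) => e /hw [N hN].
  exists N => t tI; rewrite -(linear_funB (lF t tI)).
  exact: le_lt_trans (nF t _ tI) (hN N (leqnn N)).
Qed.

Lemma extends_pcont B (beta : starHom B B) (P : crossed_product beta)
    (u : R -> self_mod B -> self_mod B) (ub : R -> self_mod P -> self_mod P) :
  (forall t : R, t \in `[0, 1] -> extends (u t) (ub t)) ->
  (forall b, pcont (u ^~ b)) -> forall y, pcont (ub ^~ y).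
Proof.
move=> hub cu; apply: (totP (cp_in_tot P)) => [|[b y]].
  apply: clin_pcont => [t tI|t x tI]; have [h _] := hub t tI.
  - exact: (umap_linear h).
  - by rewrite (umap_nrm _ h).
apply: (@pcont_ext _ P (fun t => cp_in P (u t b) ** y)).
  by move=> t tI; have [_ ->] := hub t tI.
apply: (@pcont_map _ B P (fun b => cp_in P b ** y) (nrm y)) => // x x'.
rewrite -cmulNl -cmulDl -(linear_funB (sfun_lin _)) mulrC.
apply: le_trans (nrmM _ _) _; rewrite ler_wpM2r ?nrm_ge0 //.
exact: starHom_contr.
Qed.

Lemma crossed_pcont A B (alpha : starHom A A) (beta : starHom B B)
    (PA : crossed_product alpha) (PB : crossed_product beta)
    (L : R -> starHom PA PB) (W : R -> self_mod PB -> self_mod PB) :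
  (forall t : R, t \in `[0, 1] -> umap (W t)) ->
  (forall y, pcont (W ^~ y)) ->
  (forall a, pcont (fun t => L t (cp_in PA a))) ->
  (forall (t : R) x, t \in `[0, 1] -> L t (cp_S PA x) = W t (L t x)) ->
  forall x, pcont (fun t => L t x).
Proof.
move=> hW cW c0 LS; have [_ SS] := cp_unitary PA.
apply: (dense_total (@cp_dense _ _ _ PA)).
  by apply: clin_pcont => [t _|t x _]; [exact: sfun_lin|exact: starHom_contr].
have lip (t : R) : t \in `[0, 1] -> forall x y, nrm (W t x - W t y) = nrm (x - y).
  by move=> tI x y; rewrite -(linear_funB (umap_linear (hW t tI))) (umap_nrm _ (hW t tI)).
move=> _ [n [a [->|->]]]; elim: n => [|n IH] //=.
- apply: (@pcont_ext _ _ (fun t => W t (L t (iter n (cp_S PA) (cp_in PA a))))).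
    by move=> t tI; rewrite LS.
  apply: (@pcont_app _ (self_mod PB) (self_mod PB) W 1) => //.
  by move=> t tI x y; rewrite mul1r lip.
(* For inverse powers the isometry W_s is applied to z_s - z_t: W_s z_s = L_s x and W_s z_t both
   tend to L_t x = W_t z_t as s tends to t. *)
- move: (iter n _ _) IH => x cx t tI e e0; have e2 : 0 < e / 2 by lra.
  set z := fun t => L t (aadj (cp_S PA) x).
  have Wz s : s \in `[0, 1] -> W s (z s) = L s x by move=> sI; rewrite -LS // SS.
  have [d d0 hd] := cx t tI _ e2; have [b b0 hb] := cW (z t) t tI _ e2.
  exists (Num.min d b) => [|s sI]; first by rewrite lt_min d0.
  rewrite lt_min => /andP[/(hd _ sI) h1 /(hb _ sI) h2].
  rewrite -(lip s sI) Wz //; apply: le_lt_trans (nrm_trans _ (L t x) _) _.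
  by rewrite -[X in nrm (X - W s _)](Wz t tI) [nrm (W t _ - _)]nrmB; lra.
Qed.

Lemma extends_dual B (beta : starHom B B) (P : crossed_product beta) u ub
    (gamma : R[i] -> starHom P P) (z : R[i]) : @extends B beta P u ub ->
  is_dual_action gamma -> `|z| = 1 -> forall y, gamma z (ub y) = ub (gamma z y).
Proof.
move=> [hub ubE] hg z1; have [g1 _] := hg z z1.
have lub := umap_linear hub; have bub := umap_bounded hub.
apply: in_tot_eq => [||||b y].
- exact: (comp_linear lub (sfun_lin _)).
- exact: (comp_linear (sfun_lin (gamma z)) lub).
- exact: (comp_bounded bub (starHom_bounded _)).
- exact: (comp_bounded (starHom_bounded (gamma z)) bub).
- by rewrite ubE !Defs.sfunM !g1 ubE.
Qed.

(** L gamma_z and gamma_z L agree on A and both send S_alpha to z S_beta u, because the dual action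
    fixes u. *)
Lemma crossed_equivariant A B (alpha : starHom A A) (beta : starHom B B)
    (PA : crossed_product alpha) (PB : crossed_product beta) (h : starHom A B) u ub L
    (gammaA : R[i] -> starHom PA PA) (gammaB : R[i] -> starHom PB PB) :
  @extends B beta PB u ub -> crossed_hom h ub L ->
  is_dual_action gammaA -> is_dual_action gammaB -> equivariant gammaA gammaB L.
Proof.
move=> hub [L1 L2] hA hB z z1; have [a1 a2] := hA z z1; have [b1 b2] := hB z z1.
have z0 : z != 0 by rewrite -normr_eq0 z1 oner_eq0.
apply: (@crossed_uniq _ _ PA _ (starHom_comp L (gammaA z)) (starHom_comp (gammaB z) L)
  (fun y => z *: cp_S PB (ub y))) => [x y|a|x|x] /=.
- by have [hu _] := hub => /(scalerI z0) /(umap_inj (cp_S_umap PB)) /(umap_inj hu).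
- by rewrite a1 L1 b1.
- by rewrite a2 (linear_funZ (sfun_lin _)) L2.
- by rewrite L2 b2 (extends_dual hub hB z1).
Qed.

(** The last hypothesis says that v k(u) = 1. Hence M L sends S_alpha to S_alpha v k(u) = S_alpha,
    and it fixes A. *)
Lemma crossed_cancel A B (alpha : starHom A A) (beta : starHom B B)
    (PA : crossed_product alpha) (PB : crossed_product beta)
    (h : starHom A B) (k : starHom B A) u ub v vb L M :
  @extends B beta PB u ub -> @extends A alpha PA v vb ->
  crossed_hom h ub L -> crossed_hom k vb M ->
  cancel h k -> (forall b, v (k (u b)) = k b) -> cancel L M.
Proof.
move=> [hub ubE] [hvb vbE] [L1 L2] [M1 M2] hk vk x.
pose i : starHom PA PA := @StarHom R PA PA id (fun (k : R[i]) (a b : PA) => erefl)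
  (fun a b => erefl) (fun a => erefl).
have lub := umap_linear hub; have bub := umap_bounded hub.
have lvb := umap_linear hvb; have bvb := umap_bounded hvb.
have key y : vb (M (ub y)) = M y.
  move: y; apply: in_tot_eq => [||||b y].
  - exact: (comp_linear (comp_linear lub (sfun_lin M)) lvb).
  - exact: sfun_lin.
  - exact: (comp_bounded (comp_bounded bub (starHom_bounded M)) bvb).
  - exact: starHom_bounded.
  - by rewrite ubE !Defs.sfunM !M1 vbE vk.
apply: (@crossed_uniq _ _ PA _ (starHom_comp M L) i (cp_S PA) (umap_inj (cp_S_umap PA)))
  => [a|y|y] //=.
- by rewrite L1 M1 hk.
- by rewrite L2 M2 key.
Qed.

(** The inverse belongs to the pair formed by k = h^-1 and the unitary v, the image of u^* under
    k. *)
Lemma crossed_bijective A B (alpha : starHom A A) (beta : starHom B B)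
    (PA : crossed_product alpha) (PB : crossed_product beta) (h : starHom A B) u ub
    (L : starHom PA PB) :
  bijective h -> umap u -> @extends B beta PB u ub -> crossed_hom h ub L ->
  (forall a b, u (h (alpha a) ** b) = beta (h a) ** u b) -> bijective L.
Proof.
move=> /starHom_inv [k [hk kh]] hu hub hL hh.
have [w [hw uw wu _]] := umap_adj hu; have [lw iw sw] := hw.
have iw' (b b' : B) : star (w b : B) ** (w b' : B) = star b ** b' := iw b b'.
pose v (a : self_mod A) : self_mod A := k (w (h a)).
have hv : umap v.
  split=> [c x y|x y|y].
  - by rewrite /v sfun_lin lw sfun_lin.
  - by rewrite /v /ip /= -sfunS -Defs.sfunM iw' -sfunS -Defs.sfunM hk.
  - by exists (k (u (h y))); rewrite /v kh uw hk.
have [vb hvb] := extends_exists PA hv.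
have [|M hM] := crossed_exists PB (h := k) hvb.
  move=> b a; rewrite /v Defs.sfunM kh -[b in RHS]kh.
  rewrite -[alpha _]hk -Defs.sfunM hk; congr (k _); apply: (umap_inj hu).
  by rewrite hh !wu kh.
exists M.
- by apply: (crossed_cancel hub hvb hL hM hk) => b; rewrite /v kh uw.
- by apply: (crossed_cancel hvb hub hM hL kh) => a; rewrite /v kh wu.
Qed.

(** The values on S a determine those on S (a y) by right linearity of the unitaries, and the
    products a y are total. *)
Lemma is_crossed_hom_extends A B (alpha : starHom A A) (beta : starHom B B)
    (PA : crossed_product alpha) (PB : crossed_product beta) (f : starHom A B)
    (u : multiplier B) ub (g : starHom PA PB) :
  @extends B beta PB u ub -> is_crossed_hom f u g -> crossed_hom f ub g.
Proof.
move=> [hub ubE] [g1 g2]; split=> //.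
have hA := cp_S_umap PA; have hB := cp_S_umap PB.
have lub := umap_linear hub; have bub := umap_bounded hub.
apply: in_tot_eq => [||||a y].
- exact: (comp_linear (umap_linear hA) (sfun_lin g)).
- exact: (comp_linear (comp_linear (sfun_lin g) lub) (umap_linear hB)).
- exact: (comp_bounded (umap_bounded hA) (starHom_bounded g)).
- exact: (comp_bounded (comp_bounded (starHom_bounded g) bub) (umap_bounded hB)).
have eA : cp_S PA (cp_in PA a ** y) = cp_S PA (cp_in PA a) ** y := umap_cmul _ _ hA.
have eB : cp_S PB (cp_in PB (u (f a)) ** g y) = cp_S PB (cp_in PB (u (f a))) ** g y :=
  umap_cmul _ _ hB.
by rewrite eA !Defs.sfunM g2 g1 ubE eB.
Qed.

End CrossedProducts.

Theorem proposition5p8 (R : realType) (A B : cstarAlg R)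
  (alpha : starHom A A) (beta : starHom B B)
  (alpha_aut : bijective alpha) (beta_aut : bijective beta)
  (objA : is_object (hom_corr alpha)) (objB : is_object (hom_corr beta))
  (stableA : stable A) (stableB : stable B)
  (sunitalA : sigma_unital A) (sunitalB : sigma_unital B)
  (f : starHom A B) (f_nondeg : hom_nondegenerate f)
  (u : multiplier B) (u_unitary : unitary_op u)
  (f_u : intertwines alpha beta f u)
  (PF : one_arrow (hom_corr alpha) (hom_corr beta) (hom_corr f))
  (PF_u : is_Phi_u u PF)
  (G : corr A B) (PG : one_arrow (hom_corr alpha) (hom_corr beta) G)
  (G_equiv : imprimitivity G)
  (H : homotopy PF PG)
  (PA : crossed_product alpha) (PB : crossed_product beta)
  (gammaA : R[i] -> starHom PA PA) (gammaB : R[i] -> starHom PB PB)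
  (dualA : is_dual_action gammaA) (dualB : is_dual_action gammaB)
  (fu : starHom PA PB) (fu_def : is_crossed_hom f u fu) :
  exists g : starHom PA PB,
    bijective g /\ equivariantly_homotopic gammaA gammaB fu g.
Proof.
have I0 : (0 : R) \in `[0, 1] by rewrite in_itv /= lexx ler01.
have I1 : (1 : R) \in `[0, 1] by rewrite in_itv /= lexx ler01.
have [m mA] := stable_amu stableA sunitalA; have [p pB] := stable_amu stableB sunitalB.
case: H => D IX E PH fib0 fib1 tau0 tau1.
have [q qD] := amu_path D pB.
have [Efull Eprop End] := And3 (oa_full PH) (oa_proper PH) (oa_nondegenerate PH).
have [U0 hU0] := trivialization Efull Eprop End mA qD.
have [U [hU tau0E]] := normalise pB I0 (ta_unitary tau0) hU0 Eprop.
have [h Uh] := compact_lact_hom hU Eprop.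
have h0 := start_hom pB I0 (ta_unitary tau0) hU Uh tau0E.
have [Psi2 [hPsi2 Psi2E]] := right_identification PH beta_aut pB hU.
have [V [hV VE VI]] := path_unitary hU Uh hPsi2 Psi2E End.
have [ut [hut utE utc utI]] := fibre_unitaries hV VI.
have hu := unitary_op_umap u_unitary.
have u0 b : ut 0 b = u b.
  have [c hc] := path_cst D; have lu := umap_linear hu.
  have lut := umap_linear (hut 0 I0).
  have cl : clin (fun b : B => ut 0 b = u b).
    exact: (@clin_eq _ B B (ut 0) u lut lu (umap_bounded (hut 0 I0)) (umap_bounded hu)).
  (* Since f is nondegenerate, vectors f(a) p_jj x suffice, and [start_unitary] covers them with d
     the constant path p_jj. *)
  apply: (dense_total f_nondeg cl) => _ [a [x ->]]; move: x.
  apply: (amu_lmul pB (P := fun x => ut 0 (f a ** x) = u (f a ** x))) => [|j k x].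
    exact: (@clin_preim _ _ _ (fun x => f a ** x) _ (cmul_linear_r _) (cmul_bounded _) cl).
  have := start_unitary pB I0 beta_aut hU PF_u tau0E hPsi2
    (fun d y => Psi2E d y 0 I0) VE a (c (p j j k)) x.
  rewrite utE // Defs.sfunM hc // h0 => ->.
  by rewrite -(umap_cmul _ _ (hut 0 I0)) cmulA.
have /choice [ub hub] (t : R) : exists ub : self_mod PB -> self_mod PB,
    t \in `[0, 1] -> extends (ut t) ub.
  (* Outside [0,1] an arbitrary value is taken, here [id] and below [fu]. *)
  have [tI|nI] := boolP (t \in `[0, 1]); last by exists id.
  by have [ub h'] := extends_exists PB (hut t tI); exists ub.
pose ht t := starHom_comp (pa_ev D t) h.
have /choice [L hL] (t : R) : exists L : starHom PA PB,
    t \in `[0, 1] -> crossed_hom (ht t) (ub t) L.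
  have [tI|nI] := boolP (t \in `[0, 1]); last by exists fu.
  have [|L h'] := crossed_exists PA (h := ht t) (hub t tI); last by exists L.
  by move=> a b; exact: utI.
exists (L 1); split.
  apply: (crossed_bijective _ (hut 1 I1) (hub 1 I1) (hL 1 I1)); last first.
    by move=> a b; exact: utI.
  have [W [hW _ Wh]] := fibre_umap pB hU Uh I1 (ta_unitary tau1).
  exact: (imprimitivity_bij (k := ht 1) hW Wh sunitalB G_equiv).
exists L; split=> // [x|t tI|x].
- apply/within_pcont; move: x.
  pose W t y := cp_S PB (ub t y).
  have hW (t : R) : t \in `[0, 1] -> umap (W t : self_mod PB -> self_mod PB).
    by move=> tI; have [h' _] := hub t tI; exact: umap_comp h' (cp_S_umap PB).
  apply: (crossed_pcont hW) => [y|a|t x tI].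
  + apply: (@pcont_map _ (self_mod PB) (self_mod PB) (cp_S PB) 1) => [y1 y2|].
      rewrite mul1r -(linear_funB (umap_linear (cp_S_umap PB))).
      by rewrite (umap_nrm _ (cp_S_umap PB)).
    exact: (extends_pcont hub utc).
  + apply: (@pcont_ext _ PB (fun t => cp_in PB (pa_ev D t (h a)))).
      by move=> t tI; have [-> _] := hL t tI.
    apply: (@pcont_map _ B PB (cp_in PB) 1); last exact: path_pcont.
    by move=> x y; rewrite mul1r -(linear_funB (sfun_lin _)); exact: starHom_contr.
  + by have [_ ->] := hL t tI.
- exact: (crossed_equivariant (hub t tI) (hL t tI)).
(* [fu] and [L 0] satisfy the same equations on A and S_alpha, as h_0 = f and u_0 = u. *)
- have [hub0 ub0E] := hub 0 I0.
  have ext0 : extends (u : self_mod B -> self_mod B) (ub 0).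
    by split=> // b y; rewrite ub0E u0.
  have [fu1 fu2] := is_crossed_hom_extends ext0 fu_def; have [L1 L2] := hL 0 I0.
  apply: (@crossed_uniq _ _ _ PA PB _ _ (fun y => cp_S PB (ub 0 y))) => // [y1 y2|a].
    by move=> /(umap_inj (cp_S_umap PB)) /(umap_inj hub0).
  by rewrite fu1 L1 /ht /= h0.
Qed.
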